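(* Let $(X_t)$ be a Lévy process on $\mathbb{R}^{2n}$ with $\mathbb{E}[e^{i\langle X_t,u\rangle}]=e^{t\varphi(u)}$, $$\varphi(u)=i\,m\cdot u-\frac12(au)\cdot u+\int_{\mathbb{R}^{2n}\setminus\{0\}}\Big(e^{iu\cdot y}-1-i\frac{u\cdot y}{1+|y|^2}\Big)d\rho(y),$$ whose diffusion matrix $a$ satisfies, for some $\delta>0$, $\frac12(au)\cdot u\ge\delta|u|^2$ for all $u\in\mathbb{R}^{2n}$. For $t>0$ let $\nu_t$ be the law of $X_t$. If $0<\varepsilon<4\delta$, then for each $t>0$ the convolution operator by the measure $\nu_t$ maps $L^\infty(\mathbb{R}^{2n})$ into $D_{\varepsilon t}(\mathbb{R}^{2n})$.
   Context: In the Lévy–Khintchine representation, $m\in\mathbb{R}^{2n}$, $a$ is a positive semidefinite real symmetric $2n\times2n$ matrix (the diffusion matrix), and $\rho$ is a measure on $\mathbb{R}^{2n}\setminus\{0\}$ with $\int\inf(1,|y|^2)\,d\rho(y)<+\infty$. Here $\nu_t(E)=\mathbb{P}[X_t\in E]$. For $\kappa>0$, $D_\kappa(\mathbb{R}^{2n})$ is the set of functions $F:\mathbb{R}^{2n}\to\mathbb{C}$ for which there is a real-analytic function $F^{\rm ext}(X,Y)$ on $\mathbb{R}^{2n}\times\mathbb{R}^{2n}$ (unique) such that, with $X=(x,\xi)$, $Y=(y,\eta)$, $x,\xi,y,\eta\in\mathbb{R}^n$: (1) $(\partial_{x_j}+i\partial_{\xi_j})F^{\rm ext}=0$ and $(\partial_{y_j}-i\partial_{\eta_j})F^{\rm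 ext}=0$ for $1\le j\le n$; (2) $F^{\rm ext}(X,X)=F(X)$; (3) there is $\psi_F\in L^1(\mathbb{R}^{2n})\cap L^\infty(\mathbb{R}^{2n})$ with $|F^{\rm ext}(X,Y)|\le e^{\frac1{4\kappa}|X-Y|^2}\psi_F(X-Y)$. *)

(* Defs.v *)
From HB Require Import structures.
From mathcomp Require Import all_boot all_order all_algebra.
From mathcomp Require Import all_classical all_reals all_analysis.
From mathcomp.real_closed Require Import complex.
From mathcomp.analysis.showcase Require summability.

Set Implicit Arguments.
Unset Strict Implicit.
Unset Printing Implicit Defensive.

Import Order.TTheory GRing.Theory Num.Theory.
Import numFieldNormedType.Exports.

Local Open Scope classical_set_scope.
Local Open Scope ring_scope.
Local Open Scope complex_scope.

Definition rV_display : measure_display.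
Proof. exact. Qed.

(* The sigma-algebra on R^N generated by the N coordinates, as the library does
   for tuples; it is the Borel sigma-algebra. *)
Section measurable_rV.
Context {R : realType} {N : nat}.

Let coors : 'I_N -> 'rV[R]_N -> R := fun i x => x 0 i.

Let rV_set0 : g_sigma_preimage coors set0.
Proof. exact: sigma_algebra0. Qed.

Let rV_setC A : g_sigma_preimage coors A -> g_sigma_preimage coors (~` A).
Proof. exact: sigma_algebraC. Qed.

Let rV_bigcup (F : _^nat) : (forall i, g_sigma_preimage coors (F i)) ->
  g_sigma_preimage coors (\bigcup_i (F i)).
Proof. exact: sigma_algebra_bigcup. Qed.

HB.instance Definition _ := @isMeasurable.Build rV_display
  'rV[R]_N (g_sigma_preimage coors) rV_set0 rV_setC rV_bigcup.

End measurable_rV.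

Section measurable_fun_rV.
Context {R : realType}.

Lemma measurable_coord N (i : 'I_N) :
  measurable_fun [set: 'rV[R]_N] (fun x : 'rV[R]_N => x 0 i).
Proof.
move=> _ Y mY; rewrite setTI; apply: sub_sigma_algebra => /=.
rewrite -bigcup_seq/=; exists i => /=; first by rewrite mem_index_enum.
by exists Y => //; rewrite setTI.
Qed.

Lemma measurable_fun_rV d (T : measurableType d) N (f : T -> 'rV[R]_N) :
  (forall i, measurable_fun [set: T] (fun x => f x 0 i)) ->
  measurable_fun [set: T] f.
Proof.
move=> mf; pose coors i (x : 'rV[R]_N) := x 0 i.
suff: g_sigma_preimage (fun i => coors i \o f) `<=` measurable.
  by rewrite g_sigma_preimage_comp => prefS _ A mA; apply: prefS; exists A.
apply: smallest_sub; first exact: sigma_algebra_measurable.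
rewrite -bigcup_seq; apply: bigcup_sub => i _ A [B mB <-].
exact: mf.
Qed.

End measurable_fun_rV.

Section lebesgue_rV.
Context {R : realType}.

Definition cons_rV N (p : R * 'rV[R]_N) : 'rV[R]_N.+1 := row_mx (p.1)%:M p.2.

Definition uncons_rV N (x : 'rV[R]_N.+1) : R * 'rV[R]_N :=
  (x 0 0, rsubmx (x : 'rV[R]_(1 + N))).

Lemma cons_rVK N : cancel (@cons_rV N) (@uncons_rV N).
Proof.
case=> a x; rewrite /uncons_rV /cons_rV row_mxKr; congr pair.
transitivity (row_mx a%:M x 0 (lshift N (0 : 'I_1))).
  by congr (row_mx _ _ _ _); exact/val_inj.
by rewrite row_mxEl mxE eqxx mulr1n.
Qed.

Lemma measurable_cons_rV N :
  measurable_fun [set: R * 'rV[R]_N] (@cons_rV N).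
Proof.
apply: measurable_fun_rV => i.
case: (@split_ordP 1 N i) => j ->.
  rewrite (_ : (fun=> _) = fst); first exact: measurable_fst.
  apply/funext => p; have := row_mxEl (p.1)%:M p.2 0 j.
  by rewrite [RHS]mxE !ord1 eqxx mulr1n.
rewrite (_ : (fun=> _) = (fun x : 'rV[R]_N => x 0 j) \o snd).
  exact: (measurableT_comp (measurable_coord j) measurable_snd).
by apply/funext => p; exact: row_mxEr.
Qed.

Lemma measurable_uncons_rV N :
  measurable_fun [set: 'rV[R]_N.+1] (@uncons_rV N).
Proof.
apply: measurable_fun_pair; first exact: measurable_coord.
apply: measurable_fun_rV => i.
under eq_fun do rewrite mxE.
exact: (measurable_coord (rshift 1 i)).
Qed.

Section cons_measure.
Local Open Scope ereal_scope.
Variables (N : nat) (mu : {sigma_finite_measure set 'rV[R]_N -> \bar R}).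

Definition cons_measure := pushforward (lebesgue_measure \x mu) (@cons_rV N).

Let cons_measure0 : cons_measure set0 = 0.
Proof. by rewrite /cons_measure /pushforward preimage_set0 measure0. Qed.

Let cons_measure_ge0 A : 0 <= cons_measure A.
Proof. by rewrite /cons_measure /pushforward measure_ge0. Qed.

Let mcons A : measurable A -> measurable (@cons_rV N @^-1` A).
Proof.
by move=> mA; rewrite -[X in measurable X]setTI; exact: measurable_cons_rV.
Qed.

Let cons_measure_sigma_additive : semi_sigma_additive cons_measure.
Proof.
move=> F mF tF mUF; rewrite /cons_measure /pushforward preimage_bigcup.
apply: measure_semi_sigma_additive.
- by move=> k; exact: mcons.
- apply/trivIsetP => /= i j _ _ ij; rewrite -preimage_setI.
  by move/trivIsetP : tF => /(_ _ _ _ _ ij) ->//; rewrite preimage_set0.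
- by rewrite -preimage_bigcup; exact: mcons.
Qed.

HB.instance Definition _ := isMeasure.Build _ _ _ cons_measure
  cons_measure0 cons_measure_ge0 cons_measure_sigma_additive.

Let cons_measure_sigma_finite : sigma_finite setT cons_measure.
Proof.
have /sigma_finiteP[F [TF ndF Foo]] := sigma_finiteT (@lebesgue_measure R).
have /sigma_finiteP[G [TG ndG Goo]] := sigma_finiteT mu.
exists (fun k => @uncons_rV N @^-1` (F k `*` G k)).
  rewrite predeqE => x; split=> // _.
  have [j _ Fj] : (\bigcup_k F k) (uncons_rV x).1 by rewrite -TF.
  have [k _ Gk] : (\bigcup_k G k) (uncons_rV x).2 by rewrite -TG.
  exists (maxn j k) => //; split.
  - by move: Fj; exact/subsetPset/ndF/leq_maxl.
  - by move: Gk; exact/subsetPset/ndG/leq_maxr.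
move=> k; have [mF Fkoo] := Foo k; have [mG Gkoo] := Goo k; split.
  rewrite -[X in measurable X]setTI; apply: measurable_uncons_rV => //.
  exact: measurableX.
rewrite /cons_measure /pushforward -comp_preimage.
rewrite (_ : _ \o _ = id) ?preimage_id; last first.
  by apply/funext => x; exact: cons_rVK.
by rewrite product_measure1E// lte_mul_pinfty// ge0_fin_numE.
Qed.

HB.instance Definition _ := Measure_isSigmaFinite.Build _ _ _ cons_measure
  cons_measure_sigma_finite.

End cons_measure.

(* Lebesgue measure on R^N, as the N-fold product of the Lebesgue measure on R. *)
Fixpoint lebesgue_rV N : {sigma_finite_measure set 'rV[R]_N -> \bar R} :=
  if N is N'.+1 then cons_measure (lebesgue_rV N')
  else dirac (0 : 'rV[R]_0).

End lebesgue_rV.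

Section euclidean.
Context {R : realType}.

Definition dot N (u v : 'rV[R]_N) : R := \sum_i u 0 i * v 0 i.

(* The library norm on 'rV[R]_N is the sup norm. *)
Definition enorm N (u : 'rV[R]_N) : R := Num.sqrt (dot u u).

(* [a u], for [u] a vector written as a row *)
Definition mxact N (a : 'M[R]_N) (u : 'rV[R]_N) : 'rV[R]_N := u *m a^T.

End euclidean.

Local Notation Re := (@complex.Re _).
Local Notation Im := (@complex.Im _).
Local Notation normc := ComplexField.Normc.normc.

Section complex_functions.
Context {R : realType}.

Definition cexp (z : R[i]) : R[i] :=
  (expR (Re z))%:C * (cos (Im z) +i* sin (Im z)).

Section integral.
Context {d : measure_display} {T : measurableType d}.

Definition cmeasurable (f : T -> R[i]) : Prop :=
  measurable_fun setT (Re \o f) /\ measurable_fun setT (Im \o f).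

Variable mu : {measure set T -> \bar R}.

Definition cintegrable (D : set T) (f : T -> R[i]) : Prop :=
  mu.-integrable D (EFin \o (Re \o f)) /\
  mu.-integrable D (EFin \o (Im \o f)).

Definition cintegral (D : set T) (f : T -> R[i]) : R[i] :=
  (\int[mu]_(x in D) Re (f x))%R +i* (\int[mu]_(x in D) Im (f x))%R.

End integral.

(* L^oo(R^N) for the Lebesgue measure, complex-valued *)
Definition Linfty N (f : 'rV[R]_N -> R[i]) : Prop :=
  cmeasurable f /\
  (fun x => normc (f x)) \in Lfun (lebesgue_rV N : measure _ _) +oo%E.

Definition cpartial N (i : 'I_N) (f : 'rV[R]_N -> R[i]) (x : 'rV[R]_N) : R[i] :=
  ('D_(delta_mx 0 i) (Re \o f) x) +i* ('D_(delta_mx 0 i) (Im \o f) x).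

Definition monomial N (alpha : {ffun 'I_N -> nat}) (h : 'rV[R]_N) : R :=
  \prod_i h 0 i ^+ alpha i.

(* Near every point, [f] is the sum of a power series that converges
   unconditionally, i.e. absolutely. *)
Definition real_analytic N (f : 'rV[R]_N -> R) : Prop :=
  forall x, exists c : {ffun 'I_N -> nat} -> R, \forall h \near (0 : 'rV[R]_N),
    summability.partial_sum (fun alpha => c alpha * monomial alpha h) @
      summability.totally --> f (x + h).

Definition creal_analytic N (f : 'rV[R]_N -> R[i]) : Prop :=
  real_analytic (Re \o f) /\ real_analytic (Im \o f).

End complex_functions.

Section Dspace.
Context {R : realType} {n : nat}.
Local Notation V := 'rV[R]_(n + n).

(* [X : V] is the pair [(x, xi)] with [x_j] at index [lshift n j] and [xi_j] at
   index [rshift n j]. *)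
Definition Dspace (kappa : R) (F : V -> R[i]) : Prop :=
  exists Fext : V -> V -> R[i],
  [/\ creal_analytic
        (fun Z : 'rV[R]_((n + n) + (n + n)) => Fext (lsubmx Z) (rsubmx Z)),
      forall (X Y : V) (j : 'I_n),
        cpartial (lshift n j) (Fext^~ Y) X
          + 'i%C * cpartial (rshift n j) (Fext^~ Y) X = 0 /\
        cpartial (lshift n j) (Fext X) Y
          - 'i%C * cpartial (rshift n j) (Fext X) Y = 0,
      forall X : V, Fext X X = F X &
      exists psi : V -> R,
        [/\ psi \in Lfun (lebesgue_rV (n + n) : measure _ _) 1%E,
            psi \in Lfun (lebesgue_rV (n + n) : measure _ _) +oo%E &
            forall X Y : V,
              normc (Fext X Y) <=
              expR ((4 * kappa)^-1 * enorm (X - Y) ^+ 2) * psi (X - Y)]].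

End Dspace.

Section convolution.
Context {R : realType} {N : nat}.
Local Notation V := 'rV[R]_N.
Variable nu : {measure set V -> \bar R}.

Definition conv (f : V -> R[i]) (x : V) : R[i] :=
  cintegral nu setT (fun y => f (x - y)).

(* The first two conjuncts say that [conv] is a well-defined operator on L^oo,
   whose elements are classes of functions modulo a.e. equality. *)
Definition conv_maps_Linfty_into (D : (V -> R[i]) -> Prop) : Prop :=
  [/\ forall f, Linfty f ->
        forall x, cintegrable nu setT (fun y => f (x - y)),
      forall f g, Linfty f -> Linfty g ->
        (\forall x \ae (lebesgue_rV N : measure _ _), f x = g x) ->
        conv f = conv g &
      forall f, Linfty f -> D (conv f)].

End convolution.

Section levy.
Context {R : realType} {N : nat}.
Local Notation V := 'rV[R]_N.

Section process.
Context {d : measure_display} {Omega : measurableType d}.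
Variable P : probability Omega R.

Definition independent_rvs k (Y : 'I_k -> Omega -> V) : Prop :=
  forall A : 'I_k -> set V, (forall j, measurable (A j)) ->
    fine (P (\big[setI/setT]_j (Y j @^-1` A j))) =
    \prod_j fine (P (Y j @^-1` A j)).

(* The process is indexed by the times [0 <= t]; its values at negative times
   are irrelevant.  Cadlag paths are not assumed, only the weaker stochastic
   continuity. *)
Record levy_process (X : R -> {RV P >-> V}) : Prop := {
  levy_start : P [set w | X 0 w = 0] = 1%E ;
  levy_independent_increments : forall k (t : nat -> R), 0 <= t 0%N ->
    (forall j, (j < k)%N -> t j <= t j.+1) ->
    independent_rvs (fun (j : 'I_k) w => X (t j.+1) w - X (t j) w) ;
  levy_stationary_increments : forall s t, 0 <= s -> s <= t ->
    forall A : set V, measurable A ->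
      P [set w | A (X t w - X s w)] = P [set w | A (X (t - s) w)] ;
  levy_stochastically_continuous : forall s, 0 <= s -> forall e, 0 < e ->
    P [set w | e < enorm (X t w - X s w)] @[t --> within [set t | 0 <= t] (nbhs s)]
      --> 0%E
}.

End process.

(* A measure on R^N \ {0} is encoded as a measure on R^N of which only the
   restriction to the complement of {0} is used. *)
Definition levy_measure (rho : {measure set V -> \bar R}) : Prop :=
  (\int[rho]_(y in ~` [set 0%R]) (Num.min 1 (enorm y ^+ 2))%:E < +oo)%E.

Definition levy_exponent (m : V) (a : 'M[R]_N)
    (rho : {measure set V -> \bar R}) (u : V) : R[i] :=
  'i%C * (dot m u)%:C - (2^-1 * dot (mxact a u) u)%:C
  + cintegral rho (~` [set 0]) (fun y =>
      cexp ('i%C * (dot u y)%:C) - 1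
      - 'i%C * (dot u y / (1 + enorm y ^+ 2))%:C).

End levy.

(* Main.v *)
Require Import Defs.
From HB Require Import structures.
From mathcomp Require Import all_boot all_order all_algebra finmap.
From mathcomp Require Import all_classical all_reals all_analysis.
From mathcomp.real_closed Require Import complex.
From mathcomp Require Import measurable_realfun ess_sup_inf ring lra.
From mathcomp.analysis.showcase Require summability.

Set Implicit Arguments.
Unset Strict Implicit.
Unset Printing Implicit Defensive.

Import Order.TTheory GRing.Theory Num.Theory.
Import numFieldNormedType.Exports.

Local Open Scope classical_set_scope.
Local Open Scope ring_scope.
Local Open Scope complex_scope.

(** The idea is to find a heat kernel inside [nu_t]. Its Fourier transform is
    [exp (t * phi)], and by ellipticity [phi u + delta |u|^2] is again a
    Lévy-Khintchine exponent. Choose [s] with [eps * t / 4 < s < delta * t] and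
    put [eta = delta * t - s > 0]; then
      [exp (t * phi u) = k u * exp (- eta |u|^2) * exp (- s |u|^2)]
    with [k = exp (t * (phi + delta |.|^2))], and [exp (- s |.|^2)] is the
    Fourier transform of the heat kernel [heat b], [b = 1 / (4 s)]. If [q] is
    the inverse Fourier transform of [k * exp (- eta |.|^2)], then
    [nu_t = heat b * q] and [nu_t * f = heat b * (q * f)].

    For bounded [f] the function [g = q * f] is bounded as soon as [q] is a
    probability density. Integrability of [q] is the delicate point, since [k]
    need not decay or be smooth. It follows from positivity: [q >= 0] because
    [k] is of positive type, and then Tonelli's theorem gives [q] the total
    mass of [nu_t]. That [k] is of positive type is proved from the explicit
    exponent. A function of positive type stays so when it is multiplied by the
    Fourier transform of a finite measure ([positive_type_mul]), hence by the
    exponential of such a transform ([positive_type_exp]), by a character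
    ([positive_type_shift]), or by the exponential of minus a sum of squares
    of linear forms ([positive_type_gauss_seq]), and under bounded pointwise
    limits ([positive_type_lim]). The diffusion part is such an exponential by
    [psd_sum_squares], and the jump part is the limit of its truncations to
    [|y| > 1 / n], which are compound Poisson ([positive_type_jump]).

    Since the transform of [nu_t] is dominated by a Gaussian, [nu_t] has the
    density given by Fourier inversion ([inversion]): smooth [nu_t] by narrow
    heat kernels, let the width tend to zero on boxes, and use that boxes
    determine a measure. This yields the factorisation [conv_is_heat].

    It remains to extend [heat b * g] ([heat_Dspace]). Its integrand is
    [exp (- b |X - z|^2) * g z], and with
    [herm X Y = \sum_j X_j * conj Y_j] the extension is
      [F X Y = K^-1 * \int exp (- b * herm (X - z) (Y - z)) * g z dz],
    holomorphic in [X] and antiholomorphic in [Y]. Real analyticity is obtained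
    by expanding the exponential of the quadratic polynomial in the increment
    into monomials and integrating term by term ([word_expansion]). The bound
    comes from
      [Re (herm (X - z) (Y - z)) = |z - (X + Y) / 2|^2 - |X - Y|^2 / 4]:
    the first term is integrated away and the second leaves
    [exp (|X - Y|^2 / (16 s))], which is [exp (|X - Y|^2 / (4 eps t))] times an
    integrable Gaussian because [4 s > eps * t].

    A function of [L^oo] equals a bounded one outside a Lebesgue null set, and
    [nu_t], being absolutely continuous, does not see the difference
    ([conv_maps_bounded]). *)

Local Notation Re := (@complex.Re _).
Local Notation Im := (@complex.Im _).
Local Notation normc := (@ComplexField.Normc.normc _).

(** * Complex numbers and the exponential *)

Section complex_prelim.
Context {R : realType}.
Implicit Types z w : R[i].

Lemma Re_add z w : Re (z + w) = Re z + Re w. Proof. by case: z w => [? ?] [? ?]. Qed.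
Lemma Im_add z w : Im (z + w) = Im z + Im w. Proof. by case: z w => [? ?] [? ?]. Qed.
Lemma Re_opp z : Re (- z) = - Re z. Proof. by case: z. Qed.
Lemma Im_opp z : Im (- z) = - Im z. Proof. by case: z. Qed.
Lemma Re_mul z w : Re (z * w) = Re z * Re w - Im z * Im w.
Proof. by case: z w => [? ?] [? ?]. Qed.
Lemma Im_mul z w : Im (z * w) = Re z * Im w + Im z * Re w.
Proof. by case: z w => [? ?] [? ?]. Qed.
Lemma ReC (x : R) : Re x%:C = x. Proof. by []. Qed.
Lemma ImC (x : R) : Im x%:C = 0. Proof. by []. Qed.
Lemma Re_rmul (x : R) z : Re (x%:C * z) = x * Re z.
Proof. by case: z => a b /=; rewrite mul0r subr0. Qed.
Lemma Im_rmul (x : R) z : Im (x%:C * z) = x * Im z.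
Proof. by case: z => a b /=; rewrite mul0r addr0. Qed.
Lemma Re_imul z : Re ('i%C * z) = - Im z.
Proof. by case: z => a b /=; rewrite mul0r mul1r sub0r. Qed.
Lemma Im_imul z : Im ('i%C * z) = Re z.
Proof. by case: z => a b /=; rewrite mul0r mul1r add0r. Qed.
Lemma complex_eqP z w : Re z = Re w -> Im z = Im w -> z = w.
Proof. by case: z w => [a b] [c d] /= -> ->. Qed.

Lemma Re_sum I (r : seq I) (P : pred I) (F : I -> R[i]) :
  Re (\sum_(i <- r | P i) F i) = \sum_(i <- r | P i) Re (F i).
Proof. by apply: (big_morph Re (id1 := 0)) => // ? ?; rewrite Re_add. Qed.

Lemma Im_sum I (r : seq I) (P : pred I) (F : I -> R[i]) :
  Im (\sum_(i <- r | P i) F i) = \sum_(i <- r | P i) Im (F i).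
Proof. by apply: (big_morph Im (id1 := 0)) => // ? ?; rewrite Im_add. Qed.

Lemma normc_sqr z : normc z ^+ 2 = Re z ^+ 2 + Im z ^+ 2.
Proof. by case: z => a b /=; rewrite sqr_sqrtr// addr_ge0// sqr_ge0. Qed.

Lemma normc_ge0 z : 0 <= normc z.
Proof. by case: z => a b; exact: sqrtr_ge0. Qed.

Lemma normcM z w : normc (z * w) = normc z * normc w.
Proof. exact: ComplexField.Normc.normcM. Qed.

Lemma normcD z w : normc (z + w) <= normc z + normc w.
Proof. exact: le_normcD. Qed.

Lemma normc_0 : normc 0 = 0 :> R. Proof. exact: ComplexField.Normc.normc0. Qed.
Lemma normc_1 : normc 1 = 1 :> R. Proof. exact: ComplexField.Normc.normc1. Qed.

Lemma normc_opp z : normc (- z) = normc z.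
Proof. exact: normcN. Qed.

Lemma normcB z w : normc (z - w) <= normc z + normc w.
Proof. by rewrite -(normc_opp w); exact: normcD. Qed.

Lemma normcBC z w : normc (z - w) = normc (w - z).
Proof. by rewrite -normc_opp opprB. Qed.

Lemma normc_real (x : R) : normc x%:C = `|x|.
Proof. by rewrite /= expr0n addr0 sqrtr_sqr. Qed.

Lemma normc_i : normc 'i%C = 1 :> R.
Proof. by rewrite /= expr0n add0r expr1n sqrtr1. Qed.

Lemma normc_sum I (r : seq I) (P : pred I) (F : I -> R[i]) :
  normc (\sum_(i <- r | P i) F i) <= \sum_(i <- r | P i) normc (F i).
Proof.
elim/big_ind2 : _ => [|x1 x2 y1 y2 h1 h2|//]; first by rewrite normc_0.
by apply: le_trans (lerD h1 h2); exact: normcD.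
Qed.

Lemma normc_prod I (r : seq I) (P : pred I) (F : I -> R[i]) :
  normc (\prod_(i <- r | P i) F i) = \prod_(i <- r | P i) normc (F i).
Proof.
by elim/big_ind2 : _ => [|x1 x2 y1 y2 <- <-|//]; rewrite ?normc_1 ?normcM.
Qed.

Lemma Re_le_normc z : `|Re z| <= normc z.
Proof.
rewrite -(@ler_pXn2r _ 2) ?nnegrE ?normc_ge0// normc_sqr real_normK ?num_real//.
by rewrite lerDl sqr_ge0.
Qed.

Lemma Im_le_normc z : `|Im z| <= normc z.
Proof.
rewrite -(@ler_pXn2r _ 2) ?nnegrE ?normc_ge0// normc_sqr real_normK ?num_real//.
by rewrite lerDr sqr_ge0.
Qed.

Lemma normc_le_ReIm z : normc z <= `|Re z| + `|Im z|.
Proof.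
rewrite -(@ler_pXn2r _ 2) ?nnegrE ?normc_ge0 ?addr_ge0// normc_sqr.
rewrite sqrrD !real_normK ?num_real// lerD2r lerDl mulrn_wge0// mulr_ge0//.
Qed.

Lemma normc_eq0 z : normc z = 0 -> z = 0.
Proof. exact: ComplexField.Normc.eq0_normc. Qed.

(** The modulus is the real part after a rotation; this turns bounds on real
    parts into bounds on the modulus. *)
Lemma normc_rotate z : exists2 w, normc w = 1 & Re (w * z) = normc z.
Proof.
have [z0|z0] := eqVneq (normc z) 0.
  by exists 1; [exact: normc_1|rewrite (normc_eq0 z0) mulr0 normc_0].
exists ((normc z)^-1%:C * (Re z -i* Im z)).
  rewrite normcM normc_real ger0_norm ?invr_ge0 ?normc_ge0//.
  rewrite (_ : normc _ = normc z) ?mulVf//.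
  by case: (z) => a b /=; rewrite sqrrN.
rewrite -mulrA Re_mul ReC ImC mul0r subr0 Re_mul /= mulNr opprK -!expr2 -normc_sqr.
by rewrite expr2 mulKf.
Qed.

Lemma cexp0 : cexp 0 = 1 :> R[i].
Proof. by rewrite /cexp /= expR0 cos0 sin0 mul1r. Qed.

Lemma Re_cexp z : Re (cexp z) = expR (Re z) * cos (Im z).
Proof. by rewrite /cexp Re_mul ReC ImC /= mul0r subr0. Qed.

Lemma Im_cexp z : Im (cexp z) = expR (Re z) * sin (Im z).
Proof. by rewrite /cexp Im_mul ReC ImC /= mul0r addr0. Qed.

(** The rules for [cexp] come first because [cexp] unfolds to a product. *)
Definition ReImE := (Re_cexp, Im_cexp, Re_add, Im_add, Re_opp, Im_opp,
  Re_rmul, Im_rmul, Re_imul, Im_imul, Re_mul, Im_mul).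

Lemma cexpD z w : cexp (z + w) = cexp z * cexp w.
Proof. by apply: complex_eqP; rewrite !ReImE expRD ?cosD ?sinD; ring. Qed.

Lemma normc_cexp z : normc (cexp z) = expR (Re z).
Proof.
apply/eqP; rewrite -(@eqrXn2 _ 2) ?normc_ge0 ?expR_ge0// normc_sqr Re_cexp Im_cexp.
by rewrite !exprMn -mulrDr cos2Dsin2 mulr1.
Qed.

Lemma cexp_real (x : R) : cexp x%:C = (expR x)%:C.
Proof. by apply: complex_eqP; rewrite ?Re_cexp ?Im_cexp /= ?cos0 ?sin0 ?mulr1 ?mulr0. Qed.

Definition cexp_trunc M z : R[i] := \sum_(m < M) z ^+ m * (m`!%:R^-1)%:C.

Lemma cexp_truncS M z :
  cexp_trunc M.+1 z = cexp_trunc M z + z ^+ M * (M`!%:R^-1)%:C.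
Proof. by rewrite /cexp_trunc big_ord_recr. Qed.

Lemma is_derive_pow n (x : R) :
  is_derive x 1 (fun x : R => x ^+ n.+1) (n.+1%:R * x ^+ n).
Proof.
rewrite (_ : (fun x : R => _) = (@id R) ^+ n.+1); last by apply/funext => y; rewrite fctE.
by apply: is_derive_eq; rewrite /GRing.scale/= mulr1.
Qed.

Let rem M z (t : R) := cexp (t%:C * z) - cexp_trunc M (t%:C * z).

Let remS M z t : rem M.+1 z t = rem M z t - (t ^+ M / M`!%:R)%:C * z ^+ M.
Proof.
rewrite /rem cexp_truncS opprD addrA; congr (_ - _).
by rewrite exprMn -rmorphXn rmorphM/= mulrAC.
Qed.

Let rem_derive M z (t : R) :
  is_derive t 1 (fun t => Re (rem M.+1 z t)) (Re (z * rem M z t)) /\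
  is_derive t 1 (fun t => Im (rem M.+1 z t)) (Im (z * rem M z t)).
Proof.
have h0 : is_derive t 1 (fun t => Re (rem 0 z t)) (Re (z * rem 0 z t)) /\
  is_derive t 1 (fun t => Im (rem 0 z t)) (Im (z * rem 0 z t)).
  rewrite /rem /cexp_trunc; under eq_fun do rewrite big_ord0 subr0 Re_cexp !ReImE /=.
  under [X in _ /\ is_derive _ _ X _]eq_fun do rewrite big_ord0 subr0 Im_cexp !ReImE /=.
  rewrite big_ord0 subr0 !ReImE /=.
  by split; apply: is_derive_eq; rewrite /GRing.scale /=; ring.
elim: M => [|M [ihR ihI]].
  split.
    under eq_fun do rewrite remS expr0 fact0 divr1 mulr1 Re_add Re_opp ReC.
    by case: h0 => h0 _; apply: is_derive_eq; rewrite subr0.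
  under eq_fun do rewrite remS expr0 fact0 divr1 mulr1 Im_add Im_opp ImC.
  by case: h0 => _ h0; apply: is_derive_eq; rewrite subr0.
have fM : (M.+1`!%:R : R)^-1 *+ M.+1 = (M`!%:R)^-1.
  rewrite -[LHS]mulr_natr factS natrM.
  have f0 : M`!%:R != 0 :> R by rewrite pnatr_eq0 -lt0n fact_gt0.
  have M0 : M.+1%:R != 0 :> R by rewrite pnatr_eq0.
  by rewrite invfM mulrAC mulVf// mul1r.
have e : z * rem M.+1 z t = z * rem M z t - (t ^+ M / M`!%:R)%:C * z ^+ M.+1.
  by rewrite remS mulrBr exprS; congr (_ - _); rewrite mulrCA.
have hp (k : R) : is_derive t 1 (fun x : R => x ^+ M.+1 / M.+1`!%:R * k)
    (t ^+ M / M`!%:R * k).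
  have h := is_derive_pow M t.
  apply: is_derive_eq; rewrite /GRing.scale/= !mulr0 !add0r.
  rewrite -fM -[X in _ = _ * X * _]mulr_natr.
  by move: (_ ^-1) (t ^+ M) M.+1%:R => b p q; ring.
rewrite e; split.
  under eq_fun do rewrite (remS M.+1) Re_add Re_opp Re_rmul.
  by rewrite Re_add Re_opp Re_rmul; exact: is_deriveB.
under eq_fun do rewrite (remS M.+1) Im_add Im_opp Im_rmul.
by rewrite Im_add Im_opp Im_rmul; exact: is_deriveB.
Qed.

(** Taylor's inequality, by induction on the order: the derivative of the
    remainder of order [M.+1] along a ray is [z] times the remainder of
    order [M]. *)
Lemma cexp_taylor M z :
  normc (cexp z - cexp_trunc M z) <= normc z ^+ M / M`!%:R * expR (normc z).
Proof.
suff H (t : R) : 0 <= t ->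
    normc (rem M z t) <= (t * normc z) ^+ M / M`!%:R * expR (t * normc z).
  by have := H 1 ler01; rewrite /rem !mul1r.
elim: M t => [|M ih] t t0.
  rewrite /rem /cexp_trunc big_ord0 subr0 normc_cexp expr0 fact0 divr1 mul1r.
  rewrite ler_expR Re_mul /= mul0r subr0 ler_wpM2l//.
  by apply: le_trans (Re_le_normc z); exact: ler_norm.
have [w w1 <-] := normc_rotate (rem M.+1 z t).
pose g (t : R) := (t * normc z) ^+ M.+1 / M.+1`!%:R * expR (t * normc z).
pose f (t : R) := g t - (Re w * Re (rem M.+1 z t) - Im w * Im (rem M.+1 z t)).
rewrite Re_mul -subr_ge0 -/(g t) -/(f t).
pose df (t : R) :=
  (t * normc z) ^+ M / M`!%:R * normc z * expR (t * normc z)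
  + g t * normc z - Re (w * (z * rem M z t)).
have fM : (M.+1`!%:R : R)^-1 = (M`!%:R)^-1 / M.+1%:R.
  by rewrite factS natrM invfM mulrC.
have M0 : M.+1%:R != 0 :> R by rewrite pnatr_eq0.
have fD (x : R) : is_derive x 1 f (df x).
  have [rR rI] := rem_derive M z x.
  have hp := is_derive_pow M x.
  rewrite /f (_ : g = fun t => t ^+ M.+1 * (normc z ^+ M.+1 / M.+1`!%:R)
    * expR (t * normc z)); last first.
    by apply/funext => y; rewrite /g exprMn mulrA.
  apply: is_derive_eq.
  rewrite /df /g !Re_mul !Im_mul /GRing.scale/= fM !exprS exprMn.
  by move: M.+1%:R M0 (M`!%:R^-1) => q q0 b; field.
have f00 : f 0 = 0.
  rewrite /f /g mul0r expr0n /= mul0r mul0r.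
  rewrite /rem mul0r cexp0 /cexp_trunc big_ord_recl expr0 fact0 invr1 mulr1.
  rewrite big1 => [|i _]; last by rewrite expr0n /= mul0r.
  by rewrite addr0 subrr /= !mulr0 subrr subrr.
(* [f] vanishes at [0] and its derivative is nonnegative by induction. *)
rewrite -f00; have [->//|tn0] := eqVneq t 0.
have t1 : 0 < t by rewrite lt_neqAle eq_sym tn0.
have cf : {within `[0, t], continuous f}.
  apply: continuous_subspaceT => x.
  apply: differentiable_continuous; apply/derivable1_diffP.
  by have [] := fD x.
have [c c0t] := @MVT R f df 0 t t1 (fun x _ => fD x) cf.
rewrite -subr_ge0 => ->; apply: mulr_ge0; last by rewrite subr0.
have c0 : 0 <= c by move: c0t; rewrite in_itv/= => /andP[/ltW].
rewrite /df subr_ge0; apply: le_trans (ler_norm _) _.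
apply: le_trans (Re_le_normc _) _.
rewrite !normcM w1 mul1r -[leLHS]addr0 lerD//; last first.
  by rewrite /g !mulr_ge0 ?expR_ge0 ?normc_ge0 ?exprn_ge0 ?invr_ge0 ?mulr_ge0 ?normc_ge0.
by rewrite mulrC -mulrA [normc z * _]mulrC mulrA ler_wpM2r ?normc_ge0// ih.
Qed.

End complex_prelim.

(** * Integrals of complex-valued functions *)

Section cmeasurable_theory.
Context {R : realType} {d : measure_display} {T : measurableType d}.
Implicit Types f g : T -> R[i].

Lemma cmeasurable_cst (c : R[i]) : cmeasurable (fun _ : T => c).
Proof. by split; exact: measurable_cst. Qed.

Lemma cmeasurable_real (h : T -> R) :
  measurable_fun setT h -> cmeasurable (fun x => (h x)%:C).
Proof. by move=> mh; split => //; exact: measurable_cst. Qed.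

Lemma cmeasurableD f g :
  cmeasurable f -> cmeasurable g -> cmeasurable (fun x => f x + g x).
Proof.
move=> [f1 f2] [g1 g2]; split.
  by under [X in measurable_fun _ X]eq_fun do rewrite /= Re_add; exact: measurable_funD.
by under [X in measurable_fun _ X]eq_fun do rewrite /= Im_add; exact: measurable_funD.
Qed.

Lemma cmeasurableN f : cmeasurable f -> cmeasurable (fun x => - f x).
Proof.
move=> [f1 f2]; split.
  under [X in measurable_fun _ X]eq_fun do rewrite /= Re_opp.
  exact: measurableT_comp.
under [X in measurable_fun _ X]eq_fun do rewrite /= Im_opp.
exact: measurableT_comp.
Qed.

Lemma cmeasurableM f g :
  cmeasurable f -> cmeasurable g -> cmeasurable (fun x => f x * g x).
Proof.
move=> [f1 f2] [g1 g2]; split.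
  rewrite (_ : _ \o _ = (fun x => Re (f x) * Re (g x) - Im (f x) * Im (g x))).
    by apply: measurable_funB; exact: measurable_funM.
  by apply/funext => x; exact: Re_mul.
rewrite (_ : _ \o _ = (fun x => Re (f x) * Im (g x) + Im (f x) * Re (g x))).
  by apply: measurable_funD; exact: measurable_funM.
by apply/funext => x; exact: Im_mul.
Qed.

Lemma cmeasurable_sum I (r : seq I) (F : I -> T -> R[i]) :
  (forall i, cmeasurable (F i)) -> cmeasurable (fun x => \sum_(i <- r) F i x).
Proof.
move=> mF; elim: r => [|i r ih].
  by under eq_fun do rewrite big_nil; exact: cmeasurable_cst.
by under eq_fun do rewrite big_cons; exact: cmeasurableD.
Qed.

Lemma cmeasurable_prod I (r : seq I) (F : I -> T -> R[i]) :
  (forall i, cmeasurable (F i)) -> cmeasurable (fun x => \prod_(i <- r) F i x).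
Proof.
move=> mF; elim: r => [|i r ih].
  by under eq_fun do rewrite big_nil; exact: cmeasurable_cst.
by under eq_fun do rewrite big_cons; exact: cmeasurableM.
Qed.

Lemma cmeasurable_cexp f : cmeasurable f -> cmeasurable (fun x => cexp (f x)).
Proof.
move=> [f1 f2]; split.
  rewrite (_ : _ \o _ = (fun x => expR (Re (f x)) * cos (Im (f x)))); last first.
    by apply/funext => x; exact: Re_cexp.
  apply: measurable_funM; first exact: measurableT_comp.
  exact: (measurableT_comp (continuous_measurable_fun (@continuous_cos R)) f2).
rewrite (_ : _ \o _ = (fun x => expR (Re (f x)) * sin (Im (f x)))); last first.
  by apply/funext => x; exact: Im_cexp.
apply: measurable_funM; first exact: measurableT_comp.
exact: (measurableT_comp (continuous_measurable_fun (@continuous_sin R)) f2).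
Qed.

Lemma measurable_normc f : cmeasurable f -> measurable_fun setT (normc \o f).
Proof.
move=> [f1 f2].
rewrite (_ : _ \o _ = (fun x => Num.sqrt (Re (f x) ^+ 2 + Im (f x) ^+ 2))); last first.
  by apply/funext => x /=; case: (f x).
apply: (measurableT_comp (continuous_measurable_fun (@sqrt_continuous R))).
by apply: measurable_funD; exact: measurable_funX.
Qed.

Lemma cmeasurable_comp d' (U : measurableType d') f (h : U -> T) :
  cmeasurable f -> measurable_fun setT h -> cmeasurable (fun x => f (h x)).
Proof. by move=> [f1 f2] mh; split; [exact: (measurableT_comp f1 mh)|exact: (measurableT_comp f2 mh)]. Qed.

End cmeasurable_theory.

Section cintegral_theory.
Context {R : realType} {d : measure_display} {T : measurableType d}.
Variable mu : {measure set T -> \bar R}.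
Implicit Types f g : T -> R[i].

Local Notation Int h := (mu.-integrable setT (EFin \o h)).

Lemma integrable_le (h k : T -> R) : measurable_fun setT h -> Int k ->
  (forall x, `|h x| <= k x) -> Int h.
Proof.
move=> mh ik hk; apply: le_integrable ik => //; first exact/measurable_EFinP.
by move=> x _ /=; rewrite lee_fin (le_trans (hk x))// ler_norm.
Qed.

Lemma cintegrable_cmeasurable f : cintegrable mu setT f -> cmeasurable f.
Proof. by move=> [/measurable_int/measurable_EFinP ? /measurable_int/measurable_EFinP ?]. Qed.

Lemma cintegrable_le f (k : T -> R) : cmeasurable f -> Int k ->
  (forall x, normc (f x) <= k x) -> cintegrable mu setT f.
Proof.
move=> [m1 m2] ik fk; split; apply: (integrable_le _ ik) => // x.
  by apply: le_trans (fk x); exact: Re_le_normc.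
by apply: le_trans (fk x); exact: Im_le_normc.
Qed.

Lemma integrable_norm (h : T -> R) : Int h -> Int (fun x => `|h x|).
Proof. exact: integrable_abse. Qed.

Lemma integrable_add (h k : T -> R) : Int h -> Int k -> Int (fun x => h x + k x).
Proof. by move=> ih ik; exact: (integrableD measurableT ih ik). Qed.

Lemma cintegrable_normc f : cintegrable mu setT f -> Int (normc \o f).
Proof.
move=> cf; have mf := cintegrable_cmeasurable cf; case: cf => f1 f2.
apply: (@integrable_le _ (fun x => `|Re (f x)| + `|Im (f x)|)).
- exact: measurable_normc.
- by apply: integrable_add; [exact: (integrable_norm f1)|exact: (integrable_norm f2)].
- by move=> x /=; rewrite ger0_norm ?normc_ge0// normc_le_ReIm.
Qed.

Lemma cintegrableD f g : cintegrable mu setT f -> cintegrable mu setT g ->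
  cintegrable mu setT (fun x => f x + g x).
Proof.
move=> [f1 f2] [g1 g2]; split.
  rewrite (_ : _ \o _ = (fun x => (EFin \o (Re \o f)) x + (EFin \o (Re \o g)) x)%E).
    exact: integrableD.
  by apply/funext => x /=; rewrite Re_add.
rewrite (_ : _ \o _ = (fun x => (EFin \o (Im \o f)) x + (EFin \o (Im \o g)) x)%E).
  exact: integrableD.
by apply/funext => x /=; rewrite Im_add.
Qed.

Lemma cintegralD f g : cintegrable mu setT f -> cintegrable mu setT g ->
  cintegral mu setT (fun x => f x + g x) =
  cintegral mu setT f + cintegral mu setT g.
Proof.
move=> [f1 f2] [g1 g2]; apply: complex_eqP; rewrite ?Re_add ?Im_add /=.
  by under eq_Rintegral do rewrite Re_add; exact: RintegralD.
by under eq_Rintegral do rewrite Im_add; exact: RintegralD.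
Qed.

Lemma cintegrableZ (c : R[i]) f : cintegrable mu setT f ->
  cintegrable mu setT (fun x => c * f x).
Proof.
move=> cf; have mf := cintegrable_cmeasurable cf.
apply: (@cintegrable_le _ (fun x => normc c * normc (f x))).
- by apply: cmeasurableM => //; exact: cmeasurable_cst.
- rewrite (_ : EFin \o _ = (fun x => (normc c)%:E * (EFin \o (normc \o f)) x)%E)//.
  by apply: integrableZl => //; exact: cintegrable_normc.
- by move=> x; rewrite normcM.
Qed.

Lemma integrable_scale (c : R) (h : T -> R) : Int h -> Int (fun x => c * h x).
Proof. by move=> ih; exact: (integrableZl measurableT c ih). Qed.

Lemma cintegralZ (c : R[i]) f : cintegrable mu setT f ->
  cintegral mu setT (fun x => c * f x) = c * cintegral mu setT f.
Proof.
move=> [f1 f2]; apply: complex_eqP; rewrite ?Re_mul ?Im_mul /=.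
  under eq_Rintegral do rewrite Re_mul.
  by rewrite RintegralB//; [rewrite !RintegralZl|exact: integrable_scale..].
under eq_Rintegral do rewrite Im_mul.
by rewrite RintegralD//; [rewrite !RintegralZl|exact: integrable_scale..].
Qed.

Lemma cintegral_real (h : T -> R) :
  cintegral mu setT (fun x => (h x)%:C) = (\int[mu]_x h x)%:C.
Proof. by rewrite /cintegral /= Rintegral_cst// mul0r. Qed.

Lemma cintegral_sum I (r : seq I) (F : I -> T -> R[i]) :
  (forall i, cintegrable mu setT (F i)) ->
  cintegrable mu setT (fun x => \sum_(i <- r) F i x) /\
  cintegral mu setT (fun x => \sum_(i <- r) F i x) =
  \sum_(i <- r) cintegral mu setT (F i).
Proof.
move=> iF; elim: r => [|i r [ih1 ih2]].
  under eq_fun do rewrite big_nil.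
  split; last by rewrite big_nil (cintegral_real (fun=> 0)) Rintegral_cst// mul0r.
  by split; exact: integrable0.
under eq_fun do rewrite big_cons.
split; first exact: cintegrableD.
by rewrite cintegralD// big_cons ih2.
Qed.

Lemma Re_cintegral f : Re (cintegral mu setT f) = \int[mu]_x Re (f x).
Proof. by []. Qed.

Lemma Im_cintegral f : Im (cintegral mu setT f) = \int[mu]_x Im (f x).
Proof. by []. Qed.

Lemma eq_cintegral f g : (forall x, f x = g x) ->
  cintegral mu setT f = cintegral mu setT g.
Proof. by move=> fg; congr cintegral; exact/funext. Qed.

(** Rotating the integral onto the positive axis reduces the triangle
    inequality to the monotonicity of the real integral. *)
Lemma normc_cintegral f : cintegrable mu setT f ->
  normc (cintegral mu setT f) <= \int[mu]_x normc (f x).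
Proof.
move=> cf; have [w w1 <-] := normc_rotate (cintegral mu setT f).
have cwf := cintegrableZ w cf.
rewrite -cintegralZ//=; apply: le_Rintegral => //; first by case: cwf.
  exact: cintegrable_normc.
move=> x _; apply: le_trans (ler_norm _) _; apply: le_trans (Re_le_normc _) _.
by rewrite normcM w1 mul1r.
Qed.

Lemma normc_cintegral_le f (k : T -> R) : cmeasurable f -> Int k ->
  (forall x, normc (f x) <= k x) -> normc (cintegral mu setT f) <= \int[mu]_x k x.
Proof.
move=> mf ik fk; have cf := cintegrable_le mf ik fk.
apply: le_trans (normc_cintegral cf) _; apply: le_Rintegral => //.
exact: cintegrable_normc.
Qed.

Definition ccvg (u : nat -> R[i]) (l : R[i]) :=
  (Re (u k) @[k --> \oo] --> Re l) /\ (Im (u k) @[k --> \oo] --> Im l).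

Lemma Rdominated (F : nat -> T -> R) (f k : T -> R) :
  (forall n, measurable_fun setT (F n)) -> measurable_fun setT f ->
  (forall x, F n x @[n --> \oo] --> f x) -> Int k ->
  (forall n x, `|F n x| <= k x) ->
  \int[mu]_x F n x @[n --> \oo] --> \int[mu]_x f x.
Proof.
move=> mF mf Ff ik Fk.
have iF n : Int (F n) by apply: (integrable_le _ ik).
have Ff' x : setT x -> (EFin \o F n) x @[n --> \oo] --> (EFin \o f) x.
  by move=> _; apply: cvg_EFin; [exact: nearW|exact: Ff].
have [i1 _ i3] := @dominated_convergence _ _ _ mu setT measurableT
  (fun n => EFin \o F n) (EFin \o f) (EFin \o k)
  (fun n => (measurable_EFinP _ _).2 (mF n)) ((measurable_EFinP _ _).2 mf)
  (aeW _ Ff') ik (aeW _ (fun x n _ => (Fk n x : (`|(F n x)%:E| <= (k x)%:E)%E))).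
apply: fine_cvg; rewrite fineK//.
exact: integrable_fin_num.
Qed.

Lemma cmeasurable_cvg (F : nat -> T -> R[i]) f :
  (forall n, cmeasurable (F n)) -> (forall x, ccvg (F ^~ x) (f x)) ->
  cmeasurable f.
Proof.
move=> mF Ff; split.
  by apply: (measurable_fun_cvg _ (fun x _ => (Ff x).1)) => n; exact: (mF n).1.
by apply: (measurable_fun_cvg _ (fun x _ => (Ff x).2)) => n; exact: (mF n).2.
Qed.

Lemma cdominated (F : nat -> T -> R[i]) f (k : T -> R) :
  (forall n, cmeasurable (F n)) ->
  (forall x, ccvg (F ^~ x) (f x)) -> Int k ->
  (forall n x, normc (F n x) <= k x) ->
  ccvg (fun n => cintegral mu setT (F n)) (cintegral mu setT f).
Proof.
move=> mF Ff ik Fk; have [mf1 mf2] := cmeasurable_cvg mF Ff.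
split => /=.
  apply: (@Rdominated (fun n x => Re (F n x)) _ k) => //.
  - by move=> n; exact: (mF n).1.
  - by move=> x; exact: (Ff x).1.
  - by move=> n x; apply: le_trans (Fk n x); exact: Re_le_normc.
apply: (@Rdominated (fun n x => Im (F n x)) _ k) => //.
- by move=> n; exact: (mF n).2.
- by move=> x; exact: (Ff x).2.
- by move=> n x; apply: le_trans (Fk n x); exact: Im_le_normc.
Qed.

End cintegral_theory.

Section fubini.
Context {R : realType} {d1 d2 : measure_display}.
Context {T1 : measurableType d1} {T2 : measurableType d2}.
Variable m1 : {sigma_finite_measure set T1 -> \bar R}.
Variable m2 : {sigma_finite_measure set T2 -> \bar R}.

Lemma Rfubini1 (f : T1 * T2 -> R) : (m1 \x m2)%E.-integrable setT (EFin \o f) ->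
  \int[(m1 \x m2)%E]_p f p = \int[m1]_x \int[m2]_y f (x, y).
Proof.
move=> fi; rewrite /Rintegral -(integral12_prod_meas1 fi); congr fine.
apply: ae_eq_integral => //.
- exact: (measurable_fubini_F fi).
- apply/measurable_EFinP.
  apply: (@measurableT_comp _ _ _ _ _ _ fine); first exact: fine_measurable.
  exact: (measurable_fubini_F fi).
- have := ae_integrable1 fi; apply: filterS => x ix _.
  by rewrite fineK//; exact: integrable_fin_num.
Qed.

Lemma Rfubini2 (f : T1 * T2 -> R) : (m1 \x m2)%E.-integrable setT (EFin \o f) ->
  \int[(m1 \x m2)%E]_p f p = \int[m2]_y \int[m1]_x f (x, y).
Proof.
move=> fi; rewrite /Rintegral -(integral21_prod_meas1 fi); congr fine.
apply: ae_eq_integral => //.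
- exact: (measurable_fubini_G fi).
- apply/measurable_EFinP.
  apply: (@measurableT_comp _ _ _ _ _ _ fine); first exact: fine_measurable.
  exact: (measurable_fubini_G fi).
- have := ae_integrable2 fi; apply: filterS => x ix _.
  by rewrite fineK//; exact: integrable_fin_num.
Qed.

Lemma cfubini1 (f : T1 * T2 -> R[i]) : cintegrable (m1 \x m2)%E setT f ->
  cintegral (m1 \x m2)%E setT f =
  cintegral m1 setT (fun x => cintegral m2 setT (fun y => f (x, y))).
Proof.
by move=> [f1 f2]; apply: complex_eqP; [exact: (Rfubini1 f1)|exact: (Rfubini1 f2)].
Qed.

Lemma cfubini (f : T1 -> T2 -> R[i]) :
  cintegrable (m1 \x m2)%E setT (fun p => f p.1 p.2) ->
  cintegral m1 setT (fun x => cintegral m2 setT (f x)) =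
  cintegral m2 setT (fun y => cintegral m1 setT (f ^~ y)).
Proof.
move=> [f1 f2]; apply: complex_eqP.
  by rewrite Re_cintegral -[LHS](Rfubini1 f1) (Rfubini2 f1).
by rewrite Im_cintegral -[LHS](Rfubini1 f2) (Rfubini2 f2).
Qed.

(** The dominating functions of the later applications of Fubini's theorem
    all have separated variables. *)
Lemma integrable_prod (g : T1 -> R) (h : T2 -> R) :
  m1.-integrable setT (EFin \o g) -> m2.-integrable setT (EFin \o h) ->
  (m1 \x m2)%E.-integrable setT (EFin \o (fun p => g p.1 * h p.2)).
Proof.
move=> ig ih.
have mg : measurable_fun setT g by exact/measurable_EFinP/measurable_int/ig.
have mh : measurable_fun setT h by exact/measurable_EFinP/measurable_int/ih.
apply/integrable12ltyP.
  apply/measurable_EFinP/measurable_funM.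
    exact: (measurableT_comp mg measurable_fst).
  exact: (measurableT_comp mh measurable_snd).
have mh' : measurable_fun setT (fun y => `|h y|%:E).
  by apply/measurable_EFinP; exact: measurableT_comp.
have mg' : measurable_fun setT (fun y => `|g y|%:E).
  by apply/measurable_EFinP; exact: measurableT_comp.
have E x : (\int[m2]_y `|(EFin \o (fun p => (g p.1 * h p.2)%R)) (x, y)| =
    `|g x|%:E * \int[m2]_y `|h y|%:E)%E.
  rewrite -ge0_integralZl//.
  by apply: eq_integral => y _; rewrite /= normrM EFinM.
under eq_integral do rewrite E.
have /integrableP[_ h_lty] := ih.
have /integrableP[_ g_lty] := ig.
rewrite ge0_integralZr//=; last exact: integral_ge0.
by rewrite lte_mul_pinfty// ?integral_ge0// ge0_fin_numE// integral_ge0.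
Qed.

Lemma measurable_Rintegral (f : T1 -> T2 -> R) :
  measurable_fun setT (fun p : T1 * T2 => f p.1 p.2) ->
  measurable_fun setT (fun x => \int[m2]_y f x y).
Proof.
move=> mf; apply: (@measurableT_comp _ _ _ _ _ _ fine); first exact: fine_measurable.
have mF : measurable_fun setT (EFin \o (fun p : T1 * T2 => f p.1 p.2)) by exact/measurable_EFinP.
under eq_fun do rewrite integralE.
pose F p := (f p.1 p.2)%:E.
apply: emeasurable_funB.
  have H := @measurable_fun_fubini_tonelli_F _ _ _ _ _ m2 (F^\+)%E
    (measurable_funepos mF) (funepos_ge0 F).
  rewrite (_ : (fun x => _) = fubini_F m2 (F^\+)%E)//.
  by apply/funext => x; rewrite /fubini_F; apply: eq_integral => y _; rewrite !funeposE.
have H := @measurable_fun_fubini_tonelli_F _ _ _ _ _ m2 (F^\-)%E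
  (measurable_funeneg mF) (funeneg_ge0 F).
rewrite (_ : (fun x => _) = fubini_F m2 (F^\-)%E)//.
by apply/funext => x; rewrite /fubini_F; apply: eq_integral => y _; rewrite !funenegE.
Qed.

Lemma cmeasurable_cintegral (f : T1 -> T2 -> R[i]) :
  cmeasurable (fun p : T1 * T2 => f p.1 p.2) ->
  cmeasurable (fun x => cintegral m2 setT (f x)).
Proof.
by move=> [f1 f2]; split;
  [exact: (@measurable_Rintegral (fun x y => Re (f x y)))
  |exact: (@measurable_Rintegral (fun x y => Im (f x y)))].
Qed.

End fubini.

(** * The Fourier transform of the one-dimensional Gaussian *)

Section gauss1.
Context {R : realType}.
Local Notation leb := (@lebesgue_measure R).
Local Notation Int h := (leb.-integrable setT (EFin \o h)).

Definition gauss1 (c x : R) := expR (- c * x ^+ 2).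

Lemma measurable_gauss1 c : measurable_fun setT (gauss1 c).
Proof.
apply: measurableT_comp => //; apply: measurable_funM => //.
Qed.

Lemma integral_gauss1 (c : R) : 0 < c ->
  (\int[leb]_x (gauss1 c x)%:E)%E = (Num.sqrt (pi / c))%:E.
Proof.
move=> c0; pose s := Num.sqrt ((2 * c)^-1).
have s2 : s ^+ 2 = (2 * c)^-1 by rewrite sqr_sqrtr// invr_ge0 mulr_ge0// ltW.
have s0 : s != 0 by rewrite gt_eqF// sqrtr_gt0 invr_gt0 mulr_gt0.
have := integral_normal_pdf (0 : R) s; rewrite normal_pdfE// => pdf1.
have peakE : normal_peak s = (Num.sqrt (pi / c))^-1.
  rewrite /normal_peak s2; congr (Num.sqrt _)^-1.
  by rewrite mulrC invfM -mulr_natr; field; rewrite gt_eqF.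
have peak0 : 0 < Num.sqrt (pi / c) by rewrite sqrtr_gt0 divr_gt0// pi_gt0.
have E x : gauss1 c x = Num.sqrt (pi / c) * normal_pdf 0 s x.
  rewrite normal_pdfE// peakE mulrA divff ?gt_eqF// mul1r /normal_fun.
  by congr expR; rewrite subr0 s2 -mulr_natr; field; rewrite gt_eqF.
under eq_integral do rewrite E EFinM.
rewrite ge0_integralZl//.
- by rewrite integral_normal_pdf mule1.
- by apply/measurable_EFinP; exact: measurable_normal_pdf.
- by move=> x _; rewrite lee_fin normal_pdf_ge0.
Qed.

Lemma integrable_gauss1 (c : R) : 0 < c -> Int (gauss1 c).
Proof.
move=> c0; apply/integrableP; split.
  by apply/measurable_EFinP; exact: measurable_gauss1.
under eq_integral do rewrite /= ger0_norm ?expR_ge0//.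
by rewrite integral_gauss1// ltry.
Qed.

Lemma Rintegral_gauss1 (c : R) : 0 < c ->
  \int[leb]_x gauss1 c x = Num.sqrt (pi / c).
Proof. by move=> c0; rewrite /Rintegral integral_gauss1. Qed.

(** Halving the exponent pays for a polynomial factor. *)
Lemma sqr_gauss1_le (c x : R) : 0 < c ->
  x ^+ 2 * gauss1 c x <= 2 / c * gauss1 (c / 2) x.
Proof.
move=> c0; have -> : gauss1 c x = gauss1 (c / 2) x * gauss1 (c / 2) x.
  by rewrite /gauss1 -expRD; congr expR; field.
rewrite mulrA ler_wpM2r ?expR_ge0// /gauss1.
rewrite -ler_pdivlMr ?expR_gt0// -expRN mulNr opprK.
rewrite -ler_pdivrMl ?divr_gt0// invf_div.
have := expR_ge1Dx (c / 2 * x ^+ 2).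
by apply: le_trans; rewrite mulrC lerDr.
Qed.

Lemma abs_gauss1_le (c x : R) : 0 < c ->
  `|x| * gauss1 c x <= gauss1 c x + 2 / c * gauss1 (c / 2) x.
Proof.
move=> c0; apply: (@le_trans _ _ ((1 + x ^+ 2) * gauss1 c x)).
  rewrite ler_wpM2r ?expR_ge0// -real_normK ?num_real//.
  by have := sqr_ge0 (`|x| - 1); have := normr_ge0 x; nra.
by rewrite mulrDl mul1r lerD2l sqr_gauss1_le.
Qed.

Lemma integrable_abs_gauss1 (c : R) : 0 < c -> Int (fun x => `|x| * gauss1 c x).
Proof.
move=> c0.
apply: (@integrable_le R _ (measurableTypeR R) leb _ (fun x => gauss1 c x + 2 / c * gauss1 (c / 2) x)).
- by apply: measurable_funM => //; exact: measurable_gauss1.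
- apply: integrable_add; first exact: integrable_gauss1.
  by apply: integrable_scale; apply: integrable_gauss1; rewrite divr_gt0.
- by move=> x; rewrite ger0_norm ?mulr_ge0 ?expR_ge0// abs_gauss1_le.
Qed.

Lemma cvg_gauss1 (c : R) : 0 < c -> gauss1 c n%:R @[n --> \oo] --> 0.
Proof.
move=> c0.
apply: (@squeeze_cvgr _ _ _ _ (fun=> 0) (fun n => 2 / c * (n%:R^-1 : R))).
- near=> n; rewrite expR_ge0 /=.
  have n0 : (0 < n)%N by near: n; exact: nbhs_infty_gt.
  have n1 : 1 <= n%:R :> R by rewrite ler1n.
  rewrite ler_pdivlMr ?(lt_le_trans ltr01)//.
  apply: (@le_trans _ _ (n%:R ^+ 2 * gauss1 c n%:R)).
    by rewrite mulrC ler_wpM2r ?expR_ge0// expr2 ler_peMl// ler0n.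
  apply: le_trans (sqr_gauss1_le _ c0) _.
  rewrite ler_piMr//; first by rewrite divr_ge0// ltW.
  rewrite /gauss1 -expR0 ler_expR mulNr oppr_le0 mulr_ge0 ?sqr_ge0//.
  by rewrite divr_ge0// ltW.
- exact: cvg_cst.
- rewrite -[X in _ --> X](mulr0 (2 / c)); apply: cvgMr.
  by apply/gtr0_cvgV0; [near=> n; rewrite ltr0n; near: n; exact: nbhs_infty_gt|exact: cvgr_idn].
Unshelve. all: by end_near. Qed.

Variables (c : R).
Hypothesis c0 : 0 < c.

Let h u x : R := sin (u * x) * gauss1 c x.
Let dh u x : R := u * (cos (u * x) * gauss1 c x) - 2 * c * (x * sin (u * x) * gauss1 c x).

Let is_derive_gauss1 (x : R) : is_derive x 1 (gauss1 c) (- (2 * c * x) * gauss1 c x).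
Proof.
have h2 := @is_derive_pow R 1 x.
rewrite /gauss1; apply: is_derive_eq.
by rewrite /GRing.scale /= expr1; ring.
Qed.

Let is_derive_h u (x : R) : is_derive x 1 (h u) (dh u x).
Proof.
have hg := is_derive_gauss1 x.
rewrite /h; apply: is_derive_eq.
by rewrite /dh /GRing.scale /=; ring.
Qed.

Let measurable_trig (f : R -> R) (u : R) : continuous f ->
  measurable_fun setT (fun x : R => f (u * x)).
Proof.
move=> cf; apply: measurableT_comp; first exact: continuous_measurable_fun.
exact: mulrl_measurable.
Qed.

Let int_cos u : Int (fun x => cos (u * x) * gauss1 c x).
Proof.
apply: (@integrable_le R _ (measurableTypeR R) leb _ (gauss1 c)); last 1 first.
- move=> x; rewrite normrM (ger0_norm (expR_ge0 _)) ler_piMl ?expR_ge0//.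
  by rewrite ler_norml cos_geN1 cos_le1.
- apply: measurable_funM; last exact: measurable_gauss1.
  exact: (measurable_trig _ (@continuous_cos R)).
- exact: integrable_gauss1.
Qed.

Let int_xsin u : Int (fun x => x * sin (u * x) * gauss1 c x).
Proof.
apply: (@integrable_le R _ (measurableTypeR R) leb _ (fun x => `|x| * gauss1 c x)); last 1 first.
- move=> x; rewrite !normrM (ger0_norm (expR_ge0 _)) ler_wpM2r ?expR_ge0//.
  by rewrite ler_piMr// ler_norml sin_geN1 sin_le1.
- apply: measurable_funM; last exact: measurable_gauss1.
  apply: measurable_funM => //; exact: (measurable_trig _ (@continuous_sin R)).
- exact: integrable_abs_gauss1.
Qed.

Let int_dh u : Int (dh u).
Proof.
rewrite (_ : dh u = (fun x => u * (cos (u * x) * gauss1 c x) +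
    - (2 * c) * (x * sin (u * x) * gauss1 c x))).
  by apply: integrable_add; exact: integrable_scale.
by apply/funext => x; rewrite /dh mulNr.
Qed.

(** [dh u] is the derivative of [h u], which vanishes at infinity; this is
    the integration by parts that yields the differential equation of the
    cosine transform. *)
Let dh0 u : \int[leb]_x dh u x = 0.
Proof.
pose F n x := dh u x * \1_(`[- n%:R, n%:R]%classic : set R) x.
have mI n : measurable (`[- n%:R, n%:R]%classic : set R) by exact: measurable_itv.
have mdh : measurable_fun setT (dh u) by apply/measurable_EFinP; exact: measurable_int (int_dh u).
have FE : \int[leb]_x F n x @[n --> \oo] --> \int[leb]_x dh u x.
  apply: (@Rdominated _ _ _ leb F (dh u) (fun x => `|dh u x|)) => //.
  - by move=> n; apply: measurable_funM => //; exact: measurable_indic.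
  - move=> x; apply: cvg_near_cst; near=> n.
    rewrite /F indicE mem_set ?mulr1//= in_itv/= -ler_norml.
    by near: n; exact: nbhs_infty_ger.
  - exact: integrable_norm.
  - move=> n x; rewrite normrM ler_piMr// indicE; case: (_ \in _) => //=.
      by rewrite normr1. by rewrite normr0.
have Fn n : (0 < n)%N -> \int[leb]_x F n x = 2 * h u n%:R.
  move=> n0; have nn : - n%:R < n%:R :> R by rewrite gtrN// ltr0n.
  have -> : \int[leb]_x F n x = \int[leb]_(x in `[- n%:R, n%:R]) dh u x.
    rewrite [RHS]Rintegral_mkcond; apply: eq_Rintegral => x _.
    by rewrite /F patchE indicE; case: ifPn => _; rewrite ?mulr1 ?mulr0.
  have ch : continuous (h u).
    move=> x; apply: differentiable_continuous; apply/derivable1_diffP.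
    by have [] := is_derive_h u x.
  have cdh : continuous (dh u).
    have cg : continuous (gauss1 c).
      move=> x; apply: differentiable_continuous; apply/derivable1_diffP.
      by have [] := is_derive_gauss1 x.
    have cm : continuous (fun x => u * x).
      by move=> x; exact: mulrl_continuous.
    have csin : continuous (fun x => sin (u * x)).
      by move=> x; apply: continuous_comp; [exact: cm|exact: continuous_sin].
    have ccos : continuous (fun x => cos (u * x)).
      by move=> x; apply: continuous_comp; [exact: cm|exact: continuous_cos].
    move=> x; apply: cvgB; apply: cvgMr.
      by apply: cvgM; [exact: ccos|exact: cg].
    by apply: cvgM; [apply: cvgM; [exact: cvg_id|exact: csin]|exact: cg].
  rewrite /Rintegral (@continuous_FTC2 _ (dh u) (h u)) //=.
  - by rewrite /h mulrN sinN /gauss1 sqrrN; ring.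
  - exact: continuous_subspaceT.
  - split.
    + by move=> x _; have [] := is_derive_h u x.
    + by apply: cvg_at_right_filter; exact: ch.
    + by apply: cvg_at_left_filter; exact: ch.
  - move=> x _; rewrite derive1E; have [_] := is_derive_h u x; exact.
have h0 : 2 * h u n%:R @[n --> \oo] --> 0.
  rewrite -(mulr0 2); apply: cvgMr; apply: norm_cvg0.
  apply: (@squeeze_cvgr _ _ _ _ (fun=> 0) (fun n => gauss1 c n%:R)).
  - near=> n; rewrite normr_ge0 /= normrM (ger0_norm (expR_ge0 _)).
    by rewrite ler_piMl ?expR_ge0// ler_norml sin_geN1 sin_le1.
  - exact: cvg_cst.
  - exact: cvg_gauss1.
have FE0 : \int[leb]_x F n x @[n --> \oo] --> 0.
  apply: cvg_trans h0; apply: near_eq_cvg; near=> n.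
  by rewrite Fn//; near: n; exact: nbhs_infty_gt.
by rewrite -(cvg_lim (@Rhausdorff R) FE) (cvg_lim (@Rhausdorff R) FE0).
Unshelve. all: by end_near. Qed.

Let F u := \int[leb]_x (cos (u * x) * gauss1 c x).

(** Differentiation under the integral sign, followed by [dh0]. *)
Let dF (u : R) : is_derive u 1 F (- (u / (2 * c)) * F u).
Proof.
have d1 (x y : R) : is_derive x 1 (fun u : R => cos (u * y) * gauss1 c y)
    (- (y * sin (x * y) * gauss1 c y)).
  by apply: is_derive_eq; rewrite /GRing.scale /= !mulr0 !add0r; ring.
have pE (x y : R) : partial1of2 (fun u y : R => cos (u * y) * gauss1 c y) x y =
    - (y * sin (x * y) * gauss1 c y).
  by rewrite partial1of2E; have [_] := d1 x y; exact.
have Iu : `]u - 1, u + 1[%classic u by rewrite /= in_itv/= ltrBlDr ltrDl ltr01.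
have i1 (x : R) : `]u - 1, u + 1[%classic x -> Int (fun y => cos (x * y) * gauss1 c y).
  by move=> _; exact: int_cos.
have i2 (x y : R) : `]u - 1, u + 1[%classic x -> setT y ->
    derivable (fun u : R => cos (u * y) * gauss1 c y) x 1.
  by move=> _ _; have [] := d1 x y.
have G0 (y : R) : 0 <= `|y| * gauss1 c y by rewrite mulr_ge0 ?expR_ge0.
have Gub (x y : R) : `]u - 1, u + 1[%classic x -> setT y ->
    `|partial1of2 (fun u y : R => cos (u * y) * gauss1 c y) x y| <= `|y| * gauss1 c y.
  move=> _ _; rewrite pE normrN !normrM (ger0_norm (expR_ge0 _)).
  by rewrite ler_wpM2r ?expR_ge0// ler_piMr// ler_norml sin_geN1 sin_le1.
have D1 := @derivable_under_integral R _ _ leb _ setT measurableT u _ _ Iu i1 i2 _ G0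
  (integrable_abs_gauss1 c0) Gub.
have D2 := @differentiation_under_integral R _ _ leb _ setT measurableT u _ _ Iu i1 i2 _ G0
  (integrable_abs_gauss1 c0) Gub.
apply: DeriveDef => //; rewrite -derive1E D2.
under eq_Rintegral do rewrite pE -mulN1r.
rewrite RintegralZl//.
have := dh0 u; rewrite /dh RintegralB//; [|exact: integrable_scale..].
rewrite !RintegralZl//.
rewrite -/(F u) => /eqP; rewrite subr_eq0 => /eqP e.
by rewrite mulN1r mulNr; congr -%R; rewrite mulrAC e; field; rewrite gt_eqF.
Qed.

(** By [dF] the cosine transform solves [F' = - u / (2 c) * F], so that
    [F u * exp (u^2 / (4 c))] is constant. *)
Lemma cos_gauss1 u : \int[leb]_x (cos (u * x) * gauss1 c x) =
  Num.sqrt (pi / c) * gauss1 (4 * c)^-1 u.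
Proof.
pose G v := F v * expR ((4 * c)^-1 * v ^+ 2).
have dG (v : R) : is_derive v 1 G 0.
  have hF := dF v; have hp := @is_derive_pow R 1 v.
  rewrite /G; apply: is_derive_eq.
  by rewrite /GRing.scale /= expr1; field; rewrite gt_eqF.
have := is_derive_0_is_cst u 0 dG.
rewrite /G expr0n /= mulr0 expR0 mulr1 => e.
have -> : \int[leb]_x (cos (u * x) * gauss1 c x) =
    F u * expR ((4 * c)^-1 * u ^+ 2) * gauss1 (4 * c)^-1 u.
  by rewrite /gauss1 -mulrA -expRD mulNr subrr expR0 mulr1.
rewrite e; congr (_ * _).
rewrite /F -Rintegral_gauss1//.
by under eq_Rintegral do rewrite mul0r cos0 mul1r.
Qed.

(** The integrand is odd. *)
Lemma sin_gauss1 u : \int[leb]_x (sin (u * x) * gauss1 c x) = 0.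
Proof.
have mh : measurable_fun setT (fun x => sin (u * x) * gauss1 c x).
  apply: measurable_funM; last exact: measurable_gauss1.
  exact: (measurable_trig _ (@continuous_sin R)).
have ih : Int (fun x => sin (u * x) * gauss1 c x).
  apply: (@integrable_le R _ (measurableTypeR R) leb _ (gauss1 c)) => //; last 1 first.
    move=> x; rewrite normrM (ger0_norm (expR_ge0 _)) ler_piMl ?expR_ge0//.
    by rewrite ler_norml sin_geN1 sin_le1.
  exact: integrable_gauss1.
set I := LHS.
have mN : measurable_fun setT (-%R : R -> measurableTypeR R) by exact: oppr_measurable.
suff : I = - I by lra.
rewrite {1}/I /Rintegral.
have -> : (\int[leb]_x (sin (u * x) * gauss1 c x)%:E =
    \int[pushforward leb (-%R : R -> measurableTypeR R)]_x (sin (u * x) * gauss1 c x)%:E)%E.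
  by apply: eq_measure_integral => A mA _; exact/esym/lebesgue_measureN.
rewrite integral_pushforward//=.
- transitivity (fine (\int[leb]_x ((-1) * (sin (u * x) * gauss1 c x))%:E)%E).
    congr fine; apply: eq_integral => x _ /=.
    by rewrite mulrN sinN /gauss1 sqrrN mulN1r mulNr.
  by rewrite -/(Rintegral _ _ _) RintegralZl// mulN1r.
- exact/measurable_EFinP.
- rewrite (_ : _ \o _ = EFin \o (fun x => (-1) * (sin (u * x) * gauss1 c x))).
    exact: integrable_scale.
  by apply/funext => x /=; rewrite mulrN sinN /gauss1 sqrrN mulN1r mulNr.
Qed.

Lemma cexp_gauss1 u :
  cintegral leb setT (fun x => cexp ('i%C * (u * x)%:C) * (gauss1 c x)%:C) =
  (Num.sqrt (pi / c) * gauss1 (4 * c)^-1 u)%:C.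
Proof.
apply: complex_eqP.
  rewrite Re_cintegral -[RHS]cos_gauss1; apply: eq_Rintegral => x _.
  by rewrite mulrC Re_rmul Re_cexp Re_imul Im_imul /= oppr0 expR0 mul1r mulrC.
rewrite Im_cintegral -[RHS](sin_gauss1 u); apply: eq_Rintegral => x _.
by rewrite mulrC Im_rmul Im_cexp Re_imul Im_imul /= oppr0 expR0 mul1r mulrC.
Qed.

End gauss1.

(** * Lebesgue measure and Gaussians in several variables *)

Section rV_measurability.
Context {R : realType} {d : measure_display} {T : measurableType d} {N : nat}.
Implicit Types f g : T -> 'rV[R]_N.

Lemma measurable_rV_coord f i :
  measurable_fun setT f -> measurable_fun setT (fun x => f x 0 i).
Proof. by move=> mf; exact: (measurableT_comp (measurable_coord i) mf). Qed.

Lemma measurable_rVB f g : measurable_fun setT f -> measurable_fun setT g ->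
  measurable_fun setT (fun x => f x - g x).
Proof.
move=> mf mg; apply: measurable_fun_rV => i.
under eq_fun do rewrite !mxE.
by apply: measurable_funB; exact: measurable_rV_coord.
Qed.

Lemma measurable_dot f g : measurable_fun setT f -> measurable_fun setT g ->
  measurable_fun setT (fun x => dot (f x) (g x)).
Proof.
move=> mf mg; rewrite /dot; apply: measurable_sum => i.
by apply: measurable_funM; exact: measurable_rV_coord.
Qed.

End rV_measurability.

Section dot_theory.
Context {R : realType} {N : nat}.
Implicit Types u v w : 'rV[R]_N.

Lemma dotC u v : dot u v = dot v u.
Proof. by apply: eq_bigr => i _; rewrite mulrC. Qed.

Lemma dotDl u v w : dot (u + v) w = dot u w + dot v w.
Proof. by rewrite /dot -big_split; apply: eq_bigr => i _; rewrite mxE mulrDl. Qed.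

Lemma dotNl u v : dot (- u) v = - dot u v.
Proof. by rewrite /dot -sumrN; apply: eq_bigr => i _; rewrite mxE mulNr. Qed.

Lemma dotZl a u v : dot (a *: u) v = a * dot u v.
Proof. by rewrite /dot mulr_sumr; apply: eq_bigr => i _; rewrite mxE mulrA. Qed.

Lemma dotDr u v w : dot u (v + w) = dot u v + dot u w.
Proof. by rewrite !(dotC u) dotDl. Qed.

Lemma dotNr u v : dot u (- v) = - dot u v.
Proof. by rewrite !(dotC u) dotNl. Qed.

Lemma dotZr a u v : dot u (a *: v) = a * dot u v.
Proof. by rewrite !(dotC u) dotZl. Qed.

Lemma dot0l u : dot 0 u = 0.
Proof. by rewrite -(scale0r 0) dotZl mul0r. Qed.

Definition dotE := (dotDl, dotDr, dotNl, dotNr, dotZl, dotZr).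

Lemma dot_ge0 u : 0 <= dot u u.
Proof. by apply: sumr_ge0 => i _; rewrite -expr2 sqr_ge0. Qed.

Lemma enorm_sqr u : enorm u ^+ 2 = dot u u.
Proof. by rewrite /enorm sqr_sqrtr// dot_ge0. Qed.

Lemma enorm_ge0 u : 0 <= enorm u.
Proof. exact: sqrtr_ge0. Qed.

Lemma dot_eq0 u : dot u u = 0 -> u = 0.
Proof.
move=> /eqP; rewrite psumr_eq0 => [/allP h|i _]; last by rewrite -expr2 sqr_ge0.
apply/rowP => i; rewrite mxE; apply/eqP.
by have := h i (mem_index_enum _); rewrite mulf_eq0 orbb.
Qed.

Lemma dot_le u v : 2 * `|dot u v| <= dot u u + dot v v.
Proof.
have h1 := dot_ge0 (u - v); have h2 := dot_ge0 (u + v).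
have hC := dotC v u.
rewrite !dotE hC in h1 h2.
have [_|_] := ger0P (dot u v); lra.
Qed.

Lemma dot_CS u v : dot u v ^+ 2 <= dot u u * dot v v.
Proof.
have [v0|v0] := eqVneq (dot v v) 0.
  by rewrite (dot_eq0 v0) (dotC u) !dot0l expr0n mulr0.
have vp : 0 < dot v v by rewrite lt_neqAle eq_sym v0 dot_ge0.
have := dot_ge0 (dot v v *: u - dot u v *: v); rewrite !dotE (dotC v u) => h.
rewrite -subr_ge0 -(pmulr_rge0 _ vp); move: h; congr (_ <= _); ring.
Qed.

Lemma coord_le_enorm u i : `|u 0 i| <= enorm u.
Proof.
rewrite -(@ler_pXn2r _ 2) ?nnegrE ?enorm_ge0// enorm_sqr real_normK ?num_real//.
rewrite /dot (bigD1 i)//= expr2 lerDl sumr_ge0// => j _.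
by rewrite -expr2 sqr_ge0.
Qed.

End dot_theory.

Section cons_theory.
Context {R : realType}.

Lemma cons_rV_surj N (x : 'rV[R]_N.+1) : exists t y, x = cons_rV (t, y).
Proof.
exists (x 0 0), (rsubmx (x : 'rV[R]_(1 + N))).
pose x' : 'rV[R]_(1 + N) := x.
rewrite /cons_rV /= -/x' (_ : (x 0 0)%:M = lsubmx x') ?hsubmxK//.
by apply/rowP => i; rewrite !ord1 !mxE eqxx mulr1n; congr (x _ _); exact/val_inj.
Qed.

Lemma cons_rV_ord0 N (t : R) (y : 'rV[R]_N) : cons_rV (t, y) 0 ord0 = t.
Proof.
have := row_mxEl (t%:M : 'M[R]_1) y 0 0; rewrite [RHS]mxE eqxx mulr1n => h; rewrite -[RHS]h.
by rewrite /cons_rV; congr (row_mx _ _ _ _); exact/val_inj.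
Qed.

Lemma cons_rV_lift N (t : R) (y : 'rV[R]_N) i :
  cons_rV (t, y) 0 (lift ord0 i) = y 0 i.
Proof.
rewrite -(row_mxEr (t%:M : 'M[R]_1) y 0 i).
by rewrite /cons_rV; congr (row_mx _ _ _ _); exact/val_inj.
Qed.

Lemma dot_cons N (t s : R) (y z : 'rV[R]_N) :
  dot (cons_rV (t, y)) (cons_rV (s, z)) = t * s + dot y z.
Proof.
rewrite /dot big_ord_recl !cons_rV_ord0; congr (_ + _).
by apply: eq_bigr => i _; rewrite !cons_rV_lift.
Qed.

Lemma cons_rVB N (t s : R) (y z : 'rV[R]_N) :
  cons_rV (t, y) - cons_rV (s, z) = cons_rV (t - s, y - z).
Proof.
apply/rowP => i; have [->|[j ->]] : i = ord0 \/ exists j, i = lift ord0 j.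
  by case: (unliftP ord0 i) => [j ->|->]; [right; exists j|left].
  by rewrite [LHS]mxE [X in _ + X]mxE !cons_rV_ord0.
by rewrite [LHS]mxE [X in _ + X]mxE !cons_rV_lift !mxE.
Qed.

End cons_theory.

Section reflection.
Context {R : realType}.
Local Notation leb := (@lebesgue_measure R).

Let measurable_refl1 (c : R) :
  measurable_fun setT ((fun y : R => c - y) : measurableTypeR R -> measurableTypeR R).
Proof. by apply: measurable_funB. Qed.

Lemma lebesgue_measure_reflect (c : R) (A : set R) : measurable A ->
  leb ((fun y => c - y) @^-1` A) = leb A.
Proof.
move=> mA.
have mr := @measurable_refl1 c.
rewrite -[LHS]/(pushforward leb ((fun y : R => c - y) : measurableTypeR R -> measurableTypeR R) A).
apply/esym/lebesgue_measure_unique => //= X [[a b]] _ <-.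
rewrite /pushforward /=.
rewrite (_ : _ @^-1` _ = `[c - b, c - a[%classic); last first.
  apply/seteqP; split => y /=; rewrite !in_itv/=; lra.
by rewrite !lebesgue_measure_itv/= !lte_fin ltrD2l ltrN2 -!EFinD; case: ifP => // _; congr EFin; ring.
Qed.

Lemma ge0_integral_reflect1 (c : R) (f : R -> \bar R) :
  measurable_fun setT f -> (forall x, 0 <= f x)%E ->
  (\int[leb]_y f (c - y)%R = \int[leb]_y f y)%E.
Proof.
move=> mf f0.
rewrite -(@ge0_integral_pushforward _ _ _ _ _ _ (@measurable_refl1 c) leb setT f)//.
by apply: eq_measure_integral => A mA _; exact: lebesgue_measure_reflect.
Qed.

Let measurable_cons N :
  measurable_fun setT (@cons_rV R N : measurableTypeR R * 'rV[R]_N -> 'rV[R]_N.+1).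
Proof. exact: measurable_cons_rV. Qed.

Lemma measurable_cons_snd N (t : R) :
  measurable_fun setT (fun y : 'rV[R]_N => cons_rV (t, y)).
Proof.
apply: measurable_fun_rV => i; case: (unliftP ord0 i) => [j ->|->].
  by under eq_fun do rewrite cons_rV_lift; exact: measurable_coord.
by under eq_fun do rewrite cons_rV_ord0; exact: measurable_cst.
Qed.

Lemma ge0_integral_lebesgue_rVS N (f : 'rV[R]_N.+1 -> \bar R) :
  measurable_fun setT f -> (forall x, 0 <= f x)%E ->
  (\int[lebesgue_rV N.+1]_x f x =
   \int[leb]_t \int[lebesgue_rV N]_y f (cons_rV (t, y)))%E.
Proof.
move=> mf f0.
rewrite [LHS](@ge0_integral_pushforward _ _ _ _ _ _ (@measurable_cons N) (leb \x lebesgue_rV N)%E setT f)//.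
rewrite preimage_setT fubini_tonelli1//.
  exact: (measurableT_comp mf (@measurable_cons N)).
by move=> x; exact: f0.
Qed.

(** Every change of variables below is of the form [y |-> c - y]. The proof is
    by induction on the dimension, one coordinate at a time. *)
Lemma ge0_integral_reflect N (c : 'rV[R]_N) (f : 'rV[R]_N -> \bar R) :
  measurable_fun setT f -> (forall x, 0 <= f x)%E ->
  (\int[lebesgue_rV N]_y f (c - y)%R = \int[lebesgue_rV N]_y f y)%E.
Proof.
elim: N c f => [|N ih] c f mf f0.
  by apply: eq_integral => y _; rewrite [c - y]thinmx0 [y]thinmx0.
have mr : measurable_fun setT (fun y : 'rV[R]_N.+1 => c - y).
  by apply: measurable_rVB => //; exact: measurable_id.
rewrite ge0_integral_lebesgue_rVS//; last exact: (measurableT_comp mf mr).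
rewrite ge0_integral_lebesgue_rVS//.
have [c0 [c' ->]] := cons_rV_surj c.
have mfc : measurable_fun setT (f \o @cons_rV R N).
  exact: (measurableT_comp mf (@measurable_cons N)).
pose g t := (\int[lebesgue_rV N]_y f (cons_rV (t, y)))%E.
rewrite -[RHS](@ge0_integral_reflect1 c0 g).
- apply: eq_integral => t _; rewrite /g -[RHS](ih c').
  + by apply: eq_integral => y _; rewrite cons_rVB.
  + exact: (measurableT_comp mf (measurable_cons_snd (c0 - t))).
  + by [].
- have H := @measurable_fun_fubini_tonelli_F _ _ (measurableTypeR R) _ _ (lebesgue_rV N)
    (f \o @cons_rV R N) mfc (fun p => f0 _).
  exact: H.
- by move=> t; exact: integral_ge0.
Qed.

Lemma measurable_reflect N (c : 'rV[R]_N) :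
  measurable_fun setT (fun y : 'rV[R]_N => c - y).
Proof. by apply: measurable_rVB => //; exact: measurable_id. Qed.

Lemma Rintegral_reflect N (c : 'rV[R]_N) (f : 'rV[R]_N -> R) :
  measurable_fun setT f ->
  \int[lebesgue_rV N]_y f (c - y) = \int[lebesgue_rV N]_y f y.
Proof.
move=> mf; rewrite /Rintegral; congr fine; rewrite integralE [RHS]integralE.
have mF : measurable_fun setT (EFin \o f) by exact/measurable_EFinP.
congr (_ - _)%E.
  rewrite -[RHS](@ge0_integral_reflect _ c (EFin \o f)^\+%E).
  - by apply: eq_integral => y _; rewrite !funeposE.
  - exact: measurable_funepos.
  - by move=> x; exact: funepos_ge0.
rewrite -[RHS](@ge0_integral_reflect _ c (EFin \o f)^\-%E).
- by apply: eq_integral => y _; rewrite !funenegE.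
- exact: measurable_funeneg.
- by move=> x; exact: funeneg_ge0.
Qed.

Lemma cintegral_reflect N (c : 'rV[R]_N) (f : 'rV[R]_N -> R[i]) :
  cmeasurable f ->
  cintegral (lebesgue_rV N) setT (fun y => f (c - y)) =
  cintegral (lebesgue_rV N) setT f.
Proof.
move=> [f1 f2]; apply: complex_eqP.
  exact: (Rintegral_reflect c f1).
exact: (Rintegral_reflect c f2).
Qed.

Lemma integrable_reflect N (c : 'rV[R]_N) (f : 'rV[R]_N -> R) :
  (lebesgue_rV N).-integrable setT (EFin \o f) ->
  (lebesgue_rV N).-integrable setT (EFin \o (fun y => f (c - y))).
Proof.
move=> /integrableP[mf foo]; apply/integrableP; split.
  exact: (measurableT_comp mf (measurable_reflect c)).
rewrite (@ge0_integral_reflect _ c (fun y => `|(f y)%:E|)%E)//.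
exact: measurableT_comp.
Qed.

End reflection.

Section gauss.
Context {R : realType}.
Local Notation leb := (@lebesgue_measure R).

Let measurable_cons N :
  measurable_fun setT (@cons_rV R N : measurableTypeR R * 'rV[R]_N -> 'rV[R]_N.+1).
Proof. exact: measurable_cons_rV. Qed.

Definition gauss N (c : R) (x : 'rV[R]_N) : R := expR (- c * dot x x).

Lemma gauss_ge0 N c (x : 'rV[R]_N) : 0 <= gauss c x.
Proof. exact: expR_ge0. Qed.

Lemma gauss_le1 N c (x : 'rV[R]_N) : 0 <= c -> gauss c x <= 1.
Proof.
by move=> c0; rewrite -expR0 ler_expR mulNr oppr_le0 mulr_ge0// dot_ge0.
Qed.

Lemma gaussN N c (x : 'rV[R]_N) : gauss c (- x) = gauss c x.
Proof. by rewrite /gauss dotNl dotNr opprK. Qed.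

Lemma gaussD N a b (x : 'rV[R]_N) : gauss (a + b) x = gauss a x * gauss b x.
Proof. by rewrite /gauss -expRD opprD mulrDl. Qed.

Lemma measurable_gauss N c : measurable_fun setT (@gauss N c).
Proof.
apply: measurableT_comp => //; apply: measurable_funM => //.
by apply: measurable_dot; exact: measurable_id.
Qed.

Lemma gauss_cons N c t (y : 'rV[R]_N) :
  gauss c (cons_rV (t, y)) = gauss1 c t * gauss c y.
Proof. by rewrite /gauss dot_cons mulrDr expRD /gauss1 expr2. Qed.

Lemma integral_gauss N (c : R) : 0 < c ->
  (\int[lebesgue_rV N]_x (gauss c x)%:E)%E = (Num.sqrt (pi / c) ^+ N)%:E.
Proof.
move=> c0; elim: N => [|N ih].
  rewrite integral_dirac//; last by apply/measurable_EFinP; exact: measurable_gauss.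
  by rewrite diracT mul1e /gauss /dot big_ord0 mulr0 expR0 expr0.
rewrite ge0_integral_lebesgue_rVS; last first.
- by move=> x; rewrite lee_fin gauss_ge0.
- by apply/measurable_EFinP; exact: measurable_gauss.
have E t : (\int[lebesgue_rV N]_y (gauss c (cons_rV (t, y)))%:E =
    (gauss1 c t)%:E * (Num.sqrt (pi / c) ^+ N)%:E)%E.
  under eq_integral do rewrite gauss_cons EFinM.
  rewrite ge0_integralZl//.
  - by rewrite ih.
  - by apply/measurable_EFinP; exact: measurable_gauss.
  - by move=> x _; rewrite lee_fin gauss_ge0.
  - by rewrite lee_fin expR_ge0.
under eq_integral do rewrite E.
rewrite ge0_integralZr//.
- by rewrite integral_gauss1// -EFinM exprS.
- by apply/measurable_EFinP; exact: measurable_gauss1.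
- by move=> x _; rewrite lee_fin expR_ge0.
Qed.

Definition gaussK N (c : R) : R := Num.sqrt (pi / c) ^+ N.

Lemma gaussK_gt0 N c : 0 < c -> 0 < gaussK N c.
Proof. by move=> c0; rewrite exprn_gt0// sqrtr_gt0 divr_gt0// pi_gt0. Qed.

Lemma integrable_gauss N (c : R) : 0 < c ->
  (lebesgue_rV N).-integrable setT (EFin \o @gauss N c).
Proof.
move=> c0; apply/integrableP; split.
  by apply/measurable_EFinP; exact: measurable_gauss.
under eq_integral do rewrite /= ger0_norm ?gauss_ge0//.
by rewrite integral_gauss// ltry.
Qed.

Lemma Rintegral_gauss N (c : R) : 0 < c ->
  \int[lebesgue_rV N]_x gauss c x = gaussK N c.
Proof. by move=> c0; rewrite /Rintegral integral_gauss. Qed.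

Definition cis (s : R) : R[i] := cexp ('i%C * s%:C).

Lemma cis_cmeasurable d (T : measurableType d) (f : T -> R) :
  measurable_fun setT f -> cmeasurable (fun x => cis (f x)).
Proof.
move=> mf; apply: cmeasurable_cexp; apply: cmeasurableM.
  exact: cmeasurable_cst.
exact: cmeasurable_real.
Qed.

Lemma normc_cis s : normc (cis s) = 1.
Proof. by rewrite normc_cexp Re_imul /= oppr0 expR0. Qed.

Lemma Re_cis s : Re (cis s) = cos s.
Proof. by rewrite Re_cexp Re_imul Im_imul /= oppr0 expR0 mul1r. Qed.

Lemma Im_cis s : Im (cis s) = sin s.
Proof. by rewrite Im_cexp Re_imul Im_imul /= oppr0 expR0 mul1r. Qed.

Lemma cisD s t : cis (s + t) = cis s * cis t.
Proof. by rewrite /cis rmorphD mulrDr cexpD. Qed.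

Lemma cis0 : cis 0 = 1.
Proof. by rewrite /cis mulr0 cexp0. Qed.

Lemma cfubini_lebesgue_rVS N (f : R -> R[i]) (g : 'rV[R]_N -> R[i]) h :
  cintegrable leb setT f -> cintegrable (lebesgue_rV N) setT g ->
  cmeasurable h -> (forall t y, h (cons_rV (t, y)) = f t * g y) ->
  cintegral (lebesgue_rV N.+1) setT h =
  cintegral leb setT f * cintegral (lebesgue_rV N) setT g.
Proof.
move=> fi gi mh hE.
have mf := cintegrable_cmeasurable fi; have mg := cintegrable_cmeasurable gi.
have ip : cintegrable (leb \x lebesgue_rV N)%E setT (fun p => f p.1 * g p.2).
  apply: (@cintegrable_le R _ (measurableTypeR R * 'rV[R]_N)%type (leb \x lebesgue_rV N)%E _
    (fun p => normc (f p.1) * normc (g p.2))).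
  - apply: cmeasurableM.
      exact: (cmeasurable_comp mf measurable_fst).
    exact: (cmeasurable_comp mg measurable_snd).
  - exact: (@integrable_prod R _ _ (measurableTypeR R) _ leb (lebesgue_rV N)
      (normc \o f) (normc \o g) (cintegrable_normc fi) (cintegrable_normc gi)).
  - by move=> p; rewrite normcM.
transitivity (cintegral (leb \x lebesgue_rV N)%E setT (fun p => f p.1 * g p.2)).
  case: mh => h1 h2; case: ip => ip1 ip2.
  apply: complex_eqP; rewrite ?Re_cintegral ?Im_cintegral /Rintegral; congr fine.
    rewrite (@integral_pushforward _ _ _ _ _ _ (@measurable_cons N) (leb \x lebesgue_rV N)%E setT (fun x => (Re (h x))%:E))//.
    - by apply: eq_integral => -[t y] _; rewrite /= hE.
    - exact/measurable_EFinP.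
    - rewrite preimage_setT.
      by rewrite (_ : _ \o _ = EFin \o (fun p => Re (f p.1 * g p.2)))//; apply/funext => -[t y] /=; rewrite hE.
  rewrite (@integral_pushforward _ _ _ _ _ _ (@measurable_cons N) (leb \x lebesgue_rV N)%E setT (fun x => (Im (h x))%:E))//.
  - by apply: eq_integral => -[t y] _; rewrite /= hE.
  - exact/measurable_EFinP.
  - rewrite preimage_setT.
    by rewrite (_ : _ \o _ = EFin \o (fun p => Im (f p.1 * g p.2)))//; apply/funext => -[t y] /=; rewrite hE.
rewrite cfubini1//= -[RHS]mulrC -cintegralZ//; apply: eq_cintegral => t.
by rewrite [RHS]mulrC cintegralZ.
Qed.

(** Gaussians and characters factor over the coordinates, which reduces the
    statement to the line by induction. *)
Lemma cintegral_gauss N (c : R) (u : 'rV[R]_N) : 0 < c ->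
  cintegral (lebesgue_rV N) setT (fun x => cis (dot u x) * (gauss c x)%:C) =
  (gaussK N c * gauss (4 * c)^-1 u)%:C.
Proof.
move=> c0; elim: N u => [|N ih] u.
  rewrite (_ : (fun x => _) = (fun=> 1%:C)); last first.
    by apply/funext => x; rewrite /gauss /dot !big_ord0 cis0 mulr0 expR0 mul1r.
  rewrite cintegral_real Rintegral_cst// mul1r /= indicT.
  rewrite /gaussK expr0 mul1r.
  by rewrite /gauss /dot big_ord0 mulr0 expR0.
have [t [v ->]] := cons_rV_surj u.
have mgd M (w : 'rV[R]_M) : cmeasurable (fun x => cis (dot w x) * (gauss c x)%:C).
  apply: cmeasurableM; last by apply: cmeasurable_real; exact: measurable_gauss.
  by apply: cis_cmeasurable; apply: measurable_dot => //; exact: measurable_id.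
have ngd M (w x : 'rV[R]_M) : normc (cis (dot w x) * (gauss c x)%:C) <= gauss c x.
  by rewrite normcM normc_cis mul1r normc_real ger0_norm// gauss_ge0.
rewrite (cfubini_lebesgue_rVS (f := fun s => cis (t * s) * (gauss1 c s)%:C)
  (g := fun y => cis (dot v y) * (gauss c y)%:C)).
- rewrite ih cexp_gauss1// -rmorphM/= gauss_cons; congr (_%:C).
  by rewrite /gaussK exprS; ring.
- apply: (@cintegrable_le R _ (measurableTypeR R) leb _ (gauss1 c)).
  + apply: cmeasurableM; last by apply: cmeasurable_real; exact: measurable_gauss1.
    by apply: cis_cmeasurable; exact: mulrl_measurable.
  + exact: integrable_gauss1.
  + by move=> x; rewrite normcM normc_cis mul1r normc_real ger0_norm// expR_ge0.
- by apply: (@cintegrable_le R _ _ (lebesgue_rV N) _ (@gauss N c)) => //; exact: integrable_gauss.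
- exact: mgd.
- move=> s y; rewrite dot_cons gauss_cons cisD rmorphM/=.
  by move: (cis _) (cis _) (_%:C) (_%:C) => a b e f; ring.
Qed.

End gauss.

(** * Functions of positive type *)

Section complex_limits.
Context {R : realType}.
Implicit Types (u : nat -> R[i]) (l : R[i]).

Lemma ccvg_cst l : ccvg (fun=> l) l.
Proof. by split; exact: cvg_cst. Qed.

Lemma ccvgM u v l k : ccvg u l -> ccvg v k -> ccvg (fun n => u n * v n) (l * k).
Proof.
move=> [u1 u2] [v1 v2]; split.
  rewrite Re_mul; under eq_fun do rewrite Re_mul.
  by apply: cvgB; exact: cvgM.
rewrite Im_mul; under eq_fun do rewrite Im_mul.
by apply: cvgD; exact: cvgM.
Qed.

Lemma ccvg_cexp u l : ccvg u l -> ccvg (fun n => cexp (u n)) (cexp l).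
Proof.
move=> [u1 u2]; split.
  rewrite Re_cexp; under eq_fun do rewrite Re_cexp.
  apply: cvgM; first exact: (continuous_cvg _ (@continuous_expR R _) u1).
  exact: (continuous_cvg _ (@continuous_cos R _) u2).
rewrite Im_cexp; under eq_fun do rewrite Im_cexp.
apply: cvgM; first exact: (continuous_cvg _ (@continuous_expR R _) u1).
exact: (continuous_cvg _ (@continuous_sin R _) u2).
Qed.

Lemma ccvg_normc u l : normc (u n - l) @[n --> \oo] --> 0 -> ccvg u l.
Proof.
move=> h; split; apply/subr_cvg0; apply: norm_cvg0;
  apply: (@squeeze_cvgr _ _ _ _ (fun=> 0) (fun n => normc (u n - l))) => //;
  [|exact: cvg_cst| |exact: cvg_cst]; apply: nearW => n; rewrite normr_ge0 /=.
  by rewrite -Re_opp -Re_add Re_le_normc.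
by rewrite -Im_opp -Im_add Im_le_normc.
Qed.

(** In [0 <= l] the order of the complex numbers is meant: [l] is real and
    nonnegative. *)
Lemma ccvg_ge0 u l : (forall n, 0 <= u n) -> ccvg u l -> 0 <= l.
Proof.
move=> u0 [u1 u2]; rewrite lecE /=; apply/andP; split.
  have h n : Im (u n) = 0 by exact: ger0_Im.
  have e : Im (u n) @[n --> \oo] --> (0 : R).
    by under eq_fun do rewrite h; exact: cvg_cst.
  by rewrite -(cvg_lim (@Rhausdorff R) u2) (cvg_lim (@Rhausdorff R) e).
apply: (cvgr_to_ge u1); apply: nearW => n.
by have := u0 n; rewrite lecE /= => /andP[].
Qed.

Lemma pow_fact_le_exp (x : R) n : 0 <= x -> x ^+ n / n`!%:R <= expR x.
Proof.
case: n => [|n] x0; first by rewrite expr0 fact0 divr1 -expR0 ler_expR.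
by apply: le_trans (expR_ge1Dxn n x0); rewrite lerDr.
Qed.

Lemma cexp_trunc_cvg (z : R[i]) : ccvg (cexp_trunc ^~ z) (cexp z).
Proof.
apply: ccvg_normc.
apply: (@squeeze_cvgr _ _ _ _ (fun=> 0) (fun n => normc z ^+ n / n`!%:R * expR (normc z))).
- by apply: nearW => n; rewrite normc_ge0 /= normcBC cexp_taylor.
- exact: cvg_cst.
- by rewrite -(mul0r (expR (normc z))); apply: cvgMl; exact: cvg_exp_coeff.
Qed.

Lemma normc_cexp_trunc M (z : R[i]) (L : R) : normc z <= L ->
  normc (cexp_trunc M z) <= expR L + expR L * expR L.
Proof.
move=> zL; rewrite -[cexp_trunc M z](subKr (cexp z)).
have eL : expR (normc z) <= expR L by rewrite ler_expR.
apply: le_trans (normcB _ _) _; apply: lerD.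
  rewrite normc_cexp (le_trans _ eL)// ler_expR (le_trans (ler_norm _))//.
  exact: Re_le_normc.
apply: le_trans (cexp_taylor _ _) _; apply: ler_pM; rewrite ?expR_ge0//.
  by rewrite divr_ge0 ?exprn_ge0 ?normc_ge0.
by apply: le_trans eL; apply: pow_fact_le_exp; exact: normc_ge0.
Qed.

Lemma ge0_complexE (z : R[i]) : (0 <= z) = (Im z == 0) && (0 <= Re z).
Proof. by rewrite lecE /= eq_sym. Qed.

Lemma cintegral_ge0 d (T : measurableType d) (mu : {measure set T -> \bar R})
  (f : T -> R[i]) : (forall x, 0 <= f x) -> 0 <= cintegral mu setT f.
Proof.
move=> f0; rewrite ge0_complexE Re_cintegral Im_cintegral; apply/andP; split.
  rewrite (_ : (fun x => Im (f x)) = cst 0) ?Rintegral_cst ?mul0r//.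
  by apply/funext => x; exact: ger0_Im.
by apply: Rintegral_ge0 => x _; have := f0 x; rewrite ge0_complexE => /andP[].
Qed.

End complex_limits.

Section positive_type.
Context {R : realType} {N : nat}.
Local Notation V := 'rV[R]_N.
Local Notation leb := (lebesgue_rV N : {sigma_finite_measure set V -> \bar R}).
Variable eta : R.
Hypothesis eta0 : 0 < eta.
Implicit Types m l : V -> R[i].

(** The condition says that the inverse Fourier transform of
    [m * exp (- eta |.|^2)] is nonnegative. The Fourier transform of any finite
    positive measure satisfies it, and the Gaussian factor makes every integral
    absolutely convergent. *)
Definition positive_type m : Prop :=
  [/\ cmeasurable m, exists M, forall u, normc (m u) <= M &
      forall x, 0 <= cintegral leb setT
        (fun u => cis (- dot u x) * m u * (gauss eta u)%:C)].

Lemma cmeasurable_gauss : cmeasurable (fun u : V => (gauss eta u)%:C).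
Proof. by apply: cmeasurable_real; exact: measurable_gauss. Qed.

Lemma cmeasurable_cis_dot (x : V) : cmeasurable (fun u : V => cis (- dot u x)).
Proof.
apply: cis_cmeasurable; apply: measurableT_comp => //.
by apply: measurable_dot => //; exact: measurable_id.
Qed.

Lemma cmeasurable_fourier m x : cmeasurable m ->
  cmeasurable (fun u : V => cis (- dot u x) * m u * (gauss eta u)%:C).
Proof.
move=> mm; apply: cmeasurableM; last exact: cmeasurable_gauss.
by apply: cmeasurableM => //; exact: cmeasurable_cis_dot.
Qed.

Lemma normc_fourier m x M u : normc (m u) <= M ->
  normc (cis (- dot u x) * m u * (gauss eta u)%:C) <= M * gauss eta u.
Proof.
move=> mM; rewrite normcM normcM normc_cis mul1r normc_real ger0_norm ?gauss_ge0//.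
by rewrite ler_wpM2r ?gauss_ge0.
Qed.

Lemma cintegrable_fourier m x M : cmeasurable m -> (forall u, normc (m u) <= M) ->
  cintegrable leb setT (fun u : V => cis (- dot u x) * m u * (gauss eta u)%:C).
Proof.
move=> mm mM.
apply: (@cintegrable_le _ _ _ leb _ (fun u => M * gauss eta u)).
- exact: cmeasurable_fourier.
- by apply: integrable_scale; exact: integrable_gauss.
- by move=> u; exact: normc_fourier.
Qed.

Lemma positive_type1 : positive_type (fun=> 1).
Proof.
split; first exact: cmeasurable_cst.
  by exists 1 => u; rewrite normc_1.
move=> x; rewrite (@eq_cintegral _ _ _ _ _
  (fun u => cis (dot (- x) u) * (gauss eta u)%:C)) => [|u].
  by rewrite cintegral_gauss// ler0c mulr_ge0 ?gauss_ge0// ltW// gaussK_gt0.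
by rewrite mulr1 dotNl (dotC x).
Qed.

Lemma positive_typeD m l : positive_type m -> positive_type l ->
  positive_type (fun u => m u + l u).
Proof.
move=> [mm [M mM] mp] [ml [L lL] lp]; split; first exact: cmeasurableD.
  exists (M + L) => u; apply: le_trans (normcD _ _) _; exact: lerD.
move=> x; rewrite (@eq_cintegral _ _ _ _ _ (fun u =>
    cis (- dot u x) * m u * (gauss eta u)%:C + cis (- dot u x) * l u * (gauss eta u)%:C)).
  rewrite cintegralD; first exact: addr_ge0.
    exact: cintegrable_fourier mM.
  exact: cintegrable_fourier lL.
by move=> u; rewrite mulrDr mulrDl.
Qed.

Lemma positive_typeZ (c : R) m : 0 <= c -> positive_type m ->
  positive_type (fun u => m u * c%:C).
Proof.
move=> c0 [mm [M mM] mp]; split.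
- by apply: cmeasurableM => //; exact: cmeasurable_cst.
- by exists (M * c) => u; rewrite normcM normc_real ger0_norm// ler_wpM2r.
- move=> x; rewrite (@eq_cintegral _ _ _ _ _ (fun u =>
    c%:C * (cis (- dot u x) * m u * (gauss eta u)%:C))).
    rewrite cintegralZ; last exact: cintegrable_fourier mM.
    by rewrite mulr_ge0// ler0c.
  by move=> u; move: (cis _) (m u) c%:C (_%:C) => a b e f; ring.
Qed.

(** A character on the Fourier side is a translation. *)
Lemma positive_type_shift (b : V) m : positive_type m ->
  positive_type (fun u => m u * cis (dot u b)).
Proof.
move=> [mm [M mM] mp]; split.
- apply: cmeasurableM => //; apply: cis_cmeasurable.
  by apply: measurable_dot => //; exact: measurable_id.
- by exists M => u; rewrite normcM normc_cis mulr1.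
- move=> x; rewrite (@eq_cintegral _ _ _ _ _ (fun u =>
    cis (- dot u (x - b)) * m u * (gauss eta u)%:C))//.
  move=> u; rewrite dotDr dotNr opprB cisD.
  by move: (cis _) (cis _) (m u) (_%:C) => a b' e f; ring.
Qed.

Lemma positive_type_lim (m_ : nat -> V -> R[i]) m M :
  (forall n, positive_type (m_ n)) -> (forall n u, normc (m_ n u) <= M) ->
  (forall u, ccvg (m_ ^~ u) (m u)) -> positive_type m.
Proof.
move=> mp mM mc; have mm : cmeasurable m.
  by apply: (cmeasurable_cvg _ mc) => n; have [] := mp n.
split => //.
  exists (M + M) => u; apply: le_trans (normc_le_ReIm _) _.
  have [c1 c2] := mc u; apply: lerD.
    apply: (cvgr_to_le (cvg_norm c1)); apply: nearW => n.
    by apply: le_trans (mM n u); exact: Re_le_normc.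
  apply: (cvgr_to_le (cvg_norm c2)); apply: nearW => n.
  by apply: le_trans (mM n u); exact: Im_le_normc.
move=> x.
apply: (@ccvg_ge0 _ (fun n => cintegral leb setT
  (fun u => cis (- dot u x) * m_ n u * (gauss eta u)%:C))).
  by move=> n; have [] := mp n.
apply: (@cdominated _ _ _ leb _ _ (fun u => M * gauss eta u)).
- by move=> n; apply: cmeasurable_fourier; have [] := mp n.
- move=> u; apply: ccvgM; last exact: ccvg_cst.
  by apply: ccvgM; [exact: ccvg_cst|exact: mc].
- by apply: integrable_scale; exact: integrable_gauss.
- by move=> n u; exact: normc_fourier.
Qed.

(** Multiplication by the Fourier transform of a finite measure, here the
    image by [Y] of the measure of density [g]: it superposes translates. *)
Lemma positive_type_mul d (T : measurableType d)
    (lam : {sigma_finite_measure set T -> \bar R}) (g : T -> R) (Y : T -> V) m :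
  (forall z, 0 <= g z) -> lam.-integrable setT (EFin \o g) ->
  measurable_fun setT Y -> positive_type m ->
  positive_type (fun u =>
    m u * cintegral lam setT (fun z => (g z)%:C * cis (dot u (Y z)))).
Proof.
move=> g0 ig mY [mm [M mM] mp].
have mg : measurable_fun setT g by apply/measurable_EFinP; exact: measurable_int ig.
have M0 : 0 <= M by apply: le_trans (mM 0); exact: normc_ge0.
have mYp : measurable_fun setT (fun p : V * T => dot p.1 (Y p.2)).
  apply: measurable_dot; first exact: measurable_fst.
  exact: (measurableT_comp mY measurable_snd).
have mcis : cmeasurable (fun p : V * T => (g p.2)%:C * cis (dot p.1 (Y p.2))).
  apply: cmeasurableM; last exact: cis_cmeasurable.
  by apply: cmeasurable_real; exact: (measurableT_comp mg measurable_snd).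
have mu1 (u : V) : cmeasurable (fun z => (g z)%:C * cis (dot u (Y z))).
  apply: cmeasurableM; first exact: cmeasurable_real.
  by apply: cis_cmeasurable; apply: measurable_dot => //; exact: measurable_cst.
have n1 (u : V) z : normc ((g z)%:C * cis (dot u (Y z))) <= g z.
  by rewrite normcM normc_cis mulr1 normc_real ger0_norm.
split.
- apply: cmeasurableM => //.
  exact: (@cmeasurable_cintegral _ _ _ _ _ lam (fun u z => (g z)%:C * cis (dot u (Y z)))).
- exists (M * \int[lam]_z g z) => u; rewrite normcM.
  apply: ler_pM => //; try exact: normc_ge0.
  exact: normc_cintegral_le.
move=> x.
pose F u z := cis (- dot u x) * m u * (gauss eta u)%:C * ((g z)%:C * cis (dot u (Y z))).
rewrite (@eq_cintegral _ _ _ _ _ (fun u => cintegral lam setT (F u))); last first.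
  move=> u; rewrite /F cintegralZ.
    by move: (cis _) (m u) (cintegral _ _ _) (_%:C) => a b e f; ring.
  by apply: (@cintegrable_le _ _ _ lam _ g).
rewrite cfubini; last first.
  apply: (@cintegrable_le _ _ _ (leb \x lam)%E _ (fun p => (M * gauss eta p.1) * g p.2)).
  - apply: cmeasurableM => //.
    exact: (cmeasurable_comp (cmeasurable_fourier x mm) measurable_fst).
  - apply: (@integrable_prod _ _ _ _ _ leb lam (fun u => M * gauss eta u) g) => //.
    by apply: integrable_scale; exact: integrable_gauss.
  - move=> [u z]; rewrite /F normcM; apply: ler_pM; try exact: normc_ge0.
      exact: normc_fourier.
    exact: n1.
apply: cintegral_ge0 => z.
rewrite (@eq_cintegral _ _ _ _ _ (fun u => (g z)%:C *
    (cis (- dot u (x - Y z)) * m u * (gauss eta u)%:C))).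
  rewrite cintegralZ; last exact: cintegrable_fourier mM.
  by rewrite mulr_ge0// ler0c.
move=> u; rewrite /F dotDr dotNr opprB cisD.
by move: (cis _) (cis _) (m u) (_%:C) (_%:C) => a b e f k; ring.
Qed.

Lemma positive_type_sum m n (F : nat -> V -> R[i]) :
  (forall k, positive_type (fun u => m u * F k u)) ->
  positive_type (fun u => m u * \sum_(k < n) F k u).
Proof.
move=> mF; elim: n => [|n ih].
  under eq_fun do rewrite big_ord0 mulr0 -(mulr0 1).
  exact: (@positive_typeZ 0 _ (lexx 0) positive_type1).
under eq_fun do rewrite big_ord_recr mulrDr.
exact: positive_typeD.
Qed.

(** Stability under multiplication by [l] passes to the exponential series. *)
Lemma positive_type_exp l L m : (forall u, normc (l u) <= L) ->
  (forall m, positive_type m -> positive_type (fun u => m u * l u)) ->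
  positive_type m -> positive_type (fun u => m u * cexp (l u)).
Proof.
move=> lL lp mp; have [_ [M mM] _] := mp.
have M0 : 0 <= M by apply: le_trans (mM 0); exact: normc_ge0.
have lk k : positive_type (fun u => m u * l u ^+ k).
  elim: k => [|k ih]; first by under eq_fun do rewrite expr0 mulr1.
  by under eq_fun do rewrite exprSr mulrA; exact: lp.
apply: (@positive_type_lim (fun n u => m u * cexp_trunc n (l u)) _
  (M * (expR L + expR L * expR L))).
- move=> n; apply: (@positive_type_sum m n (fun k u => l u ^+ k * (k`!%:R^-1)%:C)) => k.
  under eq_fun do rewrite mulrA.
  by apply: positive_typeZ; first by rewrite invr_ge0.
- move=> n u; rewrite normcM; apply: ler_pM; rewrite ?normc_ge0//.
  exact: normc_cexp_trunc.
- by move=> u; apply: ccvgM; [exact: ccvg_cst|exact: cexp_trunc_cvg].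
Qed.

(** The multiplier is the Fourier transform of a Gaussian measure carried by
    the line of [w]. *)
Lemma positive_type_gauss (w : V) m : positive_type m ->
  positive_type (fun u => m u * (expR (- (dot w u ^+ 2 / 2)))%:C).
Proof.
move=> mp; have h : 0 < 2^-1 :> R by rewrite invr_gt0.
pose K : R := Num.sqrt (pi / 2^-1).
have K0 : 0 < K by rewrite sqrtr_gt0 divr_gt0// pi_gt0.
have mY : measurable_fun setT ((fun z => z *: w) : measurableTypeR R -> V).
  by apply: measurable_fun_rV => i; under eq_fun do rewrite mxE; exact: mulrr_measurable.
have := @positive_type_mul _ (measurableTypeR R) (@lebesgue_measure R) (gauss1 2^-1)
  (fun z => z *: w) m (fun z => expR_ge0 _) (integrable_gauss1 h) mY mp.
move=> /(@positive_typeZ K^-1); rewrite invr_ge0 ltW// => /(_ isT).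
congr positive_type; apply/funext => u; rewrite -mulrA; congr (_ * _).
rewrite (@eq_cintegral _ _ (measurableTypeR R) _ _ (fun z => cexp ('i%C * (dot w u * z)%:C) * (gauss1 2^-1 z)%:C)).
  rewrite cexp_gauss1// -rmorphM/= -/K; congr (_%:C).
  rewrite mulrAC divff ?gt_eqF// mul1r /gauss1; congr expR.
  by rewrite mulNr; congr (- _); field.
by move=> z; rewrite mulrC dotZr (dotC u) mulrC [z * _]mulrC mulrC.
Qed.

Lemma positive_type_gauss_seq (ws : seq V) m : positive_type m ->
  positive_type (fun u => m u * (expR (- (\sum_(w <- ws) dot w u ^+ 2) / 2))%:C).
Proof.
elim: ws m => [|w ws ih] m mp.
  by under eq_fun do rewrite big_nil oppr0 mul0r expR0 mulr1.
have := ih _ (positive_type_gauss w mp); congr positive_type; apply/funext => u.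
rewrite -mulrA -rmorphM/= -expRD big_cons; congr (_ * (expR _)%:C).
by field.
Qed.

End positive_type.

(** * Positive semidefinite forms and finite measures *)

Section sum_of_squares.
Context {R : realType} {N : nat}.
Local Notation V := 'rV[R]_N.
Implicit Types B : V -> V -> R.

Definition psd_form B : Prop :=
  [/\ forall u v, B u v = B v u,
      forall c u v w, B u (c *: v + w) = c * B u v + B u w &
      forall u, 0 <= B u u].

Let form_quad B (c : R) u v : psd_form B ->
  B (c *: v + u) (c *: v + u) = c ^+ 2 * B v v + 2 * c * B u v + B u u.
Proof.
move=> [sym lin _]; rewrite lin !(sym (c *: v + u)) !lin (sym v u).
by ring.
Qed.

(** If [B u v] were nonzero, a suitable multiple of [v] added to [u] would give
    the form the value [-1]. *)
Let form_null B u v : psd_form B -> B v v = 0 -> B u v = 0.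
Proof.
move=> pB v0; apply: contrapT => /eqP uv0; have [_ _ pos] := pB.
have := pos ((- (B u u + 1) / (2 * B u v)) *: v + u).
rewrite form_quad// v0 mulr0 add0r.
have -> : 2 * (- (B u u + 1) / (2 * B u v)) * B u v = - (B u u + 1).
  by move: (B u u) (B u v) uv0 => x y y0; field.
by rewrite opprD addrAC addNr add0r oppr_ge0 ler10.
Qed.

Let form_CS B u v : psd_form B -> B v u ^+ 2 / B v v <= B u u.
Proof.
move=> pB; have [sym _ pos] := pB.
have [v0|v0] := eqVneq (B v v) 0; first by rewrite v0 invr0 mulr0.
have := pos ((- B v u / B v v) *: v + u); rewrite form_quad// (sym u v).
by move=> h; rewrite -subr_ge0; move: h; congr (_ <= _); field.
Qed.

(** When [B e e = 0] the division by zero yields zero, and the statement is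
    still right because then [B e] vanishes. *)
Let form_reduce B e : psd_form B ->
  psd_form (fun u v => B u v - B e u * B e v / B e e) /\
  forall v, B e v - B e e * B e v / B e e = 0.
Proof.
move=> pB; have [sym lin pos] := pB; split; first split.
- by move=> u v; rewrite sym [B e u * _]mulrC.
- by move=> c u v w; rewrite !lin; ring.
- by move=> u; rewrite subr_ge0 -expr2; exact: form_CS.
move=> v; have [e0|e0] := eqVneq (B e e) 0.
  by rewrite sym form_null// e0 !mul0r subrr.
by rewrite mulrAC divff// mul1r subrr.
Qed.

Let form_dot B e : psd_form B -> forall u,
  B e u = dot (\row_i B e (delta_mx 0 i)) u.
Proof.
move=> [sym lin _] u; rewrite {1}[u]row_sum_delta /dot.
have B0 : B e 0 = 0 by have := lin 1 e 0 0; rewrite scaler0 addr0 mul1r => h; lra.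
elim/big_ind2 : _ => [//|x1 x2 y1 y2 <- <-|i _].
  by have := lin 1 e x2 y2; rewrite scale1r mul1r.
by have := lin (u 0 i) e (delta_mx 0 i) 0; rewrite addr0 B0 addr0 mxE mulrC.
Qed.

(** Gram-Schmidt: subtracting [B e u ^ 2 / B e e] makes [e] orthogonal to
    everything, so one square per basis vector exhausts the form. *)
Lemma psd_sum_squares B : psd_form B ->
  exists ws : seq V, forall u, B u u = \sum_(w <- ws) dot w u ^+ 2.
Proof.
move=> pB.
suff H (s : seq 'I_N) : exists ws B', [/\ psd_form B',
    forall u, B u u = B' u u + \sum_(w <- ws) dot w u ^+ 2 &
    forall i v, i \in s -> B' (delta_mx 0 i) v = 0].
  have [ws [B' [pB' BB' B'0]]] := H (enum 'I_N).
  exists ws => u; rewrite BB' (form_dot u pB') /dot big1 ?add0r// => i _.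
  have [sym _ _] := pB'.
  by rewrite mxE sym B'0 ?mul0r// mem_enum.
elim: s => [|e s [ws [B' [pB' BB' B'0]]]].
  by exists [::], B; split => // u; rewrite big_nil addr0.
pose d : V := delta_mx 0 e.
have [pB'' B''0] := form_reduce d pB'.
exists ((Num.sqrt (B' d d))^-1 *: (\row_i B' d (delta_mx 0 i)) :: ws).
exists (fun u v => B' u v - B' d u * B' d v / B' d d); split => //.
  move=> u; rewrite big_cons BB' dotZl -form_dot// exprMn exprVn.
  have [_ _ pos] := pB'; rewrite sqr_sqrtr//.
  by ring.
move=> i v; rewrite in_cons => /orP[/eqP ->|si]; first exact: B''0.
have [sym _ _] := pB'.
by rewrite B'0// sym B'0// mul0r mul0r subr0.
Qed.

End sum_of_squares.

Section restriction.
Context {R : realType} {d : measure_display} {T : measurableType d}.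
Variables (mu : {measure set T -> \bar R}) (D : set T) (mD : measurable D).

Lemma integral_mrestr (f : T -> \bar R) : measurable_fun setT f ->
  (\int[mrestr mu mD]_x f x = \int[mu]_(x in D) f x)%E.
Proof.
move=> mf.
have H (g : T -> \bar R) : measurable_fun setT g -> (forall x, 0 <= g x)%E ->
    (\int[mrestr mu mD]_x g x = \int[mu]_(x in D) g x)%E.
  move=> mg g0; rewrite (@ge0_negligible_integral _ _ _ (mrestr mu mD) setT (~` D))//.
  - rewrite setTD setCK; apply: eq_measure_integral => A mA AD.
    by rewrite /= /mrestr setIidl.
  - exact: measurableC.
  - by rewrite /= /mrestr setICl measure0.
rewrite [LHS]integralE [RHS]integralE; congr (_ - _)%E; apply: H => //.
- exact: measurable_funepos.
- exact: measurable_funeneg.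
Qed.

Lemma cintegral_mrestr (f : T -> R[i]) : cmeasurable f ->
  cintegral (mrestr mu mD) setT f = cintegral mu D f.
Proof.
move=> [f1 f2]; rewrite /cintegral /Rintegral.
by rewrite !integral_mrestr//; exact/measurable_EFinP.
Qed.

Lemma cintegral_indic (f : T -> R[i]) :
  cintegral mu D f = cintegral mu setT (fun x => (\1_D x)%:C * f x).
Proof.
have e (g : T -> R) : \int[mu]_(x in D) g x = \int[mu]_x (\1_D x * g x).
  rewrite Rintegral_mkcond; apply: eq_Rintegral => x _.
  by rewrite patchE indicE; case: ifPn => _; rewrite ?mul1r ?mul0r.
apply: complex_eqP; rewrite ?Re_cintegral ?Im_cintegral.
  by rewrite -[LHS]/(Rintegral _ _ _) e; apply: eq_Rintegral => x _; rewrite Re_rmul.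
by rewrite -[LHS]/(Rintegral _ _ _) e; apply: eq_Rintegral => x _; rewrite Im_rmul.
Qed.

End restriction.

Section finite_integrable.
Context {R : realType} {d : measure_display} {T : measurableType d}.
Variable lam : {finite_measure set T -> \bar R}.

Lemma finite_integrable (f : T -> R) M : measurable_fun setT f ->
  (forall x, `|f x| <= M) -> lam.-integrable setT (EFin \o f).
Proof.
move=> mf fM; apply: (@integrable_le _ _ _ lam _ (fun=> M)) => //.
exact: finite_measure_integrable_cst.
Qed.

Lemma finite_cintegrable (f : T -> R[i]) M : cmeasurable f ->
  (forall x, normc (f x) <= M) -> cintegrable lam setT f.
Proof.
move=> mf fM; apply: (@cintegrable_le _ _ _ lam _ (fun=> M)) => //.
exact: finite_measure_integrable_cst.
Qed.

End finite_integrable.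

(** * The jump part of a Lévy exponent *)

Section jumps.
Context {R : realType} {N : nat}.
Local Notation V := 'rV[R]_N.
Variable rho : {measure set V -> \bar R}.
Hypothesis rhoP : levy_measure rho.

Lemma measurable_enorm d (T : measurableType d) (f : T -> V) :
  measurable_fun setT f -> measurable_fun setT (fun x => enorm (f x)).
Proof.
move=> mf; apply: (measurableT_comp (continuous_measurable_fun (@sqrt_continuous R))).
exact: measurable_dot.
Qed.

Let mV : measurable_fun setT (@id V) := @measurable_id _ _ _.

Lemma measurable_set0C : measurable (~` [set (0 : V)]).
Proof.
apply: measurableC.
rewrite (_ : [set 0] = (fun y : V => dot y y) @^-1` [set 0]).
  by rewrite -[X in measurable X]setTI; apply: measurable_dot.
apply/seteqP; split => y /=; first by move=> ->; rewrite dot0l.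
exact: dot_eq0.
Qed.

Local Notation rho0 := (mrestr rho measurable_set0C).

Definition jump (u y : V) : R[i] :=
  cis (dot u y) - 1 - 'i%C * (dot u y / (1 + enorm y ^+ 2))%:C.

Let cutoff (y : V) : R := Num.min 1 (enorm y ^+ 2).

Let measurable_cutoff : measurable_fun setT cutoff.
Proof.
apply: measurable_minr => //.
by apply: measurable_funX; exact: measurable_enorm.
Qed.

Let cutoff_ge0 y : 0 <= cutoff y.
Proof. by rewrite /cutoff le_min ler01 sqr_ge0. Qed.

Let integrable_cutoff : rho0.-integrable setT (EFin \o cutoff).
Proof.
apply/integrableP; split; first exact/measurable_EFinP.
under eq_integral do rewrite /= ger0_norm//.
rewrite integral_mrestr//; exact/measurable_EFinP.
Qed.

Let den_gt0 (y : V) : 0 < 1 + enorm y ^+ 2.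
Proof. by rewrite ltr_pwDl// sqr_ge0. Qed.

Let dot_le_enorm (u y : V) : `|dot u y| <= enorm u * enorm y.
Proof.
rewrite -(@ler_pXn2r _ 2) ?nnegrE ?mulr_ge0 ?enorm_ge0//.
by rewrite real_normK ?num_real// exprMn !enorm_sqr dot_CS.
Qed.

Let jumpK (u : V) : R := enorm u ^+ 2 * expR (enorm u) + enorm u + 2.

(** For [|y| <= 1] the compensated jump is of second order by Taylor's
    inequality; for [|y| >= 1] it is bounded. *)
Let normc_jump u y : normc (jump u y) <= jumpK u * cutoff y.
Proof.
have u0 := enorm_ge0 u; have y0 := enorm_ge0 y; have uy := dot_le_enorm u y.
have den := den_gt0 y; have E0 := expR_ge0 (enorm u).
rewrite /cutoff; case: (leP 1 (enorm y ^+ 2)) => [y1|/ltW y1].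
  have y1' : 1 <= enorm y by rewrite -(@ler_pXn2r _ 2) ?nnegrE// expr1n.
  rewrite mulr1 /jump; apply: le_trans (normcB _ _) _.
  have h1 : normc (cis (dot u y) - 1) <= 2.
    by apply: le_trans (normcB _ _) _; rewrite normc_cis normc_1.
  apply: (le_trans (lerD h1 (lexx _))).
  rewrite normcM normc_i mul1r normc_real normrM normfV (gtr0_norm den).
  rewrite /jumpK addrC lerD2r; apply: (@le_trans _ _ (enorm u)); last first.
    by rewrite lerDr mulr_ge0// sqr_ge0.
  rewrite ler_pdivrMr//; apply: le_trans uy _; rewrite ler_wpM2l//.
  by rewrite expr2; nra.
have y1' : enorm y <= 1 by rewrite -(@ler_pXn2r _ 2) ?nnegrE// expr1n.
have -> : jump u y = (cis (dot u y) - cexp_trunc 2 ('i%C * (dot u y)%:C)) +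
    'i%C * (dot u y * (enorm y ^+ 2 / (1 + enorm y ^+ 2)))%:C.
  have e : (dot u y)%:C = (dot u y / (1 + enorm y ^+ 2))%:C +
      (dot u y * (enorm y ^+ 2 / (1 + enorm y ^+ 2)))%:C.
    by rewrite -rmorphD/=; congr (_%:C); field; rewrite gt_eqF.
  have tE z : cexp_trunc 2 z = 1 + z :> R[i].
    rewrite /cexp_trunc !big_ord_recl big_ord0 expr0 expr1 fact0 factS fact0.
    by rewrite invr1 !mulr1 addr0.
  by rewrite /jump tE e; move: (cis _) (_%:C) (_%:C) => a b c; ring.
apply: le_trans (normcD _ _) _.
have ni : normc ('i%C * (dot u y)%:C) = `|dot u y| by rewrite normcM normc_i mul1r normc_real.
have T := cexp_taylor 2 ('i%C * (dot u y)%:C).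
rewrite -/(cis _) ni in T.
have uyu : `|dot u y| <= enorm u by apply: le_trans uy _; rewrite ler_piMr.
have h1 : normc (cis (dot u y) - cexp_trunc 2 ('i%C * (dot u y)%:C)) <=
    enorm u ^+ 2 * enorm y ^+ 2 * expR (enorm u).
  apply: le_trans T _; apply: ler_pM; rewrite ?expR_ge0 ?ler_expR//.
  rewrite (_ : 2`! = 2)%N //; apply: (@le_trans _ _ (`|dot u y| ^+ 2)).
    by rewrite ler_pdivrMr// ler_peMr ?sqr_ge0// ler1n.
  by rewrite -exprMn ler_pXn2r ?nnegrE ?mulr_ge0.
have h2 : normc ('i%C * (dot u y * (enorm y ^+ 2 / (1 + enorm y ^+ 2)))%:C) <=
    enorm u * enorm y ^+ 2.
  rewrite normcM normc_i mul1r normc_real normrM.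
  have q0 : 0 <= enorm y ^+ 2 / (1 + enorm y ^+ 2).
    by rewrite divr_ge0 ?sqr_ge0// ltW.
  rewrite (ger0_norm q0); apply: ler_pM => //.
  by rewrite ler_pdivrMr// ler_peMr ?sqr_ge0// lerDl sqr_ge0.
apply: le_trans (lerD h1 h2) _; rewrite /jumpK.
have y2 := sqr_ge0 (enorm y).
have -> : enorm u ^+ 2 * enorm y ^+ 2 * expR (enorm u) + enorm u * enorm y ^+ 2 =
    (enorm u ^+ 2 * expR (enorm u) + enorm u) * enorm y ^+ 2 by ring.
by rewrite ler_wpM2r// lerDl.
Qed.

Lemma cmeasurable_jump u : cmeasurable (jump u).
Proof.
have mu : measurable_fun setT (fun y : V => dot u y) by apply: measurable_dot.
apply: cmeasurableD.
  apply: cmeasurableD; first exact: cis_cmeasurable.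
  exact: cmeasurable_cst.
apply: cmeasurableN; apply: cmeasurableM; first exact: cmeasurable_cst.
apply: cmeasurable_real; apply: measurable_funM => //.
apply: (measurable_comp (F := [set x : R | x != 0])) => //.
- by apply: open_measurable; exact: open_neq.
- by move=> _ [y _ <-]; rewrite /= gt_eqF.
- apply: open_continuous_measurable_fun; first exact: open_neq.
  by move=> x; rewrite inE => x0; exact: inv_continuous.
- apply: measurable_funD => //; apply: measurable_funX; exact: measurable_enorm.
Qed.

Lemma Re_jump_le0 u y : Re (jump u y) <= 0.
Proof.
by rewrite /jump !Re_add !Re_opp Re_cis Re_imul /= !oppr0 addr0 subr_le0 cos_le1.
Qed.

(** Away from the origin a Lévy measure is finite. *)
Let far n : set V := [set y | n.+1%:R^-1 < enorm y].

Let measurable_far n : measurable (far n).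
Proof.
rewrite -[far n]setTI (_ : far n = (fun y : V => enorm y) @^-1` `]n.+1%:R^-1, +oo[).
  by apply: measurable_enorm => //; exact: measurable_itv.
by apply/seteqP; split => y /=; rewrite in_itv/= andbT.
Qed.

Let far_lty n : (rho0 (far n) < +oo)%E.
Proof.
pose c : R := Num.min 1 (n.+1%:R^-1 ^+ 2).
have c0 : 0 < c by rewrite lt_min ltr01 exprn_gt0// invr_gt0.
have [_ foo] := integrableP _ _ _ integrable_cutoff.
have : (c%:E * rho0 (far n) < +oo)%E.
  apply: le_lt_trans foo; rewrite -integral_cst//.
  apply: (@le_trans _ _ (\int[rho0]_(x in far n) `|(EFin \o cutoff) x|)%E).
    apply: ge0_le_integral => //.
    - by move=> y _; rewrite lee_fin ltW.
    - apply: measurableT_comp => //; apply: measurable_funTS; exact/measurable_EFinP.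
    - move=> y /= fy; rewrite lee_fin (le_trans _ (ler_norm _))//.
      rewrite /cutoff /c le_min !ge_min lexx /= ler_pXn2r ?nnegrE ?enorm_ge0//.
      by rewrite (ltW fy) orbT.
  apply: ge0_subset_integral => //.
  by apply: measurableT_comp => //; exact/measurable_EFinP.
have := measure_ge0 rho0 (far n); move: (rho0 (far n)) => [r| |] // _.
  by move=> _; exact: ltry.
by rewrite gt0_muley ?lte_fin// ltxx.
Qed.

Let lam n : {finite_measure set V -> \bar R} := mfrestr (measurable_far n) (far_lty n).

Definition jump_exponent (u : V) : R[i] := cintegral rho (~` [set 0]) (jump u).

Let Jn n u := cintegral (lam n) setT (jump u).

Let JnE n u : Jn n u = cintegral rho0 setT (fun y => (\1_(far n) y)%:C * jump u y).
Proof.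
rewrite -cintegral_indic -(cintegral_mrestr rho0 (measurable_far n))//.
exact: cmeasurable_jump.
Qed.

(** Every jump other than zero is eventually far. *)
Let Jn_cvg u : ccvg (Jn ^~ u) (jump_exponent u).
Proof.
rewrite /jump_exponent -(cintegral_mrestr rho measurable_set0C); last exact: cmeasurable_jump.
rewrite (_ : Jn ^~ u = (fun n => cintegral rho0 setT (fun y => (\1_(far n) y)%:C * jump u y))); last first.
  by apply/funext => n; exact: JnE.
apply: (@cdominated _ _ _ rho0 _ _ (fun y => jumpK u * cutoff y)).
- move=> n; apply: cmeasurableM; last exact: cmeasurable_jump.
  by apply: cmeasurable_real; exact: measurable_indic.
- move=> y; have [->|y0] := eqVneq y 0.
    rewrite /jump (dotC u) dot0l cis0 mul0r subrr sub0r mulr0 oppr0.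
    by under eq_fun do rewrite mulr0; exact: ccvg_cst.
  have e0 : 0 < enorm y.
    rewrite lt_neqAle enorm_ge0 andbT eq_sym; apply: contra y0 => /eqP e.
    by apply/eqP/dot_eq0; rewrite -enorm_sqr e expr0n.
  have e1 : \forall n \near \oo, (\1_(far n) y)%:C * jump u y = jump u y.
    near=> n; rewrite indicE mem_set ?mul1r// /far /=.
    by near: n; exact: near_infty_natSinv_lt (PosNum e0).
  split; apply: cvg_near_cst; near=> n; congr (complex.Re _) || congr (complex.Im _);
    by near: n.
- exact: integrable_scale.
- move=> n y; rewrite normcM normc_real indicE; case: (_ \in _) => /=.
    by rewrite normr1 mul1r normc_jump.
  by rewrite normr0 mul0r (le_trans (normc_ge0 _) (normc_jump u y)).
Unshelve. all: by end_near. Qed.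

Let Re_Jn n u : Re (Jn n u) <= 0.
Proof.
rewrite -oppr_ge0 -mulN1r Re_cintegral.
have mj := cmeasurable_jump u.
have ij : cintegrable (lam n) setT (jump u).
  apply: (@finite_cintegrable _ _ _ (lam n) _ (jumpK u)) => // y.
  apply: le_trans (normc_jump u y) _; rewrite ler_piMr ?ge_min ?lexx//.
  by rewrite !addr_ge0 ?mulr_ge0 ?sqr_ge0 ?expR_ge0 ?enorm_ge0.
case: ij => ij _; rewrite -RintegralZl//; apply: Rintegral_ge0 => y _.
by rewrite mulN1r oppr_ge0 Re_jump_le0.
Qed.

(** The compensator is integrable for the finite measure [lam n] and
    contributes a drift. *)
Let drift n : V := \row_i \int[lam n]_y (y 0 i / (1 + enorm y ^+ 2)).

Let coord_bound (y : V) i : `|y 0 i / (1 + enorm y ^+ 2)| <= 1.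
Proof.
rewrite normrM normfV (gtr0_norm (den_gt0 y)) ler_pdivrMr// mul1r.
apply: le_trans (coord_le_enorm y i) _.
by have := enorm_ge0 y; have := sqr_ge0 (enorm y - 1); nra.
Qed.

Let measurable_coord_den i :
  measurable_fun setT (fun y : V => y 0 i / (1 + enorm y ^+ 2)).
Proof.
have [_ m] := cmeasurable_jump (delta_mx 0 i).
have e (y : V) : y 0 i / (1 + enorm y ^+ 2) = sin (y 0 i) - Im (jump (delta_mx 0 i) y).
  have dE : dot (delta_mx 0 i) y = y 0 i.
    rewrite /dot (bigD1 i)//= mxE !eqxx mul1r big1 ?addr0// => j ji.
    by rewrite mxE eqxx /= (negbTE ji) mul0r.
  by rewrite /jump dE !Im_add !Im_opp Im_cis Im_imul /= oppr0 addr0 subKr.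
under eq_fun do rewrite e.
apply: measurable_funB => //.
exact: (measurableT_comp (continuous_measurable_fun (@continuous_sin R)) (measurable_coord i)).
Qed.

(** The exponent of a compound Poisson law with drift: the transform of a
    finite measure, minus its mass, plus a drift. *)
Let JnD n u : Jn n u =
  cintegral (lam n) setT (fun y => cis (dot u y)) +
  (- (fine (lam n setT)))%:C + 'i%C * (dot u (- drift n))%:C.
Proof.
have mu : measurable_fun setT (fun y : V => dot u y) by apply: measurable_dot.
have icis : cintegrable (lam n) setT (fun y => cis (dot u y)).
  apply: (@finite_cintegrable _ _ _ (lam n) _ 1); first exact: cis_cmeasurable.
  by move=> y; rewrite normc_cis.
have icoord i : (lam n).-integrable setT (EFin \o (fun y : V => y 0 i / (1 + enorm y ^+ 2))).
  by apply: (@finite_integrable _ _ _ (lam n) _ 1).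
have iterm i : cintegrable (lam n) setT
    (fun y : V => ('i%C * (- u 0 i)%:C) * (y 0 i / (1 + enorm y ^+ 2))%:C).
  apply: cintegrableZ; apply: (@finite_cintegrable _ _ _ (lam n) _ 1).
    exact: cmeasurable_real.
  by move=> y; rewrite normc_real.
have [isum sumE] := cintegral_sum (index_enum 'I_N) iterm.
have icst : cintegrable (lam n) setT (fun=> (-1)%:C).
  apply: (@finite_cintegrable _ _ _ (lam n) _ 1); first exact: cmeasurable_cst.
  by move=> y; rewrite normc_real normrN normr1.
have jE y : jump u y = (cis (dot u y) + (-1)%:C) +
    \sum_i ('i%C * (- u 0 i)%:C) * (y 0 i / (1 + enorm y ^+ 2))%:C.
  rewrite /jump; congr (_ + _ + _); first by rewrite rmorphN rmorph1.
  under eq_bigr do rewrite -mulrA -rmorphM/=.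
  rewrite -mulr_sumr -rmorph_sum -mulrN -rmorphN /=; congr (_ * _%:C).
  rewrite /dot mulr_suml -sumrN; apply: eq_bigr => i _.
  by rewrite mulNr mulrA.
rewrite /Jn (eq_cintegral _ jE) cintegralD//; last exact: cintegrableD.
rewrite cintegralD// sumE cintegral_real Rintegral_cst// mulN1r; congr (_ + _ + _).
rewrite (eq_bigr (fun i => 'i%C * (u 0 i * (- drift n) 0 i)%:C)) => [|i _].
  by rewrite -mulr_sumr -rmorph_sum.
rewrite cintegralZ; last first.
  apply: (@finite_cintegrable _ _ _ (lam n) _ 1); first exact: cmeasurable_real.
  by move=> y; rewrite normc_real.
by rewrite cintegral_real !mxE -mulrA -rmorphM /= mulNr mulrN.
Qed.

(** Each factor of the compound Poisson exponential of [JnD] preserves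
    positive type, and so does the limit of small truncation. *)
Lemma positive_type_jump eta (t : R) m : 0 < eta -> 0 <= t -> positive_type eta m ->
  positive_type eta (fun u => m u * cexp (t%:C * jump_exponent u)).
Proof.
move=> eta0 t0 mp; have [mm [M mM] _] := mp.
apply: (@positive_type_lim _ _ _ eta0 (fun n u => m u * cexp (t%:C * Jn n u)) _ M).
- move=> n.
  pose l u := cintegral (lam n) setT (fun y : V => (t%:C * cis (dot u y))).
  have h := @positive_type_exp _ _ _ eta0 l (\int[lam n]_y t) m.
  have mcis (u : V) : cmeasurable (fun y : V => cis (dot u y)).
    by apply: cis_cmeasurable; apply: measurable_dot.
  have it : (lam n).-integrable setT (EFin \o (fun=> t)).
    by apply: (@finite_integrable _ _ _ (lam n) _ t) => // y; rewrite ger0_norm.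
  have nl u : normc (l u) <= \int[lam n]_y t.
    apply: normc_cintegral_le => //.
      by apply: cmeasurableM => //; exact: cmeasurable_cst.
    by move=> y; rewrite normcM normc_cis mulr1 normc_real ger0_norm.
  have {}h := h nl (fun m' pm' => positive_type_mul eta0 (fun _ => t0) it mV pm') mp.
  have {}h := positive_type_shift (t *: - drift n) h.
  have {}h := positive_typeZ eta0 (expR_ge0 (t * - fine (lam n setT))) h.
  move: h; congr positive_type; apply/funext => u.
  have e1 : t%:C * cintegral (lam n) setT (fun y => cis (dot u y)) = l u.
    rewrite /l cintegralZ//; apply: (@finite_cintegrable _ _ _ (lam n) _ 1) => // y.
    by rewrite normc_cis.
  have e2 : t%:C * (- fine (lam n setT))%:C = (t * - fine (lam n setT))%:C.
    by rewrite -rmorphM.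
  have e3 : t%:C * ('i%C * (dot u (- drift n))%:C) = 'i%C * (dot u (t *: - drift n))%:C.
    by rewrite dotZr rmorphM mulrCA.
  rewrite JnD 2!mulrDr e1 e2 e3 2!cexpD cexp_real -/(cis _).
  by move: (cexp (l u)) (cis _) (_%:C) => a b c; ring.
- move=> n u; rewrite normcM normc_cexp Re_rmul -[leRHS]mulr1.
  apply: ler_pM => //; rewrite ?normc_ge0 ?expR_ge0//.
  by rewrite -expR0 ler_expR mulr_ge0_le0.
- move=> u; apply: ccvgM; first exact: ccvg_cst.
  apply: ccvg_cexp; apply: ccvgM; first exact: ccvg_cst.
  exact: Jn_cvg.
Qed.

End jumps.

(** * Fourier inversion for measures with a Gaussian-dominated transform *)

Section density.
Context {R : realType} {d : measure_display} {T : measurableType d}.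
Variable mu : {measure set T -> \bar R}.
Variable p : T -> R.
Hypotheses (p0 : forall x, 0 <= p x) (mp : measurable_fun setT p).

Let density (A : set T) : \bar R := (\int[mu]_(x in A) (p x)%:E)%E.

Let density0 : density set0 = 0%E.
Proof. by rewrite /density integral_set0. Qed.

Let density_ge0 A : (0 <= density A)%E.
Proof. by apply: integral_ge0 => x _; rewrite lee_fin. Qed.

Let density_sigma_additive : semi_sigma_additive density.
Proof.
move=> /= A mA tA mUA; rewrite /density ge0_integral_bigcup//.
- by apply: is_cvg_ereal_nneg_natsum_cond => n _ _; exact: density_ge0.
- by apply: measurable_funTS; exact/measurable_EFinP.
- by move=> x _; rewrite lee_fin.
Qed.

HB.instance Definition _ := isMeasure.Build _ _ _
  density density0 density_ge0 density_sigma_additive.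

Definition density_measure : {measure set T -> \bar R} := density.

Lemma density_measureE A : density_measure A = (\int[mu]_(x in A) (p x)%:E)%E.
Proof. by []. Qed.

End density.

Section boxes.
Context {R : realType} {N : nat}.
Local Notation V := 'rV[R]_N.

(** Open boxes form an intersection-stable family that generates the Borel
    sets, so they determine a finite measure. *)
Definition box (a b : V) : set V :=
  [set y | forall i, a 0 i < y 0 i /\ y 0 i < b 0 i].

Definition boxes : set (set V) := [set A | exists a b, A = box a b].

Lemma measurable_box a b : measurable (box a b).
Proof.
rewrite (_ : box a b = \bigcap_(i in [set: 'I_N])
    ((fun y : V => y 0 i) @^-1` `]a 0 i, b 0 i[)).
  apply: fin_bigcap_measurable => // i _; rewrite -[X in measurable X]setTI.
  by apply: measurable_coord => //; exact: measurable_itv.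
apply/seteqP; split => y /= h i.
  by move=> _; rewrite /= in_itv/=; apply/andP.
by have := h i I; rewrite /= in_itv/= => /andP.
Qed.

Lemma setI_closed_boxes : setI_closed boxes.
Proof.
move=> _ _ [a [b ->]] [a' [b' ->]].
exists (\row_i Num.max (a 0 i) (a' 0 i)), (\row_i Num.min (b 0 i) (b' 0 i)).
apply/seteqP; split => y /=.
  move=> [h h'] i; rewrite !mxE gt_max lt_min.
  by have [-> ->] := h i; have [-> ->] := h' i.
move=> h; split => i; have := h i; rewrite !mxE gt_max lt_min.
  by move=> [/andP[-> _] /andP[-> _]].
by move=> [/andP[_ ->] /andP[_ ->]].
Qed.

Definition cube k : set V := box (const_mx (- k%:R)) (const_mx k%:R).

Lemma near_natSinv_lt (x : R) : 0 < x -> \forall k \near \oo, k.+1%:R^-1 < x.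
Proof. by move=> x0; exact: near_infty_natSinv_lt (PosNum x0). Qed.

Lemma near_cube (y : V) : \forall k \near \oo, cube k y.
Proof.
rewrite /cube /box /=; apply: filter_forall => i; near=> k; rewrite !mxE.
suff /andP[] : - k%:R < y 0 i < k%:R by [].
by rewrite -ltr_norml; near: k; exact: nbhs_infty_gtr.
Unshelve. all: by end_near. Qed.

Lemma bigcup_cube : \bigcup_k cube k = setT.
Proof.
apply/seteqP; split => // y _.
by have [k _ /(_ k (leqnn k)) ky] := near_cube y; exists k.
Qed.

Let coor_ray (i : 'I_N) (x : R) : <<s boxes >> [set y : V | x < y 0 i].
Proof.
rewrite (_ : [set _ | _] = \bigcup_k box
    (\row_j if j == i then x else - k%:R) (const_mx k%:R)).
  apply: sigma_algebra_bigcup => k; apply: sub_sigma_algebra.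
  by eexists; eexists.
apply/seteqP; split => y /=.
  move=> xy; have [k _ /(_ k (leqnn k)) ky] := near_cube y.
  exists k => // j; have := ky j; rewrite !mxE => -[h1 h2]; split => //.
  by case: eqP => // ->.
by move=> [k _ /(_ i)]; rewrite !mxE eqxx => -[].
Qed.

Lemma measurable_boxesE : @measurable _ V = <<s boxes >>.
Proof.
apply/seteqP; split; last first.
  apply: smallest_sub; first exact: sigma_algebra_measurable.
  by move=> _ [a [b ->]]; exact: measurable_box.
apply: smallest_sub; first exact: smallest_sigma_algebra.
rewrite -bigcup_seq; apply: bigcup_sub => i _ A [B mB <-].
rewrite setTI.
have : measurable_fun setT
    ((fun y : V => y 0 i) : g_sigma_algebraType boxes -> R).
  apply: measurability; first exact: RGenOInfty.measurableE.
  move=> _ [_ [x ->] <-].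
  rewrite setTI (_ : _ @^-1` _ = [set y : V | x < y 0 i]); first exact: coor_ray.
  by apply/seteqP; split => y /=; rewrite in_itv/= andbT.
by move=> /(_ measurableT _ mB); rewrite setTI.
Qed.

(** A crude way to see that boxes have finite Lebesgue measure. *)
Lemma box_le_gauss a b : exists K, forall x, \1_(box a b) x <= K * gauss 1 x :> R.
Proof.
pose D := \sum_i (`|a 0 i| + `|b 0 i|) ^+ 2.
exists (expR D) => x; rewrite indicE; have [|_] := boolP (x \in _); last first.
  by rewrite mulr_ge0 ?expR_ge0.
rewrite inE => xab; rewrite /gauss -expRD mulN1r -expR0 ler_expR subr_ge0.
apply: ler_sum => i _; rewrite -expr2 -real_normK ?num_real//.
rewrite ler_pXn2r ?nnegrE ?addr_ge0//.
have [h1 h2] := xab i; have := ler_norm (- a 0 i); have := ler_norm (b 0 i).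
have := normr_ge0 (a 0 i); have := normr_ge0 (b 0 i); rewrite normrN ler_norml.
by move=> *; apply/andP; split; lra.
Qed.

End boxes.

Section inversion.
Context {R : realType} {N : nat}.
Local Notation V := 'rV[R]_N.
Local Notation leb := (lebesgue_rV N : {sigma_finite_measure set V -> \bar R}).
Variables (nu : probability V R) (nuhat : V -> R[i]) (a : R).
Hypothesis a0 : 0 < a.
Hypothesis nuhatE : forall u, cintegral nu setT (fun y => cis (dot y u)) = nuhat u.
Hypothesis nuhat_le : forall u, normc (nuhat u) <= gauss a u.

(** The power [N] of [2 * pi], shaped after the products of [gaussK]. *)
Definition twopi : R := Num.sqrt (2 * pi) ^+ 2 ^+ N.

Let twopi_gt0 : 0 < twopi.
Proof. by rewrite exprn_gt0// exprn_gt0// sqrtr_gt0 mulr_gt0// pi_gt0. Qed.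

Lemma gaussK_dual (b : R) : 0 < b -> gaussK N b * gaussK N (4 * b)^-1 = twopi.
Proof.
move=> b0; rewrite /gaussK -exprMn /twopi; congr (_ ^+ _).
have pb : 0 <= pi / b :> R by rewrite divr_ge0 ?pi_ge0// ltW.
rewrite -sqrtrM// sqr_sqrtr ?mulr_ge0 ?pi_ge0//.
have -> : pi / b * (pi / (4 * b)^-1) = (2 * pi) ^+ 2 :> R by field; rewrite gt_eqF.
by rewrite sqrtr_sqr ger0_norm// mulr_ge0// pi_ge0.
Qed.

(** The Gaussian probability density that concentrates at the origin as [b]
    tends to infinity. *)
Definition heat (b : R) (z : V) : R := gauss b z / gaussK N b.

Lemma heat_ge0 b z : 0 < b -> 0 <= heat b z.
Proof. by move=> b0; rewrite divr_ge0 ?gauss_ge0// ltW// gaussK_gt0. Qed.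

Lemma heat_le b z : 0 < b -> heat b z <= (gaussK N b)^-1.
Proof.
by move=> b0; rewrite ler_piMl ?invr_ge0 ?(ltW (gaussK_gt0 _ _))// gauss_le1// ltW.
Qed.

Lemma measurable_heat b : measurable_fun setT (heat b).
Proof. by apply: measurable_funM => //; exact: measurable_gauss. Qed.

Lemma integrable_heat b : 0 < b -> leb.-integrable setT (EFin \o heat b).
Proof.
move=> b0; rewrite (_ : heat b = fun z => (gaussK N b)^-1 * gauss b z).
  by apply: integrable_scale; exact: integrable_gauss.
by apply/funext => z; rewrite mulrC.
Qed.

Lemma Rintegral_heat b : 0 < b -> \int[leb]_z heat b z = 1.
Proof.
move=> b0; rewrite /heat; under eq_Rintegral do rewrite mulrC.
rewrite RintegralZl//; last exact: integrable_gauss.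
by rewrite Rintegral_gauss// mulVf// gt_eqF// gaussK_gt0.
Qed.

(** This turns convolution with a heat kernel into an integral of the Fourier
    transform against a Gaussian. *)
Lemma heatE b z : 0 < b -> (heat b z)%:C = (twopi^-1)%:C *
  cintegral leb setT (fun u => cis (dot z u) * (gauss (4 * b)^-1 u)%:C).
Proof.
move=> b0; have b40 : 0 < (4 * b)^-1 by rewrite invr_gt0 mulr_gt0.
rewrite cintegral_gauss// -rmorphM/=; congr (_%:C).
have -> : (4 * (4 * b)^-1)^-1 = b by field; rewrite gt_eqF.
rewrite -(gaussK_dual b0) /heat; field.
by rewrite !gt_eqF// gaussK_gt0.
Qed.

Let cmeasurable_nuhat : cmeasurable nuhat.
Proof.
rewrite (_ : nuhat = fun u => cintegral nu setT (fun y => cis (dot y u))).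
  apply: (@cmeasurable_cintegral _ _ _ _ _ nu (fun u y => cis (dot y u))).
  by apply: cis_cmeasurable; apply: measurable_dot;
    [exact: measurable_snd|exact: measurable_fst].
by apply/funext => u; rewrite nuhatE.
Qed.

Let mcis_dot (x : V) : cmeasurable (fun u : V => cis (- dot u x)).
Proof. exact: cmeasurable_cis_dot. Qed.

Let q x := cintegral leb setT (fun u => cis (- dot u x) * nuhat u).
Let qb b x := cintegral leb setT
  (fun u => cis (- dot u x) * nuhat u * (gauss (4 * b)^-1 u)%:C).

Let b4 (b : R) : 0 < b -> 0 <= (4 * b)^-1.
Proof. by move=> b0; rewrite invr_ge0 mulr_ge0// ltW. Qed.

Let normc_int b x u : 0 < b ->
  normc (cis (- dot u x) * nuhat u * (gauss (4 * b)^-1 u)%:C) <= gauss a u.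
Proof.
move=> b0; rewrite normcM normcM normc_cis mul1r normc_real ger0_norm ?gauss_ge0//.
by apply: le_trans (nuhat_le u); rewrite ler_piMr ?normc_ge0// gauss_le1// b4.
Qed.

(** The density of the convolution of [nu] with a heat kernel. It is visibly
    nonnegative, while [pbE] expresses it through [nuhat]; both properties pass
    to the limit. *)
Let pb b x : R := \int[nu]_y heat b (x - y).

Let pbE b x : 0 < b -> (pb b x)%:C = (twopi^-1)%:C * qb b x.
Proof.
move=> b0; have b40 : 0 < (4 * b)^-1 by rewrite invr_gt0 mulr_gt0.
rewrite /pb -cintegral_real.
pose F y u := cis (dot (y - x) u) * (gauss (4 * b)^-1 u)%:C : R[i].
have mF : cmeasurable (fun p : V * V => F p.1 p.2).
  apply: cmeasurableM.
    apply: cis_cmeasurable; apply: measurable_dot; last exact: measurable_snd.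
    by apply: measurable_rVB; [exact: measurable_fst|exact: measurable_cst].
  apply: cmeasurable_real.
  exact: (measurableT_comp (measurable_gauss _) measurable_snd).
have nF y u : normc (F y u) <= gauss (4 * b)^-1 u.
  by rewrite /F normcM normc_cis mul1r normc_real ger0_norm// gauss_ge0.
rewrite (@eq_cintegral _ _ _ _ _ (fun y => (twopi^-1)%:C * cintegral leb setT (F y))); last first.
  by move=> y; rewrite -heatE// /heat -gaussN opprB.
rewrite cintegralZ; last first.
  apply: (@finite_cintegrable _ _ _ nu _ (gaussK N (4 * b)^-1)).
    exact: (@cmeasurable_cintegral _ _ _ _ _ leb F).
  move=> y; rewrite -Rintegral_gauss//; apply: normc_cintegral_le => //.
    apply: (cmeasurable_comp mF (h := fun u => (y, u))).
    exact: measurable_pair1.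
  exact: integrable_gauss.
rewrite cfubini; last first.
  apply: (@cintegrable_le _ _ _ (nu \x leb)%E _ (fun p => 1 * gauss (4 * b)^-1 p.2)) => //.
    apply: (@integrable_prod _ _ _ _ _ nu leb (fun=> 1) (gauss (4 * b)^-1)) => //.
      exact: finite_measure_integrable_cst.
    exact: integrable_gauss.
  by move=> [y u]; rewrite mul1r nF.
congr (_ * _); apply: eq_cintegral => u.
rewrite -nuhatE mulrAC -cintegralZ; last first.
  apply: (@finite_cintegrable _ _ _ nu _ 1).
    apply: cis_cmeasurable; apply: measurable_dot; first exact: measurable_id.
    exact: measurable_cst.
  by move=> y; rewrite normc_cis.
apply: eq_cintegral => y; rewrite /F dotDl dotNl (dotC x) cisD.
by move: (cis _) (cis _) (_%:C) => e f k; ring.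
Qed.

Definition inv_density x : R := twopi^-1 * Re (q x).

Let qb_cvg x : ccvg (fun n => qb n.+1%:R x) (q x).
Proof.
apply: (@cdominated _ _ _ leb _ _ (gauss a)).
- move=> n; apply: cmeasurableM; last by apply: cmeasurable_real; exact: measurable_gauss.
  by apply: cmeasurableM.
- move=> u; rewrite -[X in ccvg _ X]mulr1; apply: ccvgM; first exact: ccvg_cst.
  split; last exact: cvg_cst.
  suff : gauss (4 * n.+1%:R)^-1 u @[n --> \oo] --> expR (- 0 * dot u u).
    by rewrite oppr0 mul0r expR0.
  apply: (continuous_cvg _ (@continuous_expR R _)).
  apply: cvgMl; apply: cvgN.
  under eq_fun do rewrite invfM.
  by rewrite -(mulr0 4^-1); apply: cvgMr; exact: cvg_harmonic.
- exact: integrable_gauss.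
- by move=> n u; exact: normc_int.
Qed.

Let pb_Re b x : 0 < b -> pb b x = twopi^-1 * Re (qb b x).
Proof.
by move=> b0; have := congr1 (@complex.Re R) (pbE x b0); rewrite Re_rmul.
Qed.

Let pb_ge0 b x : 0 < b -> 0 <= pb b x.
Proof. by move=> b0; apply: Rintegral_ge0 => y _; exact: heat_ge0. Qed.

Let pb_cvg x : pb n.+1%:R x @[n --> \oo] --> inv_density x.
Proof.
under eq_fun do rewrite pb_Re//.
by apply: cvgMr; have [] := qb_cvg x.
Qed.

Lemma inv_densityE x : (inv_density x)%:C = (twopi^-1)%:C * q x.
Proof.
apply: complex_eqP; first by rewrite Re_rmul.
have [_ h] := qb_cvg x.
have e : Im (qb n.+1%:R x) @[n --> \oo] --> (0 : R).
  apply: cvg_near_cst; near=> n.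
  have := congr1 (@complex.Im R) (pbE x (ltr0Sn R n)); rewrite Im_rmul /= => /esym/eqP.
  by rewrite mulf_eq0 invr_eq0 (gt_eqF twopi_gt0) /= => /eqP.
have q0 : Im (q x) = 0.
  by rewrite -(cvg_lim (@Rhausdorff R) h) (cvg_lim (@Rhausdorff R) e).
by rewrite Im_rmul q0 mulr0.
Unshelve. all: by end_near. Qed.

Lemma inv_density_ge0 x : 0 <= inv_density x.
Proof. by apply: (cvgr_to_ge (@pb_cvg x)); apply: nearW => n; exact: pb_ge0. Qed.

Lemma measurable_inv_density : measurable_fun setT inv_density.
Proof.
apply: measurable_funM => //.
have [m _] : cmeasurable q.
  apply: (@cmeasurable_cintegral _ _ _ _ _ leb (fun x u => cis (- dot u x) * nuhat u)).
  apply: cmeasurableM.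
    apply: cis_cmeasurable; apply: measurableT_comp => //.
    by apply: measurable_dot; [exact: measurable_snd|exact: measurable_fst].
  exact: (cmeasurable_comp cmeasurable_nuhat measurable_snd).
exact: m.
Qed.

Let M : R := twopi^-1 * gaussK N a.

Let pb_le b x : 0 < b -> pb b x <= M.
Proof.
move=> b0; rewrite pb_Re// ler_wpM2l ?invr_ge0 ?(ltW twopi_gt0)//.
apply: le_trans (ler_norm _) _; apply: le_trans (Re_le_normc _) _.
rewrite -Rintegral_gauss//; apply: normc_cintegral_le.
- apply: cmeasurableM; last by apply: cmeasurable_real; exact: measurable_gauss.
  by apply: cmeasurableM.
- exact: integrable_gauss.
- by move=> u; exact: normc_int.
Qed.

Let measurable_pb b : measurable_fun setT (pb b).
Proof.
apply: (@measurable_Rintegral _ _ _ _ _ nu (fun x y : V => heat b (x - y))).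
apply: (measurableT_comp (measurable_heat b)).
by apply: measurable_rVB; [exact: measurable_fst|exact: measurable_snd].
Qed.

Section one_box.
Variables (lo hi : V).
Local Notation O := (box lo hi).

Let mO : measurable_fun setT (\1_O : V -> R).
Proof. by apply: measurable_indic; exact: measurable_box. Qed.

Lemma integrable_indic_box : leb.-integrable setT (EFin \o (\1_O : V -> R)).
Proof.
have [K OK] := @box_le_gauss R N lo hi.
apply: (@integrable_le _ _ _ leb _ (fun x => K * gauss 1 x)) => //.
  by apply: integrable_scale; exact: integrable_gauss.
by move=> x; rewrite ger0_norm ?indicE ?ler0n//; have := OK x; rewrite indicE.
Qed.

Let S b y : R := \int[leb]_x (\1_O x * heat b (x - y)).

Let mheat b y : measurable_fun setT (fun x : V => heat b (x - y)).
Proof.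
apply: (measurableT_comp (measurable_heat b)).
by apply: measurable_rVB; [exact: measurable_id|exact: measurable_cst].
Qed.

Let heatB b x y : heat b (x - y) = heat b (y - x).
Proof. by rewrite /heat -gaussN opprB. Qed.

Let iheat b y : 0 < b -> leb.-integrable setT (EFin \o (fun x => heat b (x - y))).
Proof.
move=> b0; rewrite (_ : (fun x => _) = (fun x => heat b (y - x))).
  exact: (integrable_reflect y (integrable_heat b0)).
by apply/funext => x; rewrite heatB.
Qed.

Let Rheat b y : 0 < b -> \int[leb]_x heat b (x - y) = 1.
Proof.
move=> b0; under eq_Rintegral do rewrite heatB.
by rewrite Rintegral_reflect ?Rintegral_heat//; exact: measurable_heat.
Qed.

Let i1heat b y : 0 < b ->
  leb.-integrable setT (EFin \o (fun x => \1_O x * heat b (x - y))).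
Proof.
move=> b0; apply: (@integrable_le _ _ _ leb _ (fun x => heat b (x - y))).
- exact: measurable_funM.
- exact: iheat.
- move=> x; rewrite normrM (ger0_norm (heat_ge0 _ b0)) ler_piMl ?heat_ge0//.
  by rewrite ger0_norm indicE ?ler0n// lern1 leq_b1.
Qed.

Let S_ge0 b y : 0 < b -> 0 <= S b y.
Proof.
by move=> b0; apply: Rintegral_ge0 => x _; rewrite mulr_ge0 ?heat_ge0// indicE ler0n.
Qed.

Let S_le1 b y : 0 < b -> S b y <= 1.
Proof.
move=> b0; rewrite -(Rheat y b0); apply: le_Rintegral => //.
- exact: i1heat.
- exact: iheat.
- by move=> x _; rewrite ler_piMl ?heat_ge0// indicE lern1 leq_b1.
Qed.

Let measurable_S b : measurable_fun setT (S b).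
Proof.
apply: (@measurable_Rintegral _ _ _ _ _ leb (fun y x : V => \1_O x * heat b (x - y))).
apply: measurable_funM; first exact: (measurableT_comp mO measurable_snd).
apply: (measurableT_comp (measurable_heat b)).
by apply: measurable_rVB; [exact: measurable_snd|exact: measurable_fst].
Qed.

Let integral_S b : 0 < b -> \int[nu]_y S b y = \int[leb]_x (\1_O x * pb b x).
Proof.
move=> b0; pose F (p : V * V) := \1_O p.2 * heat b (p.2 - p.1) : R.
have iF : (nu \x leb)%E.-integrable setT (EFin \o F).
  apply: (@integrable_le _ _ _ (nu \x leb)%E _ (fun p => (gaussK N b)^-1 * \1_O p.2)).
  - apply: measurable_funM; first exact: (measurableT_comp mO measurable_snd).
    apply: (measurableT_comp (measurable_heat b)).
    by apply: measurable_rVB; [exact: measurable_snd|exact: measurable_fst].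
  - apply: (@integrable_prod _ _ _ _ _ nu leb (fun=> (gaussK N b)^-1) \1_O) => //.
      exact: finite_measure_integrable_cst.
    exact: integrable_indic_box.
  - move=> p; rewrite /F normrM (ger0_norm (heat_ge0 _ b0)) mulrC.
    by rewrite ger0_norm ?indicE ?ler0n// ler_wpM2r ?ler0n// heat_le.
rewrite -[LHS](Rfubini1 iF) (Rfubini2 iF); apply: eq_Rintegral => x _.
rewrite /F /= RintegralZl//; apply: (@finite_integrable _ _ _ nu _ (gaussK N b)^-1).
  apply: (measurableT_comp (measurable_heat b)).
  by apply: measurable_rVB; [exact: measurable_cst|exact: measurable_id].
by move=> y; rewrite ger0_norm ?heat_ge0// heat_le.
Qed.

(** The mass that the regularised measure gives to the box, in the limit. *)
Let integral_S_cvg : \int[nu]_y S n.+1%:R y @[n --> \oo] -->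
  \int[leb]_x (\1_O x * inv_density x).
Proof.
under eq_fun do rewrite integral_S//.
apply: (@Rdominated _ _ _ leb _ _ (fun x => M * \1_O x)).
- by move=> n; apply: measurable_funM => //; exact: measurable_pb.
- by apply: measurable_funM => //; exact: measurable_inv_density.
- by move=> x; apply: cvgMr; exact: pb_cvg.
- by apply: integrable_scale; exact: integrable_indic_box.
- move=> n x; rewrite normrM (ger0_norm (pb_ge0 _ _))// mulrC.
  by rewrite ger0_norm ?indicE ?ler0n// ler_wpM2r ?ler0n// pb_le.
Qed.

Let tail b (r : R) : R := expR (- (b * r ^+ 2 / 2)) * Num.sqrt 2 ^+ N.

(** If the indicator is constant near [y], its mollification at [y] is close
    to that constant, because the Gaussian mass away from [y] is small. *)
Let S_tail b y v r : 0 < b -> 0 <= r ->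
  (forall x, enorm (x - y) < r -> \1_O x = v :> R) -> `|v| <= 1 -> 0 <= v ->
  `|S b y - v| <= tail b r.
Proof.
move=> b0 r0 Ov v1 v0; have b2 : 0 < b / 2 by rewrite divr_gt0.
have v1' : v <= 1 := le_trans (ler_norm v) v1.
have K0 := gaussK_gt0 N b0.
have -> : v = \int[leb]_x (v * heat b (x - y)).
  by rewrite RintegralZl ?Rheat ?mulr1//; exact: iheat.
rewrite /S -RintegralB//; [|exact: i1heat|by apply: integrable_scale; exact: iheat].
set e := expR (- (b * r ^+ 2 / 2)).
pose k x := e * Num.sqrt 2 ^+ N * heat (b / 2) (x - y).
have KE : gaussK N (b / 2) = Num.sqrt 2 ^+ N * gaussK N b.
  rewrite /gaussK -exprMn -sqrtrM//; congr (Num.sqrt _ ^+ _).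
  by field; rewrite gt_eqF.
have kE x : k x = e * gauss (b / 2) (x - y) / gaussK N b.
  rewrite /k /heat KE invfM -!mulrA; congr (_ * _).
  have s0 : Num.sqrt 2 ^+ N != 0 :> R by rewrite gt_eqF// exprn_gt0// sqrtr_gt0.
  by move: (gauss _ _) (gaussK _ _) (Num.sqrt 2 ^+ N) K0 s0 => g1 g2 g3 g20 g30; field; rewrite g30 gt_eqF.
have ik : leb.-integrable setT (EFin \o k).
  by apply: integrable_scale; exact: iheat.
have -> : tail b r = \int[leb]_x k x.
  by rewrite RintegralZl ?Rheat ?mulr1//; exact: iheat.
have idiff : leb.-integrable setT
    (EFin \o (fun x => \1_O x * heat b (x - y) - v * heat b (x - y))).
  rewrite (_ : (fun x => _) = (fun x => \1_O x * heat b (x - y) + (-1) * (v * heat b (x - y)))).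
    apply: integrable_add; first exact: i1heat.
    by do 2 apply: integrable_scale; exact: iheat.
  by apply/funext => x; rewrite mulN1r.
apply: le_trans (le_normr_Rintegral _ idiff) _ => //.
apply: le_Rintegral => //; first exact: integrable_norm.
move=> x _; have [xr|xr] := ltP (enorm (x - y)) r.
  by rewrite Ov// subrr normr0 kE divr_ge0 ?(ltW K0)// mulr_ge0 ?expR_ge0// gauss_ge0.
rewrite -mulrBl normrM (ger0_norm (heat_ge0 _ b0)).
apply: (@le_trans _ _ (heat b (x - y))).
  rewrite ler_piMl ?heat_ge0// indicE; case: (_ \in _) => /=.
    by rewrite ger0_norm ?subr_ge0// gerBl.
  by rewrite sub0r normrN.
rewrite kE /heat ler_wpM2r ?invr_ge0 ?(ltW K0)//.
rewrite [X in gauss X _](_ : b = b / 2 + b / 2) ?gaussD; last by field.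
rewrite ler_wpM2r ?gauss_ge0// /gauss /e ler_expR -enorm_sqr mulNr lerN2.
rewrite mulrAC ler_wpM2l ?(ltW b2)//.
by rewrite ler_pXn2r ?nnegrE ?enorm_ge0.
Qed.

Let tail_cvg r : 0 < r -> tail n.+1%:R r @[n --> \oo] --> 0.
Proof.
move=> r0; rewrite -(mul0r (Num.sqrt 2 ^+ N)); apply: cvgMl.
have c0 : 0 < r ^+ 2 / 2 by rewrite divr_gt0// exprn_gt0.
apply: (@squeeze_cvgr _ _ _ _ (fun=> 0) (fun n => (r ^+ 2 / 2)^-1 * n.+1%:R^-1)).
- apply: nearW => n; rewrite expR_ge0 /= expRN -invfM.
  rewrite lef_pV2 ?posrE ?expR_gt0 ?mulr_gt0//.
  apply: le_trans (expR_ge1Dx _); rewrite -mulrA [X in _ <= _ + X]mulrC.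
  by rewrite lerDr.
- exact: cvg_cst.
- by rewrite -(mulr0 (r ^+ 2 / 2)^-1); apply: cvgMr; exact: cvg_harmonic.
Qed.

Let S_cvg_in (y : V) : O y -> S n.+1%:R y @[n --> \oo] --> (1 : R).
Proof.
move=> Oy; have [r r0 rO] : exists2 r : R, 0 < r & forall x : V, enorm (x - y) < r -> O x.
  have : \forall k \near \oo, forall i : 'I_N,
      k.+1%:R^-1 < y 0 i - lo 0 i /\ k.+1%:R^-1 < hi 0 i - y 0 i.
    apply: filter_forall => i; have [h1 h2] := Oy i.
    by near=> k; split; near: k; apply: near_natSinv_lt; rewrite subr_gt0.
  move=> [k _ /(_ k (leqnn k)) h]; exists k.+1%:R^-1; first by rewrite invr_gt0.
  move=> x xy i; have [h1 h2] := h i.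
  have := le_lt_trans (coord_le_enorm (x - y) i) xy.
  by rewrite !mxE ltr_norml => /andP[]; move: (_ ^-1) h1 h2 => e h1 h2 h3 h4; split; lra.
apply/subr_cvg0; apply: norm_cvg0.
apply: (@squeeze_cvgr _ _ _ _ (fun=> 0) (fun n => tail n.+1%:R r)).
- apply: nearW => n; rewrite normr_ge0 /=; apply: S_tail => //; rewrite ?normr1// ?ltW//.
  by move=> x /rO xO; rewrite indicE mem_set.
- exact: cvg_cst.
- exact: tail_cvg.
Unshelve. all: by end_near. Qed.

Let nuO : \int[nu]_y \1_O y = fine (nu O).
Proof. by rewrite /Rintegral integral_indic ?setIT//; exact: measurable_box. Qed.

Let iS b : 0 < b -> nu.-integrable setT (EFin \o S b).
Proof.
move=> b0; apply: (@finite_integrable _ _ _ nu _ 1) => // y.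
by rewrite ger0_norm ?S_ge0 ?S_le1.
Qed.

(** On the open box the mollified indicators converge to one, and elsewhere
    they are nonnegative. *)
Lemma box_le_density : fine (nu O) <= \int[leb]_x (\1_O x * inv_density x).
Proof.
have h : \int[nu]_y (\1_O y * S n.+1%:R y) @[n --> \oo] --> \int[nu]_y \1_O y.
  apply: (@Rdominated _ _ _ nu _ _ (fun=> 1)) => //.
  - by move=> n; exact: measurable_funM.
  - move=> y; have [yO|yO] := boolP (y \in O).
      rewrite indicE yO /= -[X in _ --> X](mulr1 1%:R); apply: cvgMr.
      by apply: S_cvg_in; rewrite inE in yO.
    rewrite indicE (negbTE yO) /=; under eq_fun do rewrite mul0r.
    exact: cvg_cst.
  - exact: finite_measure_integrable_cst.
  - move=> n y; rewrite ger0_norm ?mulr_ge0 ?S_ge0 ?indicE ?ler0n//.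
    by rewrite -[leRHS]mulr1 ler_pM ?S_ge0 ?S_le1 ?ler0n// lern1 leq_b1.
rewrite -nuO; apply: (ler_cvg_to h integral_S_cvg); apply: nearW => n.
apply: le_Rintegral => //; [|exact: iS|].
  apply: (@integrable_le _ _ _ nu _ (S n.+1%:R)); [exact: measurable_funM|exact: iS|].
  move=> y; rewrite ger0_norm ?mulr_ge0 ?S_ge0 ?indicE ?ler0n//.
  by rewrite ler_piMl ?S_ge0// lern1 leq_b1.
by move=> y _; rewrite ler_piMl ?S_ge0// indicE lern1 leq_b1.
Qed.

(** Outside a neighbourhood of a smaller box its mollified indicators vanish
    in the limit. *)
Lemma density_le_box (lo' hi' : V) r : 0 < r ->
  (forall x y, O x -> ~ box lo' hi' y -> r <= enorm (x - y)) ->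
  \int[leb]_x (\1_O x * inv_density x) <= fine (nu (box lo' hi')).
Proof.
move=> r0 sep; set O' := box lo' hi'.
have mO' : measurable O' by exact: measurable_box.
have nuO' : \int[nu]_y \1_O' y = fine (nu O').
  by rewrite /Rintegral integral_indic ?setIT.
have h : fine (nu O') + tail n.+1%:R r @[n --> \oo] --> fine (nu O').
  rewrite -[X in _ --> X]addr0; apply: cvgD; first exact: cvg_cst.
  exact: tail_cvg.
apply: (ler_cvg_to integral_S_cvg h); apply: nearW => n.
have t0 : 0 <= tail n.+1%:R r by rewrite mulr_ge0 ?expR_ge0// exprn_ge0// sqrtr_ge0.
have i1 : nu.-integrable setT (EFin \o (\1_O' : V -> R)).
  apply: (@finite_integrable _ _ _ nu _ 1); first exact: measurable_indic.
  by move=> y; rewrite ger0_norm indicE ?ler0n// lern1 leq_b1.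
have -> : fine (nu O') + tail n.+1%:R r = \int[nu]_y (\1_O' y + tail n.+1%:R r).
  rewrite RintegralD//; last exact: finite_measure_integrable_cst.
  rewrite nuO' Rintegral_cst// [X in _ * fine X](_ : _ = 1%E) ?mulr1//.
  exact: probability_setT.
apply: le_Rintegral => //; first exact: iS.
  by apply: integrable_add => //; exact: finite_measure_integrable_cst.
move=> y _; have [yO|yO] := boolP (y \in O').
  by rewrite indicE yO /= (le_trans (S_le1 _ _))// lerDl.
rewrite indicE (negbTE yO) add0r; apply: le_trans (ler_norm _) _.
rewrite -[S _ _]subr0; apply: S_tail; rewrite ?normr0 ?(ltW r0)//.
move=> x xy; rewrite indicE memNset// => Ox.
have := sep x y Ox; rewrite leNgt xy => h'.
have /h' // : ~ box lo' hi' y.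
by move=> yb; move/negP: yO; apply; rewrite inE.
Qed.

End one_box.

(** One inequality is [box_le_density]; for the other, exhaust the box by
    smaller ones and use [density_le_box]. *)
Let nu_box (lo hi : V) :
  nu (box lo hi) = (\int[leb]_(x in box lo hi) (inv_density x)%:E)%E.
Proof.
have p0 := inv_density_ge0; have mp := measurable_inv_density.
have mb l h : measurable_fun setT (\1_(box l h) : V -> R).
  by apply: measurable_indic; exact: measurable_box.
have pM x : inv_density x <= M.
  by apply: (cvgr_to_le (@pb_cvg x)); apply: nearW => n; exact: pb_le.
have pp l h x : 0 <= \1_(box l h) x * inv_density x.
  by apply: mulr_ge0; [rewrite indicE ler0n|exact: p0].
have ip l h : leb.-integrable setT (EFin \o (fun x => \1_(box l h) x * inv_density x)).
  apply: (@integrable_le _ _ _ leb _ (fun x => M * \1_(box l h) x)).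
  - exact: measurable_funM.
  - by apply: integrable_scale; exact: integrable_indic_box.
  - move=> x; rewrite ger0_norm// mulrC indicE.
    by rewrite ler_wpM2r ?ler0n.
suff e : fine (nu (box lo hi)) = \int[leb]_x (\1_(box lo hi) x * inv_density x).
  have fn : nu (box lo hi) \is a fin_num by apply: fin_num_measure; exact: measurable_box.
  rewrite -(fineK fn) e /Rintegral fineK; last exact: integrable_fin_num (ip lo hi).
  rewrite [RHS]integral_mkcond; apply: eq_integral => x _.
  by rewrite patchE indicE; case: ifPn => _; rewrite ?mul1r ?mul0r.
apply/eqP; rewrite eq_le box_le_density /=.
pose lo' k : V := lo + const_mx k.+1%:R^-1; pose hi' k : V := hi - const_mx k.+1%:R^-1.
have h : \int[leb]_x (\1_(box (lo' k) (hi' k)) x * inv_density x) @[k --> \oo] -->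
    \int[leb]_x (\1_(box lo hi) x * inv_density x).
  have sub k x : box (lo' k) (hi' k) x -> box lo hi x.
    have k0 : 0 < k.+1%:R^-1 :> R by rewrite invr_gt0.
    move=> + i => /(_ i); rewrite !mxE; move: (_ ^-1) k0 => e e0 [h1 h2].
    by split; lra.
  apply: (@Rdominated _ _ _ leb _ _ (fun x => \1_(box lo hi) x * inv_density x)) => //.
  - by move=> k; exact: measurable_funM.
  - exact: measurable_funM.
  - move=> x; apply: cvgMl; apply: cvg_near_cst.
    have [|xb] := pselect (box lo hi x) => [xb|]; last first.
      apply: nearW => k; rewrite !indicE memNset ?memNset//.
      by move=> /sub.
    have : \forall k \near \oo, forall i : 'I_N,
        k.+1%:R^-1 < x 0 i - lo 0 i /\ k.+1%:R^-1 < hi 0 i - x 0 i.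
      apply: filter_forall => i; have [h1 h2] := xb i.
      by near=> k; split; near: k; apply: near_natSinv_lt; rewrite subr_gt0.
    apply: filterS => k xk; rewrite !indicE mem_set ?mem_set// => i.
    have := xk i; rewrite !mxE; move: (_ ^-1) => e [h1 h2].
    by split; lra.
  - move=> k x; rewrite ger0_norm// ler_wpM2r ?p0// !indicE ler_nat; case: (boolP (x \in box (lo' k) _)) => //.
    by rewrite !inE => /sub xb; rewrite mem_set.
apply: (cvgr_to_le h); apply: nearW => k.
have k0 : 0 < k.+1%:R^-1 :> R by rewrite invr_gt0.
apply: (density_le_box k0) => x y xk ny; rewrite leNgt; apply/negP => xy.
apply: ny => i; have := xk i; have := le_lt_trans (coord_le_enorm (x - y) i) xy.
rewrite !mxE ltr_norml; move: (_ ^-1) => e /andP[h1 h2] [h3 h4].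
by split; lra.
Unshelve. all: by end_near. Qed.

(** Both sides are finite measures that agree on boxes. *)
Lemma inversion A : measurable A ->
  nu A = (\int[leb]_(x in A) (inv_density x)%:E)%E.
Proof.
move=> mA; rewrite -(density_measureE leb inv_density_ge0 measurable_inv_density A).
apply: (measure_unique (@boxes R N) (@cube R N)) => //.
- exact: measurable_boxesE.
- exact: setI_closed_boxes.
- by move=> k; exists (const_mx (- k%:R)), (const_mx k%:R).
- exact: bigcup_cube.
- by move=> _ [lo [hi ->]]; exact: nu_box.
- move=> k; rewrite (le_lt_trans _ (ltry 1))// probability_le1//.
  exact: measurable_box.
Qed.

End inversion.

(** * Factorisation of the convolution through a heat kernel *)

Section change_of_density.
Context {R : realType} {d : measure_display} {T : measurableType d}.
Variables (mu : {sigma_finite_measure set T -> \bar R}) (nu : probability T R).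
Variable p : T -> R.
Hypothesis mp : measurable_fun setT p.
Hypothesis nup : forall A, measurable A -> nu A = (\int[mu]_(x in A) (p x)%:E)%E.

Lemma density_dominates : nu `<< mu.
Proof.
apply/null_content_dominatesP => A mA muA0; rewrite nup//.
by apply: null_set_integral => //; apply: measurable_funTS; exact/measurable_EFinP.
Qed.

Lemma Rintegral_density (f : T -> R) : nu.-integrable setT (EFin \o f) ->
  \int[nu]_x f x = \int[mu]_x (f x * p x).
Proof.
move=> fi; rewrite /Rintegral; congr fine.
have dom := density_dominates.
rewrite -(Radon_Nikodym_change_of_variables dom measurableT fi).
have RNp : ae_eq mu setT (Radon_Nikodym (charge_of_finite_measure nu) mu) (EFin \o p).
  apply: integral_ae_eq => //.
  - exact: Radon_Nikodym_integrable.
  - exact/measurable_EFinP.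
  - move=> A _ mA; rewrite -Radon_Nikodym_integral//.
    exact: nup.
have mf := measurable_int _ fi.
have mRN : measurable_fun setT (Radon_Nikodym (charge_of_finite_measure nu) mu).
  by apply: measurable_int; exact: Radon_Nikodym_integrable.
apply: ae_eq_integral => //.
- exact: emeasurable_funM.
- apply/measurable_EFinP; apply: measurable_funM => //.
  exact/measurable_EFinP.
- by apply: filterS RNp => x /(_ I) e _; rewrite e.
Qed.

Lemma cintegral_density (f : T -> R[i]) M : cmeasurable f ->
  (forall x, normc (f x) <= M) ->
  cintegral nu setT f = cintegral mu setT (fun x => f x * (p x)%:C).
Proof.
move=> mf fM; have [i1 i2] := @finite_cintegrable _ _ _ nu f M mf fM.
apply: complex_eqP; rewrite ?Re_cintegral ?Im_cintegral.
  rewrite (Rintegral_density i1); apply: eq_Rintegral => x _.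
  by rewrite [f x * _]mulrC Re_rmul mulrC.
rewrite (Rintegral_density i2); apply: eq_Rintegral => x _.
by rewrite [f x * _]mulrC Im_rmul mulrC.
Qed.

End change_of_density.

Section factorisation.
Context {R : realType} {N : nat}.
Local Notation V := 'rV[R]_N.
Local Notation leb := (lebesgue_rV N : {sigma_finite_measure set V -> \bar R}).
Variables (nu : probability V R) (k : V -> R[i]) (s eta : R).
Hypotheses (s0 : 0 < s) (eta0 : 0 < eta).
Hypothesis kP : positive_type eta k.
Hypothesis k1 : forall u, normc (k u) <= 1.
Hypothesis nuE : forall u, cintegral nu setT (fun y => cis (dot y u)) =
  k u * (gauss (s + eta) u)%:C.

Let b : R := (4 * s)^-1.

Let b0 : 0 < b. Proof. by rewrite invr_gt0 mulr_gt0. Qed.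

Let bE : (4 * b)^-1 = s.
Proof. by rewrite /b; field; rewrite gt_eqF. Qed.

Let se0 : 0 < s + eta. Proof. exact: addr_gt0. Qed.

Let nuhat u := k u * (gauss (s + eta) u)%:C.

Let nuhat_le u : normc (nuhat u) <= gauss (s + eta) u.
Proof.
rewrite normcM normc_real ger0_norm ?gauss_ge0// ler_piMl ?gauss_ge0//.
Qed.

Let p := inv_density nuhat.

Let mp : measurable_fun setT p.
Proof. exact: (measurable_inv_density nuE). Qed.

Let nup A : measurable A -> nu A = (\int[leb]_(x in A) (p x)%:E)%E.
Proof. exact: (inversion se0 nuE nuhat_le). Qed.

Let mk : cmeasurable k. Proof. by case: kP. Qed.

Let tp0 : 0 < @twopi R N.
Proof. by rewrite exprn_gt0// exprn_gt0// sqrtr_gt0 mulr_gt0// pi_gt0. Qed.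

(** Up to the constant [twopi], the inverse Fourier transform of
    [k * exp (- eta |.|^2)]. *)
Let qc (x : V) : R[i] :=
  cintegral leb setT (fun u => cis (- dot u x) * k u * (gauss eta u)%:C).

Let q (x : V) : R := (@twopi R N)^-1 * Re (qc x).

Let qc_ge0 x : 0 <= qc x. Proof. by have [_ _] := kP; exact. Qed.

Let q_ge0 x : 0 <= q x.
Proof.
have := qc_ge0 x; rewrite ge0_complexE => /andP[_ h].
by rewrite mulr_ge0// invr_ge0 ltW.
Qed.

Let qE x : (q x)%:C = ((@twopi R N)^-1)%:C * qc x.
Proof.
have := qc_ge0 x; rewrite ge0_complexE => /andP[/eqP h _].
apply: complex_eqP; first by rewrite Re_rmul.
by rewrite Im_rmul h mulr0.
Qed.

Let mF : cmeasurable (fun p : V * V =>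
  cis (- dot p.2 p.1) * k p.2 * (gauss eta p.2)%:C).
Proof.
apply: cmeasurableM.
  apply: cmeasurableM; last exact: (cmeasurable_comp mk measurable_snd).
  apply: cis_cmeasurable; apply: measurableT_comp => //.
  by apply: measurable_dot; [exact: measurable_snd|exact: measurable_fst].
apply: cmeasurable_real.
exact: (measurableT_comp (measurable_gauss eta) measurable_snd).
Qed.

Let mqc : cmeasurable qc.
Proof.
exact: (@cmeasurable_cintegral _ _ _ _ _ leb
  (fun x u => cis (- dot u x) * k u * (gauss eta u)%:C)).
Qed.

Let mq : measurable_fun setT q.
Proof. by apply: measurable_funM => //; have [m _] := mqc; exact: m. Qed.

Let Mq : R := (@twopi R N)^-1 * gaussK N eta.

Let q_le x : q x <= Mq.
Proof.
rewrite ler_wpM2l ?invr_ge0 ?(ltW tp0)//.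
apply: le_trans (ler_norm _) _; apply: le_trans (Re_le_normc _) _.
rewrite -Rintegral_gauss//; apply: normc_cintegral_le.
- exact: cmeasurable_fourier.
- exact: integrable_gauss.
- by move=> u; rewrite -[leRHS]mul1r; exact: normc_fourier.
Qed.

Let heatB x z : heat b (x - z : V) = heat b (z - x).
Proof. by rewrite /heat -gaussN opprB. Qed.

Let iheat x : leb.-integrable setT (EFin \o (fun z => heat b (x - z))).
Proof. exact: (integrable_reflect x (@integrable_heat R N b b0)). Qed.

Let mheat2 : measurable_fun setT (fun p : V * V => heat b (p.1 - p.2)).
Proof.
apply: (measurableT_comp (measurable_heat b)).
by apply: measurable_rVB; [exact: measurable_fst|exact: measurable_snd].
Qed.

Let hq0 (w z : V) : 0 <= heat b w * q z.
Proof. by apply: mulr_ge0 => //; exact: heat_ge0. Qed.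

Let iheatq x : leb.-integrable setT (EFin \o (fun z => heat b (x - z) * q z)).
Proof.
apply: (@integrable_le _ _ _ leb _ (fun z => Mq * heat b (x - z))).
- apply: measurable_funM => //.
  exact: (measurableT_comp (measurable_heat b) (measurable_reflect x)).
- by apply: integrable_scale; exact: iheat.
- move=> z; rewrite ger0_norm ?hq0// mulrC.
  by rewrite ler_wpM2r ?heat_ge0 ?q_le.
Qed.

(** Splitting off the Gaussian factor on the Fourier side is a convolution
    with the heat kernel. *)
Let p_heat x : p x = \int[leb]_z (heat b (x - z) * q z).
Proof.
apply: (@complexI R); rewrite /p (inv_densityE se0 nuE nuhat_le) -cintegral_real.
pose F z u := (heat b (x - z))%:C * (cis (- dot u z) * k u * (gauss eta u)%:C) : R[i].
rewrite [RHS](@eq_cintegral _ _ _ _ _ (fun z : V => ((@twopi R N)^-1)%:C * cintegral leb setT (F z))); last first.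
  move=> z; rewrite rmorphM /= qE /F cintegralZ; last exact: (cintegrable_fourier _ _ mk k1).
  by rewrite mulrCA.
have mFF : cmeasurable (fun p : V * V => F p.1 p.2).
  apply: cmeasurableM; last exact: mF.
  apply: cmeasurable_real; apply: (measurableT_comp (measurable_heat b)).
  by apply: measurable_rVB; [exact: measurable_cst|exact: measurable_fst].
have nF z u : normc (F z u) <= heat b (x - z) * gauss eta u.
  rewrite normcM normc_real ger0_norm ?heat_ge0// ler_wpM2l ?heat_ge0//.
  by rewrite -[leRHS]mul1r; exact: normc_fourier.
have iprod := integrable_prod (iheat x) (integrable_gauss N eta0).
have iF : cintegrable (leb \x leb)%E setT (fun p : V * V => F p.1 p.2).
  by apply: (@cintegrable_le _ _ _ (leb \x leb)%E _
    (fun p => heat b (x - p.1) * gauss eta p.2)).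
rewrite cintegralZ; last first.
  apply: (@cintegrable_le _ _ _ leb _ (fun z : V => heat b (x - z) * gaussK N eta)).
  - exact: (@cmeasurable_cintegral _ _ _ _ _ leb F).
  - rewrite (_ : (fun z => _) = (fun z => gaussK N eta * heat b (x - z))).
      by apply: integrable_scale; exact: iheat.
    by apply/funext => z; rewrite mulrC.
  - move=> z; rewrite -Rintegral_gauss// -RintegralZl//; last exact: integrable_gauss.
    apply: normc_cintegral_le => //.
      apply: (cmeasurable_comp mFF (h := fun u => (z, u))).
      exact: measurable_pair1.
    by apply: integrable_scale; exact: integrable_gauss.
rewrite cfubini//; congr (_ * _); apply: eq_cintegral => u.
rewrite /nuhat.
rewrite [RHS](@eq_cintegral _ _ _ _ _ (fun z : V => (k u * (gauss eta u)%:C) *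
    ((heat b (x - z))%:C * cis (- dot u z)))); last first.
  by move=> z; rewrite /F; move: (cis _) (k u) (_%:C) (_%:C) => e f g h; ring.
have mhc : cmeasurable (fun z : V => (heat b z)%:C * cis (dot u z)).
  apply: cmeasurableM; first by apply: cmeasurable_real; exact: measurable_heat.
  by apply: cis_cmeasurable; apply: measurable_dot; [exact: measurable_cst|exact: measurable_id].
have ihc : cintegrable leb setT (fun z : V => (heat b z)%:C * cis (dot u z)).
  apply: (@cintegrable_le _ _ _ leb _ (heat b)) => //; first exact: integrable_heat.
  by move=> z; rewrite normcM normc_cis mulr1 normc_real ger0_norm ?heat_ge0.
rewrite cintegralZ; last first.
  apply: (@cintegrable_le _ _ _ leb _ (fun z : V => heat b (x - z))) => //.
    apply: cmeasurableM.
      apply: cmeasurable_real.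
      exact: (measurableT_comp (measurable_heat b) (measurable_reflect x)).
    apply: cis_cmeasurable; apply: measurableT_comp => //.
    by apply: measurable_dot; [exact: measurable_cst|exact: measurable_id].
  by move=> z; rewrite normcM normc_cis mulr1 normc_real ger0_norm ?heat_ge0.
have -> : cintegral leb setT (fun z : V => (heat b (x - z))%:C * cis (- dot u z)) =
    cis (- dot u x) * (gauss s u)%:C.
  rewrite (@eq_cintegral _ _ _ _ _ (fun z : V => cis (- dot u x) *
      ((heat b (x - z))%:C * cis (dot u (x - z))))); last first.
    move=> z; rewrite [RHS]mulrCA -cisD; congr (_ * cis _).
    by rewrite dotDr dotNr addrA addNr add0r.
  rewrite cintegralZ; last first.
    apply: (@cintegrable_le _ _ _ leb _ (fun z : V => heat b (x - z))) => //.
      exact: (cmeasurable_comp mhc (measurable_reflect x)).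
    by move=> z; rewrite normcM normc_cis mulr1 normc_real ger0_norm ?heat_ge0.
  congr (_ * _); rewrite (cintegral_reflect x mhc).
  have K0 := gaussK_gt0 N b0.
  rewrite (@eq_cintegral _ _ _ _ _ (fun z : V => ((gaussK N b)^-1)%:C *
      (cis (dot u z) * (gauss b z)%:C))); last first.
    by move=> z; rewrite /heat rmorphM /=; move: (cis _) (_%:C) (_%:C) => e f g; ring.
  rewrite cintegralZ; last first.
    apply: (@cintegrable_le _ _ _ leb _ (gauss b)).
    - apply: cmeasurableM; last by apply: cmeasurable_real; exact: measurable_gauss.
      by apply: cis_cmeasurable; apply: measurable_dot; [exact: measurable_cst|exact: measurable_id].
    - exact: integrable_gauss.
    - by move=> z; rewrite normcM normc_cis mul1r normc_real ger0_norm ?gauss_ge0.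
  by rewrite cintegral_gauss// bE -rmorphM/= mulrA mulVf ?gt_eqF// mul1r.
rewrite gaussD rmorphM /=.
by move: (cis _) (k u) (_%:C) (_%:C) => e f g h; ring.
Qed.

Let p_heatE x : (p x)%:E = (\int[leb]_z (heat b (x - z) * q z)%:E)%E.
Proof. by rewrite p_heat /Rintegral fineK//; exact: integrable_fin_num (iheatq x). Qed.

Let Rheat z : (\int[leb]_x (heat b (x - z))%:E = 1)%E.
Proof.
under eq_integral do rewrite heatB.
have := ge0_integral_reflect z (f := EFin \o heat b).
rewrite /= => ->; last 2 first.
- by apply/measurable_EFinP; exact: measurable_heat.
- by move=> x; rewrite lee_fin heat_ge0.
have fi := @integrable_heat R N b b0.
by rewrite -[LHS]fineK ?(integrable_fin_num _ fi)//; congr (_%:E); exact: Rintegral_heat.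
Qed.

Let mhq : measurable_fun setT (fun p : V * V => heat b (p.1 - p.2) * q p.2).
Proof. by apply: measurable_funM => //; exact: (measurableT_comp mq measurable_snd). Qed.

Let int_hq z : (\int[leb]_x (heat b (x - z) * q z)%:E = (q z)%:E)%E.
Proof.
under eq_integral do rewrite mulrC EFinM.
rewrite ge0_integralZl//; first by rewrite Rheat mule1.
- apply/measurable_EFinP; apply: (measurableT_comp (measurable_heat b)).
  by apply: measurable_rVB; [exact: measurable_id|exact: measurable_cst].
- by move=> x _; rewrite lee_fin heat_ge0.
- by rewrite lee_fin.
Qed.

(** By Tonelli's theorem [1 = \int p = \int (heat b * q) = \int q]; the
    positivity of [q] is essential here. *)
Let int_q : (\int[leb]_z (q z)%:E = 1)%E.
Proof.
transitivity (nu setT); last exact: probability_setT.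
rewrite (nup measurableT).
under [RHS]eq_integral do rewrite p_heatE.
have H := @fubini_tonelli _ _ _ _ _ leb leb (fun p : V * V => (heat b (p.1 - p.2) * q p.2)%:E).
rewrite [RHS]H; last 2 first.
- exact/measurable_EFinP.
- by move=> x; rewrite lee_fin hq0.
by apply: eq_integral => z _; rewrite int_hq.
Qed.

Let iq : leb.-integrable setT (EFin \o q).
Proof.
apply/integrableP; split; first exact/measurable_EFinP.
under eq_integral do rewrite /= ger0_norm//.
by rewrite int_q ltry.
Qed.

Let ihq : (leb \x leb)%E.-integrable setT
  (EFin \o (fun p : V * V => heat b (p.1 - p.2) * q p.2)).
Proof.
apply/integrable21ltyP; first exact/measurable_EFinP.
have E z : (\int[leb]_x `|(EFin \o (fun p : V * V => (heat b (p.1 - p.2) * q p.2)%R)) (x, z)| =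
    (q z)%:E)%E.
  by rewrite -int_hq; apply: eq_integral => x _; rewrite /= ger0_norm ?hq0.
under eq_integral do rewrite E.
by rewrite int_q ltry.
Qed.

Let conv_heat (f : V -> R[i]) M x : cmeasurable f -> (forall y, normc (f y) <= M) ->
  Defs.conv nu f x = cintegral leb setT (fun y : V => (heat b (x - y))%:C *
    cintegral leb setT (fun z : V => f (y - z) * (q z)%:C)).
Proof.
move=> mf fM; have M0 : 0 <= M by apply: le_trans (fM 0); exact: normc_ge0.
have mfr (y : V) : cmeasurable (fun z : V => f (y - z)).
  exact: (cmeasurable_comp mf (measurable_reflect y)).
rewrite /Defs.conv (@cintegral_density R _ V leb nu p mp nup _ M (mfr x) (fun y => fM _)).
pose F (y z : V) := f (x - y) * (heat b (y - z) * q z)%:C.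
rewrite [LHS](@eq_cintegral _ _ _ _ _ (fun y => cintegral leb setT (F y))); last first.
  move=> y; rewrite /F p_heat -cintegral_real -cintegralZ//.
  by apply: cintegrable_le (iheatq y) _ => [|z];
    [apply: cmeasurable_real; exact/measurable_EFinP/measurable_int/(iheatq y)
    |rewrite normc_real ger0_norm ?hq0].
rewrite [LHS]cfubini; last first.
  apply: (@cintegrable_le _ _ _ (leb \x leb)%E _
    (fun p : V * V => M * (heat b (p.1 - p.2) * q p.2))).
  - apply: cmeasurableM; last exact: cmeasurable_real.
    exact: (cmeasurable_comp (mfr x) measurable_fst).
  - exact: integrable_scale.
  - move=> [y z] /=; rewrite /F normcM normc_real ger0_norm ?hq0//.
    by rewrite ler_wpM2r ?hq0.
pose G (z y : V) := f (y - z) * (heat b (x - y) * q z)%:C.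
rewrite [LHS](@eq_cintegral _ _ _ _ _ (fun z => cintegral leb setT (G z))); last first.
  move=> z; rewrite -(cintegral_reflect (x + z)).
    apply: eq_cintegral => y; rewrite /F /G.
    have -> : x - (x + z - y) = y - z by apply/rowP => i; rewrite !mxE; ring.
    by have -> : x + z - y - z = x - y by apply/rowP => i; rewrite !mxE; ring.
  apply: cmeasurableM.
    apply: (cmeasurable_comp mf).
    by apply: measurable_rVB; [exact: measurable_id|exact: measurable_cst].
  apply: cmeasurable_real; apply: measurable_funM => //.
  exact: (measurableT_comp (measurable_heat b) (measurable_reflect x)).
rewrite [LHS]cfubini; last first.
  apply: (@cintegrable_le _ _ _ (leb \x leb)%E _ (fun p : V * V => M * (q p.1 * heat b (x - p.2)))).
  - apply: cmeasurableM.
      apply: (cmeasurable_comp mf).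
      by apply: measurable_rVB; [exact: measurable_snd|exact: measurable_fst].
    apply: cmeasurable_real; apply: measurable_funM; last exact: (measurableT_comp mq measurable_fst).
    apply: (measurableT_comp (measurable_heat b)).
    by apply: measurable_rVB; [exact: measurable_cst|exact: measurable_snd].
  - by apply: integrable_scale; exact: (integrable_prod iq (iheat x)).
  - move=> [z y] /=; rewrite /G normcM normc_real ger0_norm ?hq0//.
    by rewrite [q z * _]mulrC ler_wpM2r ?hq0.
apply: eq_cintegral => y; rewrite -cintegralZ.
  by apply: eq_cintegral => z; rewrite /G rmorphM /= mulrCA mulrA.
apply: (@cintegrable_le _ _ _ leb _ (fun z => M * q z)).
- by apply: cmeasurableM => //; exact: cmeasurable_real.
- exact: integrable_scale.
- by move=> z; rewrite normcM normc_real ger0_norm// ler_wpM2r.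
Qed.

(** The function [g] is [q * f]: convolution is associative, and averages
    against the probability density [q] keep the bound [M]. *)
Lemma conv_is_heat (f : V -> R[i]) M : cmeasurable f -> (forall y, normc (f y) <= M) ->
  exists g : V -> R[i], [/\ cmeasurable g, forall y, normc (g y) <= M &
    forall x, Defs.conv nu f x = cintegral leb setT (fun y : V => (heat b (x - y))%:C * g y)].
Proof.
move=> mf fM; exists (fun y => cintegral leb setT (fun z : V => f (y - z) * (q z)%:C)).
have mfr (y : V) : cmeasurable (fun z : V => f (y - z)).
  exact: (cmeasurable_comp mf (measurable_reflect y)).
split.
- apply: (@cmeasurable_cintegral _ _ _ _ _ leb (fun y z : V => f (y - z) * (q z)%:C)).
  apply: cmeasurableM.
    apply: (cmeasurable_comp mf).
    by apply: measurable_rVB; [exact: measurable_fst|exact: measurable_snd].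
  by apply: cmeasurable_real; exact: (measurableT_comp mq measurable_snd).
- move=> y; have -> : M = \int[leb]_z (M * q z).
    by rewrite RintegralZl// /Rintegral int_q mulr1.
  apply: normc_cintegral_le.
  + by apply: cmeasurableM => //; exact: cmeasurable_real.
  + exact: integrable_scale.
  + by move=> z; rewrite normcM normc_real ger0_norm// ler_wpM2r.
- by move=> x; exact: conv_heat fM.
Qed.

Lemma nu_dominated : nu `<< leb.
Proof. exact: (density_dominates mp nup). Qed.

End factorisation.

(** * Power series and derivatives of exponential integrals *)

Section words.
Context {R : realType} {m : nat} {T : finType}.
Variable beta : T -> {ffun 'I_m -> nat}.

Definition weight (alpha : {ffun 'I_m -> nat}) := (\sum_j alpha j)%N.

(** Words of length [M] over a set [T] of monomials, with exponents [beta],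
    index the terms in the expansion of the power [M] of a polynomial. *)
Definition word_deg M (w : {ffun 'I_M -> T}) : {ffun 'I_m -> nat} :=
  [ffun j => (\sum_(i < M) beta (w i) j)%N].

Lemma leq_weight_word_deg M (w : {ffun 'I_M -> T}) :
  (forall t, (0 < weight (beta t))%N) -> (M <= weight (word_deg w))%N.
Proof.
move=> b0; rewrite /weight; under eq_bigr do rewrite ffunE.
rewrite exchange_big /= -[leqLHS]card_ord -sum1_card.
by apply: leq_sum => i _; exact: b0.
Qed.

Lemma monomial_word_deg M (w : {ffun 'I_M -> T}) (h : 'rV[R]_m) :
  monomial (word_deg w) h = \prod_(i < M) monomial (beta (w i)) h.
Proof.
rewrite /monomial exchange_big; apply: eq_bigr => j _.
by rewrite ffunE prodrXr.
Qed.

Lemma sum_exp_words M (x : T -> R[i]) :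
  (\sum_t x t) ^+ M = \sum_(w : {ffun 'I_M -> T}) \prod_(i < M) x (w i).
Proof. by rewrite -[M in LHS]card_ord -prodr_const bigA_distr_bigA. Qed.

(** All monomials here have positive degree, so on the cube of radius [r] they
    are at most [r]. *)
Lemma monomial_le (alpha : {ffun 'I_m -> nat}) (h : 'rV[R]_m) r :
  0 <= r -> r <= 1 -> (forall j, `|h 0 j| <= r) -> (0 < weight alpha)%N ->
  `|monomial alpha h| <= r.
Proof.
move=> r0 r1 hr a0; rewrite /monomial normr_prod.
apply: (@le_trans _ _ (\prod_j r ^+ alpha j)).
  apply: ler_prod => j _; rewrite normr_ge0 normrX/=.
  by apply: lerXn2r; rewrite ?nnegrE.
rewrite prodrXr -[leRHS]expr1; exact: ler_wiXn2l.
Qed.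

Lemma sum_geo2 K L : (K <= L)%N ->
  \sum_(K <= M < L) (2^-1 : R) ^+ M <= 2 * 2^-1 ^+ K.
Proof.
move=> KL; have -> : \sum_(K <= M < L) (2^-1 : R) ^+ M = 2 * 2^-1 ^+ K - 2 * 2^-1 ^+ L.
  elim: L KL => [|L ih] KL.
    by move: KL; rewrite leqn0 => /eqP ->; rewrite big_geq// subrr.
  have [->|nKL] := eqVneq K L.+1; first by rewrite big_geq// subrr.
  have {}KL : (K <= L)%N by move: KL; rewrite leq_eqVlt (negbTE nKL).
  rewrite big_nat_recr//= ih// exprS mulrA divff ?pnatr_eq0// mul1r.
  by ring.
by rewrite gerBl mulr_ge0// exprn_ge0.
Qed.

End words.

Section word_expansion.
Context {R : realType} {d : measure_display} {V : measurableType d}.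
Context {m : nat} {T : finType}.
Variables (mu : {sigma_finite_measure set V -> \bar R}).
Variable beta : T -> {ffun 'I_m -> nat}.
Hypothesis beta_gt0 : forall t, (0 < weight (beta t))%N.
Variables (w : V -> R[i]) (a : T -> V -> R[i]) (r : R).
Hypotheses (mw : cmeasurable w) (ma : forall t, cmeasurable (a t)).
Hypotheses (r0 : 0 < r) (r1 : r <= 1).

Let A z : R := r * \sum_t normc (a t z).

Hypothesis wA : mu.-integrable setT (EFin \o (fun z => normc (w z) * expR (3 * A z))).

Let A0 z : 0 <= A z.
Proof. by rewrite mulr_ge0 ?(ltW r0)// sumr_ge0// => t _; exact: normc_ge0. Qed.

Let W := \int[mu]_z (normc (w z) * expR (3 * A z)).

(** The sum over [M] may stop at the degree of [alpha], because every letter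
    has positive degree. *)
Definition word_coef (alpha : {ffun 'I_m -> nat}) : R[i] :=
  \sum_(0 <= M < (weight alpha).+1) \sum_(v : {ffun 'I_M -> T})
    (M`!%:R^-1 * (word_deg beta v == alpha)%:R)%:C *
    cintegral mu setT (fun z => w z * \prod_(i < M) a (v i) z).

Let iword M (v : {ffun 'I_M -> T}) :
  cintegrable mu setT (fun z => w z * \prod_(i < M) a (v i) z).
Proof.
have rM : 0 < r ^+ M by exact: exprn_gt0.
apply: (@cintegrable_le _ _ _ mu _
  (fun z => (r ^- M * M`!%:R) * (normc (w z) * expR (3 * A z)))).
- by apply: cmeasurableM => //; apply: cmeasurable_prod.
- exact: integrable_scale.
- move=> z; rewrite normcM mulrCA ler_wpM2l ?normc_ge0// normc_prod.
  apply: (@le_trans _ _ (\prod_(i < M) (r^-1 * A z))).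
    apply: ler_prod => i _; rewrite normc_ge0 /A mulKf ?gt_eqF//=.
    by rewrite (bigD1 (v i))//= lerDl sumr_ge0// => t _; exact: normc_ge0.
  rewrite prodr_const card_ord exprMn exprVn -mulrA ler_wpM2l ?invr_ge0 ?(ltW rM)//.
  rewrite -ler_pdivrMl ?ltr0n ?fact_gt0// mulrC.
  apply: le_trans (pow_fact_le_exp _ (A0 z)) _.
  by rewrite ler_expR; have := A0 z; lra.
Qed.

Lemma word_coefE alpha L : (weight alpha < L)%N -> word_coef alpha =
  \sum_(0 <= M < L) \sum_(v : {ffun 'I_M -> T})
    (M`!%:R^-1 * (word_deg beta v == alpha)%:R)%:C *
    cintegral mu setT (fun z => w z * \prod_(i < M) a (v i) z).
Proof.
move=> aL; rewrite (big_cat_nat _ aL)//= [X in _ + X]big1_seq ?addr0// => M.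
rewrite mem_index_iota => /andP[_ /andP[aM _]]; apply: big1 => v _.
case: eqP => [va|_]; last by rewrite mulr0 mul0r.
by move: aM; rewrite -va ltnNge leq_weight_word_deg.
Qed.

Variable h : 'rV[R]_m.
Hypothesis hr : forall j, `|h 0 j| <= r.

Let x t z := a t z * (monomial (beta t) h)%:C.

Let xA z : \sum_t normc (x t z) <= A z.
Proof.
rewrite /A mulr_sumr; apply: ler_sum => t _.
rewrite normcM normc_real mulrC ler_wpM2r ?normc_ge0//.
by apply: monomial_le => //; exact: ltW.
Qed.

Let partial (S : {fset {ffun 'I_m -> nat}}) L z : R[i] :=
  \sum_(0 <= M < L) \sum_(v : {ffun 'I_M -> T})
    (M`!%:R^-1 * (word_deg beta v \in S)%:R)%:C * (w z * \prod_(i < M) x (v i) z).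

Let integral_partial (S : {fset {ffun 'I_m -> nat}}) L :
  (forall alpha, alpha \in S -> (weight alpha < L)%N) ->
  cintegrable mu setT (partial S L) /\
  summability.partial_sum (fun alpha => word_coef alpha * (monomial alpha h)%:C) S =
  cintegral mu setT (partial S L).
Proof.
move=> SL.
pose F M (v : {ffun 'I_M -> T}) z :=
  (M`!%:R^-1 * (word_deg beta v \in S)%:R)%:C * (w z * \prod_(i < M) x (v i) z).
have FE M (v : {ffun 'I_M -> T}) : F M v = fun z =>
    ((M`!%:R^-1 * (word_deg beta v \in S)%:R)%:C * (monomial (word_deg beta v) h)%:C) *
     (w z * \prod_(i < M) a (v i) z).
  apply/funext => z; rewrite /F /x big_split/= monomial_word_deg rmorph_prod/=.
  by rewrite -[RHS]mulrA; congr (_ * _); rewrite [LHS]mulrA [LHS]mulrC.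
have iF M (v : {ffun 'I_M -> T}) : cintegrable mu setT (F M v).
  by rewrite FE; exact: cintegrableZ.
have iFM M : cintegrable mu setT (fun z => \sum_(v : {ffun 'I_M -> T}) F M v z) /\
    cintegral mu setT (fun z => \sum_(v : {ffun 'I_M -> T}) F M v z) =
    \sum_(v : {ffun 'I_M -> T}) cintegral mu setT (F M v).
  exact: cintegral_sum.
have [iL eL] := cintegral_sum (index_iota 0 L) (fun M => (iFM M).1).
split; first exact: iL.
rewrite [RHS]eL /summability.partial_sum.
under eq_bigr => alpha _ do rewrite (word_coefE (SL _ (fsvalP alpha))) mulr_suml.
rewrite exchange_big /=; apply: eq_bigr => M _.
rewrite (iFM M).2.
under eq_bigr => alpha _ do rewrite mulr_suml.
rewrite exchange_big /=; apply: eq_bigr => v _.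
rewrite FE cintegralZ; last exact: iword.
have [vS|vS] := boolP (word_deg beta v \in S).
  rewrite (bigD1 [` vS]%fset)//= eqxx [X in _ + X]big1 ?addr0; last first.
    move=> alpha /negP av; case: eqP => [e|_]; last by rewrite mulr0 !mul0r.
    by exfalso; apply: av; apply/eqP/val_inj.
  by rewrite -mulrA [_ * (monomial _ _)%:C]mulrC mulrA.
rewrite mulr0 !mul0r big1// => alpha _; case: eqP => [e|_]; last by rewrite mulr0 !mul0r.
by move: vS; rewrite e fsvalP.
Qed.

Let words_below K : {fset {ffun 'I_m -> nat}} :=
  [fset al | al in flatten [seq codom (@word_deg m T beta M) | M <- iota 0 K]]%fset.

Let words_belowP K M (v : {ffun 'I_M -> T}) : (M < K)%N -> word_deg beta v \in words_below K.
Proof.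
move=> MK; rewrite /words_below !inE /=; apply/flattenP.
exists (codom (@word_deg m T beta M)); last exact: codom_f.
by apply/mapP; exists M => //; rewrite mem_iota.
Qed.

(** Beyond length [K] the exponential series of [A z] is at most
    [2 * 2^-K * exp (2 A z)], since [A^M / M! <= 2^-M * exp (2 A)]. This bounds
    both the remainder of the exponential and the longer words whose exponent
    happens to lie in [S]. *)
Let partial_bound (S : {fset {ffun 'I_m -> nat}}) K L z : (words_below K `<=` S)%fset -> (K <= L)%N ->
  normc (partial S L z - w z * cexp (\sum_t x t z)) <=
  3 * 2^-1 ^+ K * (normc (w z) * expR (3 * A z)).
Proof.
move=> KS KL; set Q := \sum_t x t z.
have QA : normc Q <= A z by apply: le_trans (normc_sum _ _ _) (xA z).
have powA M : A z ^+ M / M`!%:R <= 2^-1 ^+ M * expR (2 * A z).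
  rewrite -[A z](mulKf (_ : 2 != 0)) ?pnatr_eq0// exprMn -mulrA.
  rewrite ler_wpM2l ?exprn_ge0 ?invr_ge0// mulKf ?pnatr_eq0//.
  by apply: pow_fact_le_exp; rewrite mulr_ge0.
pose tail := \sum_(K <= M < L) \sum_(v : {ffun 'I_M -> T})
    (M`!%:R^-1 * (word_deg beta v \in S)%:R)%:C * \prod_(i < M) x (v i) z.
have -> : partial S L z = w z * (cexp_trunc K Q + tail).
  rewrite /partial (big_cat_nat _ KL)//= mulrDr; congr (_ + _).
    rewrite /cexp_trunc mulr_sumr big_mkord; apply: eq_bigr => M _.
    rewrite sum_exp_words mulr_suml mulr_sumr; apply: eq_bigr => v _.
    rewrite (fsubsetP KS) ?words_belowP// mulr1.
    by rewrite mulrCA [X in w z * X]mulrC.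
  rewrite mulr_sumr; apply: eq_bigr => M _; rewrite mulr_sumr; apply: eq_bigr => v _.
  exact: mulrCA.
rewrite -mulrBr normcM mulrCA ler_wpM2l ?normc_ge0//.
have e3 : expR (2 * A z) <= expR (3 * A z) by rewrite ler_expR; have := A0 z; lra.
have htail : normc tail <= 2 * 2^-1 ^+ K * expR (3 * A z).
  apply: (@le_trans _ _ (\sum_(K <= M < L) 2^-1 ^+ M * expR (2 * A z))).
    apply: le_trans (normc_sum _ _ _) _; apply: ler_sum => M _.
    apply: le_trans (powA M).
    apply: le_trans (normc_sum _ _ _) _.
    apply: (@le_trans _ _ ((\sum_t normc (x t z)) ^+ M / M`!%:R)); last first.
      rewrite ler_wpM2r ?invr_ge0//; apply: lerXn2r; rewrite ?nnegrE//.
      by apply: sumr_ge0 => t _; exact: normc_ge0.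
    have -> : (\sum_t normc (x t z)) ^+ M =
        \sum_(v : {ffun 'I_M -> T}) \prod_(i < M) normc (x (v i) z).
      by rewrite -[M in LHS]card_ord -prodr_const bigA_distr_bigA.
    rewrite mulr_suml; apply: ler_sum => v _.
    rewrite normcM normc_prod normc_real mulrC ler_wpM2l//.
      by apply: prodr_ge0 => i _; exact: normc_ge0.
    by rewrite normrM normr_nat ger0_norm ?invr_ge0// ler_piMr ?invr_ge0// lern1 leq_b1.
  rewrite -mulr_suml; apply: ler_pM => //.
  - by apply: sumr_ge0 => M _; rewrite exprn_ge0 ?invr_ge0.
  - exact: sum_geo2.
have hQ : normc (cexp_trunc K Q - cexp Q) <= 2^-1 ^+ K * expR (3 * A z).
  rewrite normcBC; apply: le_trans (cexp_taylor K Q) _.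
  apply: (@le_trans _ _ (A z ^+ K / K`!%:R * expR (A z))).
    apply: ler_pM; rewrite ?divr_ge0 ?exprn_ge0 ?normc_ge0 ?expR_ge0 ?ler_expR//.
    by rewrite ler_wpM2r ?invr_ge0//; apply: lerXn2r; rewrite ?nnegrE ?normc_ge0.
  apply: (@le_trans _ _ (2^-1 ^+ K * expR (2 * A z) * expR (A z))).
    by rewrite ler_wpM2r ?expR_ge0.
  by rewrite -mulrA -expRD ler_wpM2l ?exprn_ge0 ?invr_ge0// ler_expR; lra.
rewrite addrAC; apply: le_trans (normcD _ _) _; apply: le_trans (lerD hQ htail) _.
by rewrite le_eqVlt; apply/orP; left; apply/eqP; ring.
Qed.

(** The integral of an exponential of a polynomial in [h] without constant
    term is the sum of a power series in [h]: expand each power of the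
    polynomial over the words in its monomials. The index set [S0] consists of
    the exponents of all short words, and any finite [S] that contains it gives
    an error that is uniform in [S]. *)
Lemma word_expansion e : 0 < e -> exists S0 : {fset {ffun 'I_m -> nat}},
  forall S, (S0 `<=` S)%fset ->
  normc (summability.partial_sum (fun alpha => word_coef alpha * (monomial alpha h)%:C) S -
    cintegral mu setT (fun z => w z * cexp (\sum_t x t z))) <= e.
Proof.
move=> e0.
have [K Ke] : exists K, 3 * 2^-1 ^+ K * W <= e.
  have : (fun K => 3 * 2^-1 ^+ K * W) @ \oo --> 3 * 0 * W.
    by apply: cvgMl; apply: cvgMr; apply: cvg_expr; rewrite ger0_norm; lra.
  rewrite mulr0 mul0r => /cvgr_le => /(_ e e0)[K _ hK].
  by exists K; exact: (hK K (leqnn K)).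
exists (words_below K) => S KS.
pose L := maxn K (\max_(alpha <- enum_fset S) weight alpha).+1.
have SL alpha : alpha \in S -> (weight alpha < L)%N.
  move=> aS; rewrite /L leq_max; apply/orP; right; rewrite ltnS.
  exact: (leq_bigmax_seq (F := @weight m)).
have KL : (K <= L)%N by rewrite /L leq_maxl.
have [iP ->] := integral_partial SL.
have mx t : cmeasurable (x t).
  by apply: cmeasurableM => //; exact: cmeasurable_cst.
have mE : cmeasurable (fun z => w z * cexp (\sum_t x t z)).
  by apply: cmeasurableM => //; apply: cmeasurable_cexp; exact: cmeasurable_sum.
have iE : cintegrable mu setT (fun z => w z * cexp (\sum_t x t z)).
  apply: (cintegrable_le mE wA) => z.
  rewrite normcM ler_wpM2l ?normc_ge0// normc_cexp ler_expR.
  apply: le_trans (ler_norm _) _; apply: le_trans (Re_le_normc _) _.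
  apply: le_trans (normc_sum _ _ _) _; apply: le_trans (xA z) _.
  by have := A0 z; lra.
have -> : cintegral mu setT (partial S L) - cintegral mu setT (fun z => w z * cexp (\sum_t x t z)) =
    cintegral mu setT (fun z => partial S L z + -1 * (w z * cexp (\sum_t x t z))).
  by rewrite cintegralD//; [rewrite cintegralZ// mulN1r|exact: cintegrableZ].
apply: le_trans Ke; rewrite /W -RintegralZl//.
apply: normc_cintegral_le.
- apply: cmeasurableD; first exact: cintegrable_cmeasurable iP.
  by apply: cmeasurableM; [exact: cmeasurable_cst|exact: mE].
- exact: integrable_scale.
- by move=> z; rewrite mulN1r; exact: partial_bound.
Qed.

End word_expansion.

Section partial_derivatives.
Context {R : realType} {N : nat}.

Lemma derive_quadratic (f : 'rV[R]_N -> R) x v c C r : 0 < r ->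
  (forall h, `|h| <= r -> `|f (h *: v + x) - f x - h * c| <= C * h ^+ 2) ->
  'D_v f x = c.
Proof.
move=> r0 hf; rewrite /derive; apply: cvg_lim => //.
apply/cvgrPdist_le => e e0.
have C0 : 0 <= C.
  have := hf r; rewrite gtr0_norm// lexx => /(_ isT) h.
  by rewrite -(@pmulr_lge0 _ (r ^+ 2)) ?exprn_gt0//; apply: le_trans h.
near=> h.
have h0 : h != 0 by near: h; exact: nbhs_dnbhs_neq.
have hr : `|h| <= r by near: h; apply: dnbhs0_le.
have he : `|h| <= e / (C + 1).
  by near: h; apply: dnbhs0_le; rewrite divr_gt0// ltr_wpDl.
have -> : c - h^-1 *: (f (h *: v + x) - f x) = - (h^-1 * (f (h *: v + x) - f x - h * c)).
  by rewrite /GRing.scale/= [in RHS]mulrBr mulKf// opprB.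
rewrite normrN normrM normfV ler_pdivrMl ?normr_gt0//.
apply: le_trans (hf h hr) _; rewrite -normr_id -real_normK ?num_real// expr2 mulrCA.
rewrite normr_id ler_wpM2l//; apply: (@le_trans _ _ ((C + 1) * `|h|)).
  by rewrite ler_wpM2r// lerDl.
by rewrite mulrC -ler_pdivlMr// ltr_wpDl.
Unshelve. all: by end_near. Qed.

Lemma cpartial_quadratic (f : 'rV[R]_N -> R[i]) x i c C r : 0 < r ->
  (forall h : R, `|h| <= r ->
    normc (f (h *: delta_mx 0 i + x) - f x - h%:C * c) <= C * h ^+ 2) ->
  cpartial i f x = c.
Proof.
move=> r0 hf; apply: complex_eqP; apply: (@derive_quadratic _ _ _ _ C r) => // h hr.
  apply: le_trans (hf h hr); rewrite -Re_rmul /= -!Re_opp -!Re_add.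
  exact: Re_le_normc.
apply: le_trans (hf h hr); rewrite -Im_rmul /= -!Im_opp -!Im_add.
exact: Im_le_normc.
Qed.

Context {d : measure_display} {V : measurableType d}.
Variables (mu : {sigma_finite_measure set V -> \bar R}).

(** Differentiation under the integral sign, from the second-order Taylor
    bound on the exponential. *)
Lemma cpartial_integral (F : 'rV[R]_N -> R[i]) x i (w l : V -> R[i]) (A : V -> R) r :
  0 < r -> r <= 1 -> cmeasurable w -> cmeasurable l ->
  (forall z, r * normc (l z) <= A z) ->
  mu.-integrable setT (EFin \o (fun z => normc (w z) * expR (3 * A z))) ->
  (forall h : R, F (h *: delta_mx 0 i + x) =
    cintegral mu setT (fun z => w z * cexp (h%:C * l z))) ->
  cintegrable mu setT (fun z => w z * l z) /\
  cpartial i F x = cintegral mu setT (fun z => w z * l z).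
Proof.
move=> r0 r1 mw ml lA wA FE.
have A0 z : 0 <= A z by apply: le_trans (lA z); rewrite mulr_ge0 ?normc_ge0 ?(ltW r0).
have iw : cintegrable mu setT w.
  apply: (cintegrable_le mw wA) => z; rewrite ler_peMr ?normc_ge0// -[leLHS](@expR0 R).
  by rewrite ler_expR mulr_ge0.
have iwl : cintegrable mu setT (fun z => w z * l z).
  apply: (@cintegrable_le _ _ _ mu _ (fun z => r^-1 * (normc (w z) * expR (3 * A z)))).
  - exact: cmeasurableM.
  - exact: integrable_scale.
  - move=> z; rewrite normcM mulrCA ler_wpM2l ?normc_ge0// ler_pdivlMl//.
    apply: le_trans (lA z) _; apply: le_trans (_ : expR (A z) <= _).
      by apply: le_trans (expR_ge1Dx _); rewrite lerDr.
    by rewrite ler_expR; have := A0 z; lra.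
have mE (h : R) : cmeasurable (fun z => w z * cexp (h%:C * l z)).
  apply: cmeasurableM => //; apply: cmeasurable_cexp.
  by apply: cmeasurableM => //; exact: cmeasurable_cst.
have lA1 (h : R) z : `|h| <= r -> normc (h%:C * l z) <= A z.
  move=> hr; apply: le_trans (lA z); rewrite normcM normc_real.
  by rewrite ler_wpM2r ?normc_ge0.
have iE (h : R) : `|h| <= r -> cintegrable mu setT (fun z => w z * cexp (h%:C * l z)).
  move=> hr; apply: (cintegrable_le (mE h) wA) => z.
  rewrite normcM ler_wpM2l ?normc_ge0// normc_cexp ler_expR.
  apply: le_trans (ler_norm _) _; apply: le_trans (Re_le_normc _) _.
  by apply: le_trans (lA1 h z hr) _; have := A0 z; lra.
split=> //; apply: (@cpartial_quadratic _ _ _ _ (r ^- 2 * \int[mu]_z (normc (w z) * expR (3 * A z))) r) => // h hr.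
have -> : F x = cintegral mu setT w.
  rewrite -[x]add0r -(scale0r (delta_mx 0 i)) FE; apply: eq_cintegral => z.
  by rewrite mul0r cexp0 mulr1.
rewrite FE -cintegralZ//.
have -> : cintegral mu setT (fun z => w z * cexp (h%:C * l z)) - cintegral mu setT w -
    cintegral mu setT (fun z => h%:C * (w z * l z)) =
    cintegral mu setT (fun z => (w z * cexp (h%:C * l z) + -1 * w z) + -1 * (h%:C * (w z * l z))).
  have i1 : cintegrable mu setT (fun z => w z * cexp (h%:C * l z) + -1 * w z).
    by apply: cintegrableD; [exact: iE|exact: cintegrableZ].
  have i2 : cintegrable mu setT (fun z => h%:C * (w z * l z)) by exact: cintegrableZ.
  rewrite cintegralD//; last exact: cintegrableZ.
  rewrite cintegralD//; [|exact: iE|exact: cintegrableZ].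
  by rewrite !cintegralZ// !mulN1r.
rewrite mulrAC -RintegralZl//.
apply: normc_cintegral_le.
- apply: cmeasurableD; last first.
    apply: cmeasurableM; first exact: cmeasurable_cst.
    by apply: cmeasurableM; [exact: cmeasurable_cst|exact: cmeasurableM].
  apply: cmeasurableD => //.
  by apply: cmeasurableM => //; exact: cmeasurable_cst.
- exact: integrable_scale.
- move=> z.
  have -> : w z * cexp (h%:C * l z) + -1 * w z + -1 * (h%:C * (w z * l z)) =
      w z * (cexp (h%:C * l z) - cexp_trunc 2 (h%:C * l z)).
    rewrite /cexp_trunc !big_ord_recr big_ord0/= fact0 invr1 expr0 expr1.
    by rewrite rmorph1; ring.
  rewrite normcM mulrCA ler_wpM2l ?normc_ge0//.
  apply: le_trans (cexp_taylor 2 _) _.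
  rewrite normcM normc_real.
  have -> : (`|h| * normc (l z)) ^+ 2 / 2`!%:R =
      (r ^- 2 * h ^+ 2) * ((r * normc (l z)) ^+ 2 / 2`!%:R).
    rewrite !exprMn real_normK ?num_real// -[in LHS](mulKf (_ : r ^+ 2 != 0) (normc (l z) ^+ 2)).
      by ring.
    by rewrite expf_neq0// gt_eqF.
  have rh0 : 0 <= r ^- 2 * h ^+ 2 by apply: mulr_ge0; rewrite ?invr_ge0 sqr_ge0.
  rewrite -[leLHS]mulrA ler_wpM2l//.
  apply: (@le_trans _ _ (expR (A z) * expR (A z))).
    apply: ler_pM; rewrite ?expR_ge0 ?divr_ge0 ?sqr_ge0//.
      apply: le_trans (pow_fact_le_exp 2 _) _; first by rewrite mulr_ge0 ?normc_ge0 ?(ltW r0).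
      by rewrite ler_expR.
    by rewrite ler_expR -normc_real -normcM lA1.
  by rewrite -expRD ler_expR; have := A0 z; lra.
Qed.

End partial_derivatives.

(** * The analytic extension of a Gaussian convolution *)

#[local] Existing Instance summability.totally_filter.

Section hermitian_form.
Context {R : realType} {n : nat}.
Local Notation V := 'rV[R]_(n + n).
Implicit Types X Y Z : V.

Definition rot X : V := row_mx (rsubmx X) (- lsubmx X).

Lemma rotD X Y : rot (X + Y) = rot X + rot Y.
Proof. by rewrite /rot !linearD add_row_mx. Qed.

Lemma rotZ (c : R) X : rot (c *: X) = c *: rot X.
Proof. by rewrite /rot !linearZ scale_row_mx. Qed.

Lemma dot_rowE X Y : dot X Y =
  dot (lsubmx X) (lsubmx Y) + dot (rsubmx X) (rsubmx Y).
Proof.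
by rewrite /dot [LHS]big_split_ord; congr (_ + _); apply: eq_bigr => i _; rewrite !mxE.
Qed.

Lemma dot_rot_self X : dot (rot X) X = 0.
Proof. by rewrite dot_rowE row_mxKl row_mxKr dotNl dotC subrr. Qed.

Lemma dot_rot_rot X : dot (rot X) (rot X) = dot X X.
Proof.
by rewrite !dot_rowE row_mxKl row_mxKr dotNl dotNr opprK addrC.
Qed.

(** The form [\sum_j X_j * conj Y_j] in the complex coordinates
    [X_j = x_j + i xi_j]; multiplication by [-i] is [rot]. *)
Definition herm X Y : R[i] := dot X Y +i* dot (rot X) Y.

Lemma hermDl X Y Z : herm (X + Y) Z = herm X Z + herm Y Z.
Proof. by rewrite /herm rotD !dotDl. Qed.

Lemma hermDr X Y Z : herm Z (X + Y) = herm Z X + herm Z Y.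
Proof. by rewrite /herm !dotDr. Qed.

Lemma hermZl (c : R) X Y : herm (c *: X) Y = c%:C * herm X Y.
Proof. by rewrite /herm rotZ !dotZl; apply: complex_eqP; rewrite ?Re_rmul ?Im_rmul. Qed.

Lemma hermZr (c : R) X Y : herm X (c *: Y) = c%:C * herm X Y.
Proof. by rewrite /herm !dotZr; apply: complex_eqP; rewrite ?Re_rmul ?Im_rmul. Qed.

Lemma herm_suml I (r : seq I) (F : I -> V) Y :
  herm (\sum_(i <- r) F i) Y = \sum_(i <- r) herm (F i) Y.
Proof.
apply: (big_morph (herm^~ Y)) => [? ?|]; first exact: hermDl.
by rewrite -(scale0r 0) hermZl mul0r.
Qed.

Lemma herm_sumr I (r : seq I) (F : I -> V) X :
  herm X (\sum_(i <- r) F i) = \sum_(i <- r) herm X (F i).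
Proof.
apply: (big_morph (herm X)) => [? ?|]; first exact: hermDr.
by rewrite -(scale0r 0) hermZr mul0r.
Qed.

Lemma herm_self X : herm X X = (dot X X)%:C.
Proof. by rewrite /herm dot_rot_self. Qed.

Lemma normc_herm X Y : normc (herm X Y) <= dot X X + dot Y Y.
Proof.
apply: le_trans (normc_le_ReIm _) _.
have := dot_le X Y; have := dot_le (rot X) Y; rewrite dot_rot_rot /=.
by move: (dot X X) (dot Y Y) => p q; lra.
Qed.

Lemma cmeasurable_herm d (T : measurableType d) (f g : T -> V) :
  measurable_fun setT f -> measurable_fun setT g ->
  cmeasurable (fun z => herm (f z) (g z)).
Proof.
move=> mf mg; split; first exact: measurable_dot.
apply: measurable_dot => //; apply: measurable_fun_rV => i.
case: (split_ordP i) => j ->.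
  under eq_fun do rewrite row_mxEl mxE.
  exact: measurable_rV_coord.
under eq_fun do rewrite row_mxEr !mxE.
by apply: measurableT_comp => //; exact: measurable_rV_coord.
Qed.

Local Notation e := (delta_mx 0).

Lemma dot_delta i X : dot (e i) X = X 0 i.
Proof.
rewrite /dot (bigD1 i)//= mxE !eqxx mul1r big1 ?addr0// => j ji.
by rewrite mxE (negbTE ji) andbF mul0r.
Qed.

Lemma rot_delta_r (j : 'I_n) : rot (e (rshift n j)) = e (lshift n j).
Proof.
apply/rowP => k; case: (split_ordP k) => l ->; rewrite ?row_mxEl ?row_mxEr !mxE /=.
  by rewrite !(inj_eq (@lshift_inj _ _)) !(inj_eq (@rshift_inj _ _)).
by rewrite eq_lrshift eq_rlshift oppr0.
Qed.

Lemma rot_delta_l (j : 'I_n) : rot (e (lshift n j)) = - e (rshift n j).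
Proof.
apply/rowP => k; case: (split_ordP k) => l ->; rewrite ?row_mxEl ?row_mxEr !mxE /=.
  by rewrite eq_rlshift eq_lrshift oppr0.
by rewrite !(inj_eq (@lshift_inj _ _)) !(inj_eq (@rshift_inj _ _)).
Qed.

Lemma herm_delta_l (j : 'I_n) Y :
  herm (e (rshift n j)) Y = 'i%C * herm (e (lshift n j)) Y.
Proof.
apply: complex_eqP; rewrite ?Re_imul ?Im_imul /= ?rot_delta_l ?rot_delta_r //.
by rewrite dotNl opprK.
Qed.

Lemma herm_delta_r (j : 'I_n) X :
  herm X (e (rshift n j)) = - ('i%C * herm X (e (lshift n j))).
Proof.
apply: complex_eqP; rewrite ?Re_opp ?Im_opp ?Re_imul ?Im_imul /=.
  by rewrite opprK !(dotC _ (e _)) !dot_delta row_mxEl mxE.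
by rewrite !(dotC _ (e _)) !dot_delta row_mxEr !mxE.
Qed.

End hermitian_form.

Section gaussian_extension.
Context {R : realType} {n : nat}.
Local Notation N := (n + n)%N.
Local Notation V := 'rV[R]_(n + n).
Local Notation leb := (lebesgue_rV N : {sigma_finite_measure set V -> \bar R}).
Variables (b M : R) (g : V -> R[i]).
Hypotheses (b0 : 0 < b) (mg : cmeasurable g) (gM : forall z, normc (g z) <= M).

Let M0 : 0 <= M.
Proof. by apply: le_trans (gM 0); exact: normc_ge0. Qed.

(** On the diagonal the form is [|X - z|^2] and the kernel is that of the
    convolution. *)
Definition ext_kernel (X Y z : V) : R[i] :=
  ((gaussK N b)^-1)%:C * cexp (- b%:C * herm (X - z) (Y - z)) * g z.

Definition gauss_ext (X Y : V) : R[i] := cintegral leb setT (ext_kernel X Y).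

Let mker X Y : cmeasurable (ext_kernel X Y).
Proof.
apply: cmeasurableM => //; apply: cmeasurableM; first exact: cmeasurable_cst.
apply: cmeasurable_cexp; apply: cmeasurableM; first exact: cmeasurable_cst.
by apply: cmeasurable_herm; exact: measurable_reflect.
Qed.

(** The real part of the form is a square centred at the midpoint. *)
Lemma dot_midpoint (X Y z : V) : let c := 2^-1 *: (X + Y) in
  dot (X - z) (Y - z) = dot (c - z) (c - z) - dot (X - Y) (X - Y) / 4.
Proof.
move=> /=; rewrite !dotE (dotC Y X) (dotC z X) (dotC z Y).
by move: (dot X X) (dot X Y) (dot X z) (dot Y Y) (dot Y z) (dot z z) => *; field.
Qed.

(** The quadratic growth of the coefficients is controlled by the exponent of
    the kernel itself. *)
Lemma dot_distances (X Y z : V) :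
  dot (X - z) (X - z) + dot (Y - z) (Y - z) =
  2 * dot (X - z) (Y - z) + dot (X - Y) (X - Y).
Proof.
rewrite !dotE (dotC Y X) (dotC z X) (dotC z Y).
by move: (dot X X) (dot X Y) (dot X z) (dot Y Y) (dot Y z) (dot z z) => *; ring.
Qed.

Lemma normc_ext_kernel X Y z :
  normc (ext_kernel X Y z) <= M / gaussK N b * expR (- b * dot (X - z) (Y - z)).
Proof.
have K0 := gaussK_gt0 N b0.
rewrite /ext_kernel 2!normcM normc_real ger0_norm ?invr_ge0 ?(ltW K0)// normc_cexp.
have -> : Re (- b%:C * herm (X - z) (Y - z)) = - b * dot (X - z) (Y - z).
  by rewrite mulNr Re_opp Re_rmul mulNr.
rewrite mulrC -[leRHS]mulrA; apply: ler_wpM2r => //.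
by rewrite mulr_ge0 ?expR_ge0// invr_ge0 ltW.
Qed.

Definition growth (X Y z : V) : R := 1 + dot (X - z) (X - z) + dot (Y - z) (Y - z).

Let measurable_growth X Y : measurable_fun setT (growth X Y).
Proof.
apply: measurable_funD; first apply: measurable_funD => //;
  by apply: measurable_dot; exact: measurable_reflect.
Qed.

(** The exponent of the kernel grows like [- b |z|^2] and that of the second
    factor like [6 r C |z|^2]; the choice of [r] makes [6 r C <= b / 2]. *)
Lemma integrable_ext_kernel (C : R) X Y : 0 <= C -> exists r : R, [/\ 0 < r, r <= 1 &
  leb.-integrable setT (EFin \o (fun z =>
    normc (ext_kernel X Y z) * expR (3 * (r * (C * growth X Y z)))))].
Proof.
move=> C0; have K0 := gaussK_gt0 N b0.
pose r := Num.min 1 (b / (12 * (C + 1))).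
have C10 : 0 < 12 * (C + 1) by rewrite mulr_gt0// ltr_wpDl.
have r0 : 0 < r by rewrite lt_min ltr01 divr_gt0.
have r1 : r <= 1 by rewrite ge_min lexx.
have rC : 12 * (r * C) <= b.
  have h : r * (12 * (C + 1)) <= b by rewrite -ler_pdivlMr// ge_min lexx orbT.
  by move: h r0; rewrite mulrCA mulrDr mulr1; move: (r * C) => p; lra.
pose c := 2^-1 *: (X + Y); pose D := dot (X - Y) (X - Y).
pose b' := b - 6 * (r * C).
have b'0 : 0 < b' by rewrite /b'; move: rC b0; move: (r * C) => p; lra.
exists r; split=> //.
apply: (@integrable_le _ _ _ leb _ (fun z =>
  (M / gaussK N b * expR (3 * (r * C) * (1 + D) + b' * (D / 4))) * gauss b' (c - z))).
- apply: measurable_funM; first exact: measurable_normc.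
  apply: measurableT_comp => //; apply: measurable_funM => //.
  by apply: measurable_funM => //; exact: measurable_funM.
- by apply: integrable_scale; apply: integrable_reflect; exact: integrable_gauss.
- move=> z; rewrite ger0_norm ?mulr_ge0 ?normc_ge0 ?expR_ge0//.
  apply: le_trans (ler_wpM2r (expR_ge0 _) (normc_ext_kernel X Y z)) _.
  rewrite -[leLHS]mulrA -[leRHS]mulrA ler_wpM2l ?divr_ge0 ?(ltW K0)//.
  rewrite /gauss -!expRD ler_expR /growth -addrA dot_distances dot_midpoint -/c -/D /b'.
  move: (dot (c - z) (c - z)) => q.
  by rewrite le_eqVlt; apply/orP; left; apply/eqP; field.
Qed.

Local Notation e := (delta_mx 0).

(** The increment of the exponent is a polynomial without constant term in
    [h = (h1, h2)]: linear terms in [h1] and in [h2], and mixed terms. The type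
    [index] enumerates these monomials. *)
Let unit_exp (i : 'I_(N + N)) : {ffun 'I_(N + N) -> nat} := [ffun j => (j == i) : nat].

Let index := ('I_N + 'I_N + 'I_N * 'I_N)%type.

Let exponent (t : index) : {ffun 'I_(N + N) -> nat} :=
  match t with
  | inl (inl i) => unit_exp (lshift N i)
  | inl (inr i) => unit_exp (rshift N i)
  | inr (i, j) => [ffun k => (unit_exp (lshift N i) k + unit_exp (rshift N j) k)%N]
  end.

Let coefficient X Y (t : index) (z : V) : R[i] :=
  match t with
  | inl (inl i) => - b%:C * herm (e i) (Y - z)
  | inl (inr i) => - b%:C * herm (X - z) (e i)
  | inr (i, j) => - b%:C * herm (e i) (e j)
  end.

Let weight_unit i : weight (unit_exp i) = 1%N.
Proof.
rewrite /weight (bigD1 i)//= big1 ?addn0 ?ffunE ?eqxx// => j ji.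
by rewrite ffunE (negbTE ji).
Qed.

Let weight_exponent t : (0 < weight (exponent t))%N.
Proof.
case: t => [[i|i]|[i j]]; rewrite ?weight_unit//.
rewrite /weight /=; under eq_bigr do rewrite ffunE.
by rewrite big_split /= -!/(weight _) !weight_unit.
Qed.

Let monomial_unit i (h : 'rV[R]_(N + N)) : monomial (unit_exp i) h = h 0 i.
Proof.
rewrite /monomial (bigD1 i)//= big1 ?mulr1 ?ffunE ?eqxx ?expr1// => j ji.
by rewrite ffunE (negbTE ji).
Qed.

Let monomial_exponent_pair i j (h : 'rV[R]_(N + N)) :
  monomial (exponent (inr (i, j))) h = h 0 (lshift N i) * h 0 (rshift N j).
Proof.
rewrite -(monomial_unit (lshift N i)) -(monomial_unit (rshift N j)) /monomial -big_split/=.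
by apply: eq_bigr => k _; rewrite !ffunE exprD.
Qed.

Let ext_kernel_shift X Y z (h : 'rV[R]_(N + N)) :
  ext_kernel (X + lsubmx h) (Y + rsubmx h) z = ext_kernel X Y z *
    cexp (\sum_t coefficient X Y t z * (monomial (exponent t) h)%:C).
Proof.
rewrite /ext_kernel -[RHS]mulrA [g z * _]mulrC [RHS]mulrA; congr (_ * _).
rewrite -[RHS]mulrA -cexpD; congr (_ * cexp _).
rewrite !big_sumType /=.
have -> : \sum_i - b%:C * herm (e i) (Y - z) * (monomial (unit_exp (lshift N i)) h)%:C =
    - b%:C * herm (lsubmx h) (Y - z).
  rewrite [in RHS](row_sum_delta (lsubmx h)) herm_suml mulr_sumr; apply: eq_bigr => i _.
  by rewrite hermZl monomial_unit mxE -mulrA [_ * herm _ _]mulrC.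
have -> : \sum_i - b%:C * herm (X - z) (e i) * (monomial (unit_exp (rshift N i)) h)%:C =
    - b%:C * herm (X - z) (rsubmx h).
  rewrite [in RHS](row_sum_delta (rsubmx h)) herm_sumr mulr_sumr; apply: eq_bigr => i _.
  by rewrite hermZr monomial_unit mxE -mulrA [_ * herm _ _]mulrC.
have -> : \sum_t coefficient X Y (inr t) z * (monomial (exponent (inr t)) h)%:C =
    - b%:C * herm (lsubmx h) (rsubmx h).
  have -> : herm (lsubmx h) (rsubmx h) = \sum_i \sum_j
      (lsubmx h 0 i)%:C * ((rsubmx h 0 j)%:C * herm (e i) (e j)).
    rewrite [X in herm X _]row_sum_delta herm_suml; apply: eq_bigr => i _.
    rewrite hermZl -mulr_sumr [X in herm _ X]row_sum_delta herm_sumr; congr (_ * _).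
    by apply: eq_bigr => j _; rewrite hermZr.
  rewrite pair_bigA /= mulr_sumr; apply: eq_bigr => -[i j] _.
  rewrite monomial_exponent_pair !mxE rmorphM /=.
  by move: (herm _ _) (_%:C) (_%:C) (- _%:C) => p q s t; ring.
rewrite -!mulrDr; congr (_ * _).
rewrite [X + _ - z]addrAC [Y + _ - z]addrAC.
rewrite (hermDl (X - z)) !(hermDr (Y - z)).
by rewrite -!addrA; congr (_ + _); rewrite addrCA.
Qed.

Let nI : R := #|{: index}|%:R.

Let coefficient_le X Y t z : normc (coefficient X Y t z) <= 2 * b * growth X Y z.
Proof.
have eb (p : R[i]) : normc p <= 2 * growth X Y z -> normc (- b%:C * p) <= 2 * b * growth X Y z.
  move=> h; rewrite normcM normc_opp normc_real gtr0_norm// [2 * b]mulrC -mulrA.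
  by rewrite ler_wpM2l// ltW.
have e1 (i : 'I_N) : dot (e i : V) (e i) = 1 by rewrite dot_delta mxE !eqxx.
have p0 := dot_ge0 (X - z); have q0 := dot_ge0 (Y - z).
case: t => [[i|i]|[i j]]; apply: eb.
- by apply: le_trans (normc_herm _ _) _; rewrite e1 /growth; lra.
- by apply: le_trans (normc_herm _ _) _; rewrite e1 /growth; lra.
- by apply: le_trans (normc_herm _ _) _; rewrite !e1 /growth; lra.
Qed.

Let mcoefficient X Y t : cmeasurable (coefficient X Y t).
Proof.
case: t => [[i|i]|[i j]]; (apply: cmeasurableM; first exact: cmeasurable_cst).
- by apply: cmeasurable_herm => //; exact: measurable_reflect.
- by apply: cmeasurable_herm => //; exact: measurable_reflect.
- exact: cmeasurable_cst.
Qed.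

Let sum_coefficient_le X Y z :
  \sum_t normc (coefficient X Y t z) <= nI * (2 * b) * growth X Y z.
Proof.
apply: (@le_trans _ _ (\sum_(t : index) (2 * b * growth X Y z))).
  by apply: ler_sum => t _; exact: coefficient_le.
by rewrite sumr_const -[leLHS]mulr_natl [leLHS]mulrA.
Qed.

Let small_radius X Y : exists r : R, [/\ 0 < r, r <= 1,
  leb.-integrable setT (EFin \o (fun z => normc (ext_kernel X Y z) *
     expR (3 * (r * \sum_t normc (coefficient X Y t z))))) &
  leb.-integrable setT (EFin \o (fun z => normc (ext_kernel X Y z) *
     expR (3 * (r * (nI * (2 * b) * growth X Y z)))))].
Proof.
have C0 : 0 <= nI * (2 * b) by rewrite mulr_ge0 ?ler0n// mulr_ge0// ltW.
have [r [r0 r1 ir]] := integrable_ext_kernel X Y C0.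
exists r; split=> //.
apply: integrable_le ir _ => [|z].
  apply: measurable_funM; first exact: measurable_normc.
  apply: measurableT_comp => //; apply: measurable_funM => //.
  apply: measurable_funM => //; apply: measurable_sum => t.
  exact: (measurable_normc (mcoefficient X Y t)).
rewrite ger0_norm ?mulr_ge0 ?normc_ge0 ?expR_ge0// ler_wpM2l ?normc_ge0// ler_expR.
by rewrite ler_wpM2l// ler_wpM2l ?(ltW r0).
Qed.

Lemma gauss_ext_analytic : creal_analytic
  (fun Z : 'rV[R]_(N + N) => gauss_ext (lsubmx Z) (rsubmx Z)).
Proof.
suff H Z : exists c : {ffun 'I_(N + N) -> nat} -> R[i], \forall h \near (0 : 'rV[R]_(N + N)),
    forall eps : R, 0 < eps -> exists S0 : {fset {ffun 'I_(N + N) -> nat}},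
    forall S, (S0 `<=` S)%fset ->
    normc (summability.partial_sum (fun alpha => c alpha * (monomial alpha h)%:C) S -
      gauss_ext (lsubmx (Z + h)) (rsubmx (Z + h))) <= eps.
  split=> Z; have [c hc] := H Z.
    exists (fun alpha => Re (c alpha)); apply: filterS hc => h hh.
    apply/cvgrPdist_le => eps e0; have [S0 hS] := hh eps e0.
    exists S0 => // S /= /hS; apply: le_trans; rewrite distrC.
    rewrite (_ : summability.partial_sum _ _ = Re (summability.partial_sum
      (fun alpha => c alpha * (monomial alpha h)%:C) S)); last first.
      rewrite /summability.partial_sum Re_sum; apply: eq_bigr => alpha _.
      by rewrite [in RHS]mulrC Re_rmul mulrC.
    set p := summability.partial_sum _ _.
  rewrite (_ : _ - _ = Re (p - gauss_ext (lsubmx (Z + h)) (rsubmx (Z + h)))).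
    exact: Re_le_normc.
  by rewrite Re_add Re_opp.
  exists (fun alpha => Im (c alpha)); apply: filterS hc => h hh.
  apply/cvgrPdist_le => eps e0; have [S0 hS] := hh eps e0.
  exists S0 => // S /= /hS; apply: le_trans; rewrite distrC.
  rewrite (_ : summability.partial_sum _ _ = Im (summability.partial_sum
    (fun alpha => c alpha * (monomial alpha h)%:C) S)); last first.
    rewrite /summability.partial_sum Im_sum; apply: eq_bigr => alpha _.
    by rewrite [in RHS]mulrC Im_rmul mulrC.
  set p := summability.partial_sum _ _.
  rewrite (_ : _ - _ = Im (p - gauss_ext (lsubmx (Z + h)) (rsubmx (Z + h)))).
    exact: Im_le_normc.
  by rewrite Im_add Im_opp.
set X := lsubmx Z; set Y := rsubmx Z.
have [r [r0 r1 ir _]] := small_radius X Y.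
exists (word_coef leb exponent (ext_kernel X Y) (coefficient X Y)).
near=> h => eps e0.
have hr j : `|h 0 j| <= r.
  apply: le_trans (_ : `|h| <= r); last by near: h; exact: (@nbhs0_le R 'rV[R]_(N + N) r r0).
  rewrite [leRHS]mx_normrE; exact: (le_bigmax _ (fun i => `|h i.1 i.2|) (0, j)).
have [S0 hS0] := word_expansion weight_exponent (mker X Y) (mcoefficient X Y)
  r0 r1 ir hr e0.
exists S0 => S /hS0; congr (normc (_ - _) <= _).
by apply: eq_cintegral => z; rewrite !linearD -/X -/Y ext_kernel_shift.
Unshelve. all: by end_near. Qed.

Let cpartial_ext_l X Y i :
  cintegrable leb setT (fun z => ext_kernel X Y z * (- b%:C * herm (e i) (Y - z))) /\
  cpartial i (gauss_ext^~ Y) X =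
  cintegral leb setT (fun z => ext_kernel X Y z * (- b%:C * herm (e i) (Y - z))).
Proof.
have [r [r0 r1 _ ir]] := small_radius X Y.
apply: (cpartial_integral r0 r1 (mker X Y) (mcoefficient X Y (inl (inl i))) _ ir).
  move=> z; rewrite ler_wpM2l ?(ltW r0)//.
  apply: le_trans (sum_coefficient_le X Y z).
  rewrite (bigD1 (inl (inl i)))//= lerDl.
  by apply: sumr_ge0 => t _; exact: normc_ge0.
move=> h; apply: eq_cintegral => z.
rewrite /ext_kernel -[RHS]mulrA [g z * _]mulrC [RHS]mulrA; congr (_ * _).
rewrite -[RHS]mulrA -cexpD; congr (_ * cexp _).
rewrite [h *: _ + X - z](_ : _ = (X - z) + h *: e i); last by rewrite -addrA addrC.
rewrite hermDl hermZl /coefficient.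
by move: (herm _ _) (herm _ _) (_%:C) (- _%:C) => p q s t; ring.
Qed.

Let cpartial_ext_r X Y i :
  cintegrable leb setT (fun z => ext_kernel X Y z * (- b%:C * herm (X - z) (e i))) /\
  cpartial i (gauss_ext X) Y =
  cintegral leb setT (fun z => ext_kernel X Y z * (- b%:C * herm (X - z) (e i))).
Proof.
have [r [r0 r1 _ ir]] := small_radius X Y.
apply: (cpartial_integral r0 r1 (mker X Y) (mcoefficient X Y (inl (inr i))) _ ir).
  move=> z; rewrite ler_wpM2l ?(ltW r0)//.
  apply: le_trans (sum_coefficient_le X Y z).
  rewrite (bigD1 (inl (inr i)))//= lerDl.
  by apply: sumr_ge0 => t _; exact: normc_ge0.
move=> h; apply: eq_cintegral => z.
rewrite /ext_kernel -[RHS]mulrA [g z * _]mulrC [RHS]mulrA; congr (_ * _).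
rewrite -[RHS]mulrA -cexpD; congr (_ * cexp _).
rewrite [h *: _ + Y - z](_ : _ = (Y - z) + h *: e i); last by rewrite -addrA addrC.
rewrite hermDr hermZr /coefficient.
by move: (herm _ _) (herm _ _) (_%:C) (- _%:C) => p q s t; ring.
Qed.

(** Differentiating the kernel produces the value of the form at a basis
    vector, and the form is complex linear in [X] and antilinear in [Y]. *)
Lemma gauss_ext_holomorphic X Y (j : 'I_n) :
  cpartial (lshift n j) (gauss_ext^~ Y) X
    + 'i%C * cpartial (rshift n j) (gauss_ext^~ Y) X = 0 /\
  cpartial (lshift n j) (gauss_ext X) Y
    - 'i%C * cpartial (rshift n j) (gauss_ext X) Y = 0.
Proof.
have ii : 'i%C * 'i%C = -1 :> R[i] by rewrite -expr2 sqr_i.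
have [i1 e1] := cpartial_ext_l X Y (lshift n j).
have [_ e2] := cpartial_ext_l X Y (rshift n j).
have [i3 e3] := cpartial_ext_r X Y (lshift n j).
have [_ e4] := cpartial_ext_r X Y (rshift n j).
split.
  rewrite e1 e2 (@eq_cintegral _ _ _ _ (fun z => ext_kernel X Y z * (- b%:C * herm (e (rshift n j)) (Y - z)))
    (fun z => 'i%C * (ext_kernel X Y z * (- b%:C * herm (e (lshift n j)) (Y - z))))).
    by rewrite cintegralZ// mulrA ii mulN1r subrr.
  by move=> z; rewrite herm_delta_l; move: (ext_kernel _ _ _) (herm _ _) (_%:C) => p q s; ring.
rewrite e3 e4 (@eq_cintegral _ _ _ _ (fun z => ext_kernel X Y z * (- b%:C * herm (X - z) (e (rshift n j))))
  (fun z => - 'i%C * (ext_kernel X Y z * (- b%:C * herm (X - z) (e (lshift n j)))))).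
  by rewrite cintegralZ// mulrA mulrN ii opprK mul1r subrr.
by move=> z; rewrite herm_delta_r; move: (ext_kernel _ _ _) (herm _ _) (_%:C) => p q s; ring.
Qed.

Lemma gauss_ext_diag X : gauss_ext X X =
  cintegral leb setT (fun z : V => (heat b (X - z))%:C * g z).
Proof.
apply: eq_cintegral => z; rewrite /ext_kernel herm_self; congr (_ * _).
by rewrite -rmorphN -rmorphM /= cexp_real -rmorphM /= mulrC.
Qed.

Lemma gauss_ext_le X Y : normc (gauss_ext X Y) <= M * expR (b / 4 * dot (X - Y) (X - Y)).
Proof.
have K0 := gaussK_gt0 N b0; pose c := 2^-1 *: (X + Y).
have E : M * expR (b / 4 * dot (X - Y) (X - Y)) =
    \int[leb]_z (M / gaussK N b * expR (b / 4 * dot (X - Y) (X - Y)) * gauss b (c - z)).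
  have ig : leb.-integrable setT (EFin \o (fun z => gauss b (c - z))).
    by apply: integrable_reflect; exact: integrable_gauss.
  rewrite RintegralZl// (Rintegral_reflect c (measurable_gauss b)) Rintegral_gauss//.
  by field; rewrite gt_eqF.
rewrite E; apply: normc_cintegral_le => //.
  by apply: integrable_scale; apply: integrable_reflect; exact: integrable_gauss.
move=> z; apply: le_trans (normc_ext_kernel X Y z) _.
rewrite -[leRHS]mulrA ler_wpM2l ?divr_ge0 ?(ltW K0)//.
rewrite /gauss -expRD ler_expR dot_midpoint -/c.
move: (dot (c - z) (c - z)) (dot (X - Y) (X - Y)) => q p.
by rewrite le_eqVlt; apply/orP; left; apply/eqP; field.
Qed.

(** By [gauss_ext_le] the extension is bounded by [exp (b / 4 * |X - Y|^2)], and
    [b * kappa < 1] leaves an integrable Gaussian to serve as [psi]. *)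
Lemma heat_Dspace (kappa : R) (F : V -> R[i]) : 0 < kappa -> b * kappa < 1 ->
  (forall X, F X = cintegral leb setT (fun z : V => (heat b (X - z))%:C * g z)) ->
  Dspace kappa F.
Proof.
move=> k0 bk FE; exists gauss_ext; split.
- exact: gauss_ext_analytic.
- exact: gauss_ext_holomorphic.
- by move=> X; rewrite gauss_ext_diag FE.
pose c := (4 * kappa)^-1 - b / 4.
have c0 : 0 < c.
  by rewrite subr_gt0 ltr_pdivrMr// invfM mulrAC mulVf ?pnatr_eq0// mul1r -[ltRHS]mul1r ltr_pdivlMr.
have mpsi : measurable_fun setT (fun w : V => M * gauss c w).
  by apply: measurable_funM => //; exact: measurable_gauss.
exists (fun w => M * gauss c w); split.
- by apply/Lfun1_integrable; apply: integrable_scale; exact: integrable_gauss.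
- apply/andP; split; apply/asboolP; first exact: mpsi.
  rewrite /= /finite_norm unlock /Lnorm; case: ifPn => // _.
  apply: (@le_lt_trans _ _ M%:E); last exact: ltry.
  apply/ess_supP; apply: aeW => w /=; rewrite lee_fin ger0_norm.
    by rewrite ler_piMr// gauss_le1// ltW.
  by rewrite mulr_ge0// gauss_ge0.
- move=> X Y; apply: le_trans (gauss_ext_le X Y) _; rewrite enorm_sqr mulrCA.
  rewrite ler_wpM2l// /gauss -expRD ler_expR /c.
  move: (dot _ _) => q.
  by rewrite le_eqVlt; apply/orP; left; apply/eqP; ring.
Qed.

End gaussian_extension.

(** * Convolution with the law of a Lévy process *)

Section ae_equal.
Context {R : realType} {d : measure_display} {T : measurableType d}.
Variable mu : {measure set T -> \bar R}.
Local Notation Int f := (mu.-integrable setT (EFin \o f)).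

Lemma integrable_ae (f g : T -> R) : measurable_fun setT f -> Int g ->
  (\forall x \ae mu, f x = g x) -> Int f.
Proof.
move=> mf ig fg; have /integrableP[mg goo] := ig.
have mF : measurable_fun setT (EFin \o f) by exact/measurable_EFinP.
apply/integrableP; split => //.
rewrite (_ : integral _ _ _ = \int[mu]_x `|(EFin \o g) x|)%E//.
apply: ae_eq_integral => //; [exact: measurableT_comp|exact: measurableT_comp|].
by apply: filterS fg => x /= fgx _; rewrite fgx.
Qed.

Lemma Rintegral_ae (f g : T -> R) : measurable_fun setT f -> measurable_fun setT g ->
  (\forall x \ae mu, f x = g x) -> \int[mu]_x f x = \int[mu]_x g x.
Proof.
move=> mf mg fg; rewrite /Rintegral; congr fine; apply: ae_eq_integral => //.
- exact/measurable_EFinP.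
- exact/measurable_EFinP.
- by apply: filterS fg => x /= fgx _; rewrite fgx.
Qed.

Lemma cintegrable_ae (f g : T -> R[i]) : cmeasurable f -> cintegrable mu setT g ->
  (\forall x \ae mu, f x = g x) -> cintegrable mu setT f.
Proof.
move=> [f1 f2] [g1 g2] fg; split.
  by apply: (integrable_ae f1 g1); apply: filterS fg => x /= ->.
by apply: (integrable_ae f2 g2); apply: filterS fg => x /= ->.
Qed.

Lemma cintegral_ae (f g : T -> R[i]) : cmeasurable f -> cmeasurable g ->
  (\forall x \ae mu, f x = g x) -> cintegral mu setT f = cintegral mu setT g.
Proof.
move=> [f1 f2] [g1 g2] fg; apply: complex_eqP.
  by apply: (Rintegral_ae f1 g1); apply: filterS fg => x /= ->.
by apply: (Rintegral_ae f2 g2); apply: filterS fg => x /= ->.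
Qed.

End ae_equal.

Section essentially_bounded.
Context {R : realType} {N : nat}.
Local Notation V := 'rV[R]_N.
Local Notation leb := (lebesgue_rV N : {sigma_finite_measure set V -> \bar R}).

Lemma Lfun_infty_bounded (h : V -> R) : h \in Lfun (leb : measure _ _) +oo%E ->
  exists M, \forall x \ae leb, `|h x| <= M.
Proof.
move=> /andP[_ /asboolP] /=; rewrite /finite_norm unlock /Lnorm.
case: ifPn => [_|leb0 _].
  by move=> /ess_supr_bounded.
exists 0; exists setT; split=> //.
by apply/eqP; move: leb0; rewrite lt_neqAle measure_ge0 andbT negbK eq_sym.
Qed.

(** Set [f] to zero where its modulus exceeds the essential bound. *)
Lemma Linfty_bounded (f : V -> R[i]) : Linfty f -> exists f0 M,
  [/\ cmeasurable f0, forall x, normc (f0 x) <= M & \forall x \ae leb, f x = f0 x].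
Proof.
move=> [mf /Lfun_infty_bounded[M hM]].
have M0 : 0 <= Num.max M 0 by rewrite le_max lexx orbT.
pose A := [set x | normc (f x) <= M].
have mA : measurable A.
  rewrite -[A]setTI; have := measurable_normc mf measurableT (measurable_itv `]-oo, M]).
  by congr measurable; apply/seteqP; split => x /=; rewrite in_itv.
exists (fun x => (\1_A x)%:C * f x), (Num.max M 0); split.
- apply: cmeasurableM => //; apply: cmeasurable_real; exact: measurable_indic.
- move=> x; rewrite normcM normc_real /indic; case: (boolP (x \in A)) => [|_].
    by rewrite inE /A /= normr1 mul1r => /le_trans; apply; rewrite le_max lexx.
  by rewrite normr0 mul0r.
- apply: filterS hM => x; rewrite ger0_norm ?normc_ge0// => h.
  by rewrite /indic mem_set// mul1r.
Qed.

Variable nu : probability V R.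
Hypothesis nu_leb : nu `<< leb.

(** Reflections preserve Lebesgue null sets, hence [nu]-null sets. *)
Lemma ae_reflect (f g : V -> R[i]) x : (\forall y \ae leb, f y = g y) ->
  \forall y \ae nu, f (x - y) = g (x - y).
Proof.
move=> [A [mA A0 fgA]]; exists ((fun y => x - y) @^-1` A); split.
- by rewrite -[X in measurable X]setTI; exact: measurable_reflect.
- move/null_content_dominatesP : nu_leb; apply.
    by rewrite -[X in measurable X]setTI; exact: measurable_reflect.
  have mB : measurable ((fun y => x - y) @^-1` A).
    by rewrite -[X in measurable X]setTI; exact: measurable_reflect.
  transitivity (\int[leb]_y (\1_A (x - y)%R)%:E)%E.
    by rewrite -[LHS]/(leb _) -[X in leb X]setIT -integral_indic.
  rewrite (ge0_integral_reflect x (f := fun y => (\1_A y)%:E)).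
  - by rewrite integral_indic// setIT.
  - by apply/measurable_EFinP; exact: measurable_indic.
  - by move=> y; rewrite lee_fin.
- by move=> y /= fgy; apply: fgA.
Qed.

(** Since [nu] does not charge Lebesgue null sets, only bounded functions
    matter. *)
Lemma conv_maps_bounded (D : (V -> R[i]) -> Prop) :
  (forall f M, cmeasurable f -> (forall y, normc (f y) <= M) -> D (Defs.conv nu f)) ->
  conv_maps_Linfty_into nu D.
Proof.
move=> hD.
have mfr (f : V -> R[i]) x : cmeasurable f -> cmeasurable (fun y : V => f (x - y)).
  by move=> mf; exact: (cmeasurable_comp mf (measurable_reflect x)).
have conv_ae f g : Linfty f -> cmeasurable g -> (\forall x \ae leb, f x = g x) ->
    Defs.conv nu f = Defs.conv nu g.
  move=> [mf _] mg fg; apply/funext => x.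
  by apply: cintegral_ae; [exact: mfr|exact: mfr|exact: ae_reflect].
split.
- move=> f fi x; have [f0 [M [mf0 f0M ff0]]] := Linfty_bounded fi.
  apply: cintegrable_ae (ae_reflect x ff0).
    by case: fi => mf _; exact: mfr.
  exact: (@finite_cintegrable _ _ _ nu _ M (mfr f0 x mf0) (fun y => f0M _)).
- by move=> f g fi [mg _]; exact: conv_ae.
- move=> f fi; have [f0 [M [mf0 f0M ff0]]] := Linfty_bounded fi.
  by rewrite (conv_ae f f0)//; exact: hD f0M.
Qed.

End essentially_bounded.

Section levy_khintchine.
Context {R : realType} {N : nat}.
Local Notation V := 'rV[R]_N.
Variables (m : V) (a : 'M[R]_N) (rho : {measure set V -> \bar R}) (delta : R).
Hypotheses (aT : a^T = a) (rhoP : levy_measure rho).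
Hypothesis a_delta : forall u, delta * enorm u ^+ 2 <= 2^-1 * dot (mxact a u) u.

Lemma dot_mxactC u v : dot (mxact a u) v = dot u (mxact a v).
Proof.
rewrite /dot /mxact aT; under eq_bigr do rewrite mxE mulr_suml.
under [RHS]eq_bigr do rewrite mxE mulr_sumr.
rewrite exchange_big; apply: eq_bigr => i _; apply: eq_bigr => j _.
by rewrite -[a in LHS]aT mxE -mulrA [a _ _ * _]mulrC.
Qed.

(** Twice the form that remains of the diffusion after the Gaussian
    [exp (- delta |u|^2)] has been split off. *)
Let excess u v : R := dot (mxact a u) v - 2 * delta * dot u v.

Let psd_excess : psd_form excess.
Proof.
split.
- by move=> u v; rewrite /excess dot_mxactC dotC (dotC u).
- move=> c u v w; rewrite /excess !dotDr !dotZr; ring.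
- move=> u; have := a_delta u; rewrite enorm_sqr /excess; lra.
Qed.

Lemma normc_cexp_jump t u : 0 <= t -> normc (cexp (t%:C * jump_exponent rho u)) <= 1.
Proof.
move=> t0; rewrite normc_cexp -[leRHS]expR0 ler_expR Re_rmul.
rewrite mulr_ge0_le0//.
have -> : Re (jump_exponent rho u) = - \int[rho]_(y in ~` [set 0]) (- Re (jump u y)).
  rewrite /Rintegral -fineN -integral_ge0N => [|y _].
    by congr fine; apply: eq_integral => y _; rewrite -EFinN opprK.
  by rewrite lee_fin oppr_ge0; exact: Re_jump_le0.
by rewrite oppr_le0; apply: Rintegral_ge0 => y _; rewrite oppr_ge0; exact: Re_jump_le0.
Qed.

(** The factor [k] is the Lévy-Khintchine exponential of the drift, of the
    nonnegative form [excess] and of the jumps; each of the three preserves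
    positive type. *)
Lemma levy_factor t eta : 0 <= t -> 0 < eta -> exists k : V -> R[i],
  [/\ positive_type eta k, forall u, normc (k u) <= 1 &
  forall u, cexp (t%:C * levy_exponent m a rho u) = k u * (gauss (delta * t) u)%:C].
Proof.
move=> t0 eta0; have [ws wsE] := psd_sum_squares psd_excess.
pose ts := [seq Num.sqrt t *: w | w <- ws].
have tsE u : \sum_(w <- ts) dot w u ^+ 2 = t * excess u u.
  rewrite wsE big_map mulr_sumr; apply: eq_bigr => w _.
  by rewrite dotZl exprMn sqr_sqrtr.
pose k u := (1 * (expR (- (\sum_(w <- ts) dot w u ^+ 2) / 2))%:C) * cis (dot u (t *: m)) *
  cexp (t%:C * jump_exponent rho u).
exists k; split.
- apply: positive_type_jump => //; apply: positive_type_shift => //.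
  by apply: positive_type_gauss_seq => //; exact: positive_type1.
- move=> u; rewrite /k mul1r 2!normcM normc_cis mulr1 normc_real ger0_norm ?expR_ge0//.
  rewrite -[leRHS]mulr1; apply: ler_pM; rewrite ?expR_ge0 ?normc_ge0//.
    rewrite -[leRHS]expR0 ler_expR mulNr oppr_le0 divr_ge0// sumr_ge0// => w _.
    exact: sqr_ge0.
  exact: normc_cexp_jump.
- move=> u; rewrite /k mul1r /cis /gauss -!cexp_real -!cexpD; congr cexp.
  rewrite tsE /excess /levy_exponent -/(jump_exponent rho u).
  rewrite dotZr (dotC u m).
  move: (jump_exponent rho u) (dot (mxact a u) u) (dot u u) (dot m u) => J p q r.
  apply: complex_eqP; rewrite !(Re_rmul, Im_rmul, Re_add, Im_add, Re_opp, Im_opp, Re_imul, Im_imul) /=.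
    by field.
  by ring.
Qed.

End levy_khintchine.

Theorem theorem2p19 (R : realType) (n : nat)
  (d : measure_display) (Omega : measurableType d) (P : probability Omega R)
  (X : R -> {RV P >-> 'rV[R]_(n + n)})
  (m : 'rV[R]_(n + n)) (a : 'M[R]_(n + n))
  (rho : {measure set 'rV[R]_(n + n) -> \bar R})
  (delta eps : R) :
  levy_process X ->
  a^T = a ->
  (forall u, 0 <= dot (mxact a u) u) ->
  levy_measure rho ->
  (forall t u, 0 <= t ->
     cintegral P setT (fun w => cexp ('i%C * (dot (X t w) u)%:C)) =
     cexp (t%:C * levy_exponent m a rho u)) ->
  0 < delta ->
  (forall u, delta * enorm u ^+ 2 <= 2^-1 * dot (mxact a u) u) ->
  0 < eps -> eps < 4 * delta ->
  forall t, 0 < t ->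
    conv_maps_Linfty_into (distribution P (X t)) (Dspace (eps * t)).
Proof.
move=> _ aT _ rhoP XE delta0 a_delta eps0 eps_delta t t0.
pose s := (eps * t / 4 + delta * t) / 2; pose eta := delta * t - s.
have et0 : 0 < eps * t by exact: mulr_gt0.
have ed : eps * t / 4 < delta * t.
  by rewrite ltr_pdivrMr// mulrAC ltr_pM2r// mulrC.
have s0 : 0 < s by rewrite /s; move: ed et0; lra.
have eta0 : 0 < eta by rewrite /eta /s; move: ed et0; lra.
(* [s] is the midpoint of the interval from [eps * t / 4] to [delta * t]. *)
have bs : (4 * s)^-1 * (eps * t) < 1.
  rewrite mulrC ltr_pdivrMr ?mul1r; last by rewrite mulr_gt0.
  by rewrite /s; move: ed et0; lra.
have [k [kP k1 kE]] := levy_factor m aT rhoP a_delta (ltW t0) eta0.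
pose nu : probability 'rV[R]_(n + n) R := distribution P (X t).
have nuE u : cintegral nu setT (fun y => cis (dot y u)) = k u * (gauss (s + eta) u)%:C.
  have mc : cmeasurable (fun y : 'rV[R]_(n + n) => cis (dot y u)).
    by apply: cis_cmeasurable; apply: measurable_dot; [exact: measurable_id|exact: measurable_cst].
  have mcX : cmeasurable (fun w => cis (dot (X t w) u)).
    exact: (cmeasurable_comp mc (measurable_funPT (X t))).
  have n1 w : normc (cis (dot (X t w) u)) <= 1 by rewrite normc_cis.
  have [i1 i2] := @finite_cintegrable _ _ _ P _ 1 mcX n1.
  have -> : s + eta = delta * t by rewrite /eta addrC subrK.
  rewrite -kE.
  transitivity (cintegral P setT (fun w => cis (dot (X t w) u))); last exact: (XE t u (ltW t0)).
  case: mc => mc1 mc2; rewrite /cintegral /Rintegral.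
  congr (fine _ +i* fine _).
    apply: (integral_distribution (X := X t) (f := fun y => (Re (cis (dot y u)))%:E) _ i1).
    exact/measurable_EFinP.
  apply: (integral_distribution (X := X t) (f := fun y => (Im (cis (dot y u)))%:E) _ i2).
  exact/measurable_EFinP.
apply: (conv_maps_bounded (nu := nu) (nu_dominated s0 eta0 k1 nuE)) => f M mf fM.
have [g [mg gM gE]] := conv_is_heat s0 eta0 kP k1 nuE mf fM.
by apply: (heat_Dspace _ mg gM et0 bs gE); rewrite invr_gt0 mulr_gt0.
Qed.
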